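(* Let $n\ge2$ and $M\ge2$ be integers, let $s\in[-1,1)$, and let $h\in\mathcal{AM}([-1,1])$. Let $m=2k-1+\varepsilon$ ($\varepsilon\in\{0,1\}$) be such that $s\in I_m$, and let $f_m^{(n,s)}=\sum_{i=0}^m\ell_iP_i^{(n)}$, the multiset $T$, the Hermite interpolant $g_T=\sum_{i=0}^{\deg(g_T)}g_iP_i^{(n)}$ of $h$ at $T$, and the nodes and weights $(\alpha_i,\rho_i)_{i=0}^{k-1+\varepsilon}$ be as in the context. Then for any large enough $\lambda>0$ the polynomial $$f(t)=-\lambda f_m^{(n,s)}(t)+g_T(t)$$ belongs to $U_h^{n,s}$. In particular, if $$\lambda=\max\left\{\frac{g_i}{\ell_i}:1\le i\le\deg(g_T)\right\},$$ then the corresponding polynomial $f_m^{(h)}:=-\lambda f_m^{(n,s)}+g_T$ belongs to $U_h^{n,s}$ and $$\mathcal{G}_h(n,M,s)\le M\left(\frac{M}{L_m(n,s)}-1\right)f_m^{(h)}(1)+M^2\sum_{i=0}^{k-1+\varepsilon}\rho_ih(\alpha_i).$$ A code $C\in C(n,M,s)$ attains this bound (i.e. $E_h(C)$ equals the right-hand side) if and only if all inner products $\langle x,y\rangle$, $x\ne y\in C$, are in $T$ and $(f_m^{(h)})_iM_i(C)=0$ for every $i\ge1$, where $(f_m^{(h)})_i$ is the $i$-th Gegenbauer coefficient of $f_m^{(h)}$.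
   Context: Codes and energy. $\mathbb{S}^{n-1}$ is the unit sphere in $\mathbb{R}^n$; a spherical code is a finite subset $C\subset\mathbb{S}^{n-1}$. The $h$-energy is $E_h(C)=\sum_{x,y\in C,\,x\neq y}h(\langle x,y\rangle)$ (ordered pairs). $s(C)=\max\{\langle x,y\rangle:x,y\in C,x\ne y\}$; $C(n,M,s)=\{C\subset\mathbb{S}^{n-1}:|C|=M,\ s(C)=s\}$; $\mathcal{G}_h(n,M,s)=\sup_{C\in C(n,M,s)}E_h(C)$ (with $\sup\emptyset=-\infty$). Absolutely monotone potentials. $\mathcal{AM}([-1,1])$ is the set of $h:[-1,1]\to(0,+\infty]$ with $h^{(k)}(t)\ge0$ for every $t\in[-1,1)$ and every integer $k\ge0$ (so $h$ is finite and smooth on $[-1,1)$), where $h(1)=\lim_{t\to1^-}h(t)$. Gegenbauer polynomials. $P_0^{(n)}=1$, $P_1^{(n)}=t$, $(i+n-2)P_{i+1}^{(n)}(t)=(2i+n-2)tP_i^{(n)}(t)-iP_{i-1}^{(n)}(t)$ for $i\ge1$, so $P_i^{(n)}(1)=1$; they are orthogonal on $[-1,1]$ for the weight $(1-t^2)^{(n-3)/2}$. The Gegenbauer coefficients of $f\in C([-1,1])$ are $f_i=\int_{-1}^1 fP_i^{(n)}(1-t^2)^{(n-3)/2}dt\big/\int_{-1}^1 (P_i^{(n)})^2(1-t^2)^{(n-3)/2}dt$, so that $f=\sum_i f_iP_i^{(n)}$. The $i$-th moment of $C$ is $M_i(C)=\sum_{x,y\in C}P_i^{(n)}(\langle x,y\rangle)$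 (all ordered pairs, including $x=y$). Feasible set. $U_h^{n,s}$ is the set of $f\in C([-1,1])$ with $f(t)\ge h(t)$ for every $t\in[-1,s]$ and $f_i\le0$ for all $i\ge1$. Levenshtein parameters. $P_i^{(\alpha,\beta)}$ denotes the Jacobi polynomial. For $a,b\in\{0,1\}$ and $i\ge1$, $t_i^{a,b}$ is the greatest zero of $P_i^{(a+\frac{n-3}2,\,b+\frac{n-3}2)}$, and $t_0^{1,1}=-1$. Set $I_{2k-1}=[t_{k-1}^{1,1},t_k^{1,0}]$ and $I_{2k}=[t_k^{1,0},t_k^{1,1}]$ for $k\ge1$; these intervals cover $[-1,1)$ and have non-overlapping interiors. Define for $s\in I_{2k-1}$, resp. $s\in I_{2k}$, $$L_{2k-1}(n,s)=\binom{k+n-3}{k-1}\left[\frac{2k+n-3}{n-1}-\frac{P_{k-1}^{(n)}(s)-P_k^{(n)}(s)}{(1-s)P_k^{(n)}(s)}\right],$$ $$L_{2k}(n,s)=\binom{k+n-2}{k}\left[\frac{2k+n-1}{n-1}-\frac{(1+s)(P_k^{(n)}(s)-P_{k+1}^{(n)}(s))}{(1-s)(P_k^{(n)}(s)+P_{k+1}^{(n)}(s))}\right].$$ Given $s\in I_m$, write $m=2k-1+\varepsilon$ with $\varepsilon\in\{0,1\}$, $k\ge1$. Put $Q_i^\varepsilon=P_i^{(\frac{n-1}2,\,\varepsilon+\frac{n-3}2)}$. The nodes $\alpha_0<\alpha_1<\dots<\alpha_{k-1+\varepsilon}=s$ are the (simple) roots of $$(t+1)^\varepsilon\bigl(Q_k^\varepsilon(t)Q_{k-1}^\varepsilon(s)-Q_k^\varepsilon(s)Q_{k-1}^\varepsilon(t)\bigr)=0$$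 (so $\alpha_0=-1$ if $m=2k$). The weights $\rho_0,\dots,\rho_{k-1+\varepsilon}$ are those for which Levenshtein's quadrature $$f_0=\frac{f(1)}{L_m(n,s)}+\sum_{i=0}^{k-1+\varepsilon}\rho_if(\alpha_i)$$ holds for every real polynomial $f$ of degree at most $m$. The multiset $T$, of cardinality $m$, is $\{\alpha_0,\alpha_0,\alpha_1,\alpha_1,\dots,\alpha_{k-2},\alpha_{k-2},\alpha_{k-1}\}$ if $m=2k-1$, and $\{\alpha_0=-1,\alpha_1,\alpha_1,\dots,\alpha_{k-1},\alpha_{k-1},\alpha_k\}$ if $m=2k$. The Levenshtein polynomial is $f_m^{(n,s)}(t)=\prod_{\alpha_i\in T}(t-\alpha_i)$ (with multiplicity), with Gegenbauer expansion $f_m^{(n,s)}=\sum_{i=0}^m\ell_iP_i^{(n)}$; it is a known fact (Levenshtein) that $\ell_i>0$ for $i=0,\dots,m$. Hermite interpolant. $g_T$ is the polynomial of degree at most $m-1$ that agrees with $h$ at the points of $T$ counted with multiplicity (both $h$ and $h'$ are interpolated at doubled points), with Gegenbauer expansion $g_T=\sum_{i=0}^{\deg(g_T)}g_iP_i^{(n)}$.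
   Formalization: If deg(g_T)=0 the maximum defining λ is over the empty set; λ is then taken to be 0, and the attainment criterion is asserted only when deg(g_T)≥1 or h is not constant on [-1,1] (for constant h every code attains the bound). *)

(* Defs.v *)
From HB Require Import structures.
From mathcomp Require Import all_boot all_order all_algebra.
From mathcomp Require Import finmap.
From mathcomp Require Import all_classical all_reals all_analysis.

Set Implicit Arguments.
Unset Strict Implicit.
Unset Printing Implicit Defensive.

Import Order.TTheory GRing.Theory Num.Theory.
Import numFieldNormedType.Exports.

Local Open Scope classical_set_scope.
Local Open Scope ring_scope.

Section Maximum.
Variable R : realType.

(* Only applied to finite sets of reals: it is the maximum of a nonempty one,
   and sup set0 = 0. *)
Definition maxset (A : set R) : R := sup A.

End Maximum.

Section SphericalCodes.
Variables (R : realType) (n : nat).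

Definition dotv (x y : 'rV[R]_n) : R := \sum_(i < n) x 0 i * y 0 i.

Definition spherical_code (C : {fset 'rV[R]_n}) : Prop :=
  forall x, x \in C -> dotv x x = 1.

Definition max_inner (C : {fset 'rV[R]_n}) : R :=
  maxset [set r | exists x y, [/\ x \in C, y \in C, x != y & r = dotv x y]].

Definition codes (M : nat) (s : R) : set {fset 'rV[R]_n} :=
  [set C | [/\ spherical_code C, #|` C| = M & max_inner C = s]].

Definition energy (h : R -> \bar R) (C : {fset 'rV[R]_n}) : \bar R :=
  (\sum_(x <- C) \sum_(y <- C | x != y) h (dotv x y))%E.

Definition sup_energy (h : R -> \bar R) (M : nat) (s : R) : \bar R :=
  ereal_sup [set energy h C | C in codes M s].

End SphericalCodes.

Section AbsolutelyMonotone.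
Variable R : realType.

(* Derivatives are taken within [-1, 1), hence one-sided at -1: the potential
   is meaningful on [-1, 1] only. *)
Definition dquot (f : R -> R) (t u : R) : R := (f u - f t) / (u - t).

Definition deriv_filter (t : R) : set_system R := within `[-1, 1[ t^'.

Definition deriv_in (f : R -> R) (t : R) : R :=
  lim (dquot f t u @[u --> deriv_filter t]).

Definition derivable_in (f : R -> R) (t : R) : Prop :=
  cvg (dquot f t u @[u --> deriv_filter t]).

Definition hderiv (h : R -> \bar R) (j : nat) : R -> R :=
  iter j deriv_in (fun t => fine (h t)).

Definition abs_monotone (h : R -> \bar R) : Prop :=
  [/\ forall t, -1 <= t <= 1 -> (0 < h t)%E,
      forall t, -1 <= t < 1 -> h t \is a fin_num,
      forall j t, -1 <= t < 1 -> derivable_in (hderiv h j) t,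
      forall j t, -1 <= t < 1 -> 0 <= hderiv h j t
    & h t @[t --> 1^'-] --> h 1].

End AbsolutelyMonotone.

Section Gegenbauer.
Variables (R : realType) (n : nat).

Fixpoint gegenbauer (i : nat) : {poly R} :=
  match i with
  | 0 => 1
  | 1 => 'X
  | (j.+1 as i').+1 =>
      (i' + n - 2)%:R^-1 *:
        ((2 * i' + n - 2)%:R *: ('X * gegenbauer i') - i'%:R *: gegenbauer j)
  end.

Definition gweight (t : R) : R := (1 - t ^+ 2) `^ ((n%:R - 3) / 2).

Definition gcoef (f : R -> R) (i : nat) : R :=
  (\int[lebesgue_measure]_(t in `[-1, 1])
      (f t * (gegenbauer i).[t] * gweight t)) /
  (\int[lebesgue_measure]_(t in `[-1, 1])
      ((gegenbauer i).[t] ^+ 2 * gweight t)).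

Definition pcoef (p : {poly R}) (i : nat) : R := gcoef (fun t => p.[t]) i.

Definition moment (i : nat) (C : {fset 'rV[R]_n}) : R :=
  \sum_(x <- C) \sum_(y <- C) (gegenbauer i).[dotv x y].

Definition feasible (h : R -> \bar R) (s : R) : set (R -> R) :=
  [set f : R -> R | [/\ {within `[(-1 : R), 1], continuous f},
               forall t, -1 <= t <= s -> (h t <= (f t)%:E)%E
             & forall i, (1 <= i)%N -> gcoef f i <= 0]].

End Gegenbauer.

Section Jacobi.
Variable R : realType.

Definition gbinom (x : R) (j : nat) : R :=
  (\prod_(i < j) (x - i%:R)) / j`!%:R.

(* Szego, Orthogonal polynomials, (4.3.2) *)
Definition jacobi (a b : R) (i : nat) : {poly R} :=
  \sum_(j < i.+1) (gbinom (i%:R + a) (i - j) * gbinom (i%:R + b) j) *: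
    ((2^-1 *: ('X - 1)) ^+ j * (2^-1 *: ('X + 1)) ^+ (i - j)).

End Jacobi.

Section Levenshtein.
Variables (R : realType) (n : nat).

Definition ajacobi (a b : bool) (i : nat) : {poly R} :=
  jacobi (a%:R + (n%:R - 3) / 2) (b%:R + (n%:R - 3) / 2) i.

(* The value -1 at i = 0 is the convention for a = b = 1, the only case in
   which i = 0 is used. *)
Definition tzero (a b : bool) (i : nat) : R :=
  if i is 0 then -1 else maxset [set t | root (ajacobi a b i) t].

(* In what follows the index m is encoded as m = 2k - 1 + e, with k >= 1. *)
Definition lev_m (k : nat) (e : bool) : nat := (2 * k - 1 + e)%N.

Definition lev_interval (k : nat) (e : bool) : set R :=
  if e then `[tzero true false k, tzero true true k]%classic
  else `[tzero true true (k - 1), tzero true false k]%classic.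

Definition lev_bound (k : nat) (e : bool) (s : R) : R :=
  let P i := (gegenbauer R n i).[s] in
  if e then
    'C(k + n - 2, k)%:R *
      ((2 * k + n - 1)%:R / (n - 1)%:R
       - (1 + s) * (P k - P k.+1) / ((1 - s) * (P k + P k.+1)))
  else
    'C(k + n - 3, k - 1)%:R *
      ((2 * k + n - 3)%:R / (n - 1)%:R
       - (P (k - 1)%N - P k) / ((1 - s) * P k)).

Definition lev_node_poly (k : nat) (e : bool) (s : R) : {poly R} :=
  let Q := ajacobi true e in
  ('X + 1) ^+ e * ((Q (k - 1)%N).[s] *: Q k - (Q k).[s] *: Q (k - 1)%N).

(* Only the values of alpha and rho at the indices i < k + e matter. *)
Definition lev_nodes (k : nat) (e : bool) (s : R) (alpha : nat -> R) : Prop :=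
  [/\ forall i j, (i < j < k + e)%N -> alpha i < alpha j,
      alpha (k - 1 + e)%N = s
    & forall t, root (lev_node_poly k e s) t <->
        exists2 i, (i < k + e)%N & t = alpha i].

Definition lev_weights (k : nat) (e : bool) (s : R) (alpha rho : nat -> R) :
    Prop :=
  forall f : {poly R}, (size f <= (lev_m k e).+1)%N ->
    pcoef n f 0 =
      f.[1] / lev_bound k e s + \sum_(i < k + e) rho i * f.[alpha i].

Definition lev_T (k : nat) (e : bool) (alpha : nat -> R) : seq R :=
  let doubled := [seq alpha i | i <- iota e (k - 1)] in
  (if e then [:: alpha 0] else [::])
    ++ doubled ++ doubled ++ [:: alpha (k - 1 + e)%N].

Definition lev_poly (T : seq R) : {poly R} := \prod_(a <- T) ('X - a%:P).

Definition hermite_interpolant (h : R -> \bar R) (T : seq R) (g : {poly R}) :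
    Prop :=
  (size g <= size T)%N /\
  forall a j, (j < count_mem a T)%N -> (g^`(j)).[a] = hderiv h j a.

(* maxset gives the value 0 if g is constant, i.e. if there is no index i. *)
Definition lev_lambda (T : seq R) (g : {poly R}) : R :=
  maxset [set r | exists2 i, (1 <= i <= (size g).-1)%N
                           & r = pcoef n g i / pcoef n (lev_poly T) i].

Definition upper_poly (T : seq R) (g : {poly R}) (lambda : R) : {poly R} :=
  - lambda *: lev_poly T + g.

Definition energy_bound (h : R -> \bar R) (M k : nat) (e : bool) (s : R)
    (alpha rho : nat -> R) (f : {poly R}) : R :=
  M%:R * (M%:R / lev_bound k e s - 1) * f.[1]
  + M%:R ^+ 2 * \sum_(i < k + e) rho i * fine (h (alpha i)).

End Levenshtein.

(* Main.v *)
(* Let f be the Levenshtein polynomial and g the Hermite interpolant of h at T.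

   Feasibility. For t outside T, Rolle's theorem applied to h - g - c f, with c
   chosen so that t is one more zero, gives h^(m)(xi) = c m!, so c >= 0 and
   h <= g on [-1, s], where f <= 0. Adding - lambda f preserves this, and makes
   the coefficients of index >= 1 nonpositive because all the Gegenbauer
   coefficients of f are positive. That positivity is Levenshtein's: up to a
   scalar, f = (X + 1)^e (Q_k(s) Q_(k+1) - Q_(k+1)(s) Q_k) K_s, where K_s is the
   Christoffel-Darboux kernel of the Q_i at s; the Q_i are nonnegative
   combinations of Gegenbauer polynomials, and so are the products of Gegenbauer
   polynomials.

   Energy. If p is feasible, then sum_(x != y) h(<x,y>) <= sum_(x != y) p(<x,y>)
   = sum_i p_i M_i(C) - M p(1) <= p_0 M^2 - M p(1), since M_i(C) >= 0 (Schoenberg),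
   and the quadrature formula turns p_0 into p(1) / L + sum_i rho_i h(alpha_i).
   Equality holds iff it holds in both steps. The top coefficient of g is
   h^(d)(xi) / d! > 0, so if g is not constant then lambda > 0 and p > h off T;
   if g is constant, then equality off T makes h constant. *)

Require Import Defs.
From HB Require Import structures.
From mathcomp Require Import all_boot all_order all_algebra.
From mathcomp Require Import ring lra zify.
From mathcomp Require mpoly.

Set Implicit Arguments.
Unset Strict Implicit.
Unset Printing Implicit Defensive.

Import Order.TTheory GRing.Theory Num.Theory.

Local Open Scope ring_scope.

(** * Positive definiteness of zonal harmonics *)

(** The assumption that [s] lies in [I_m] is exploited through three sign conditions. With [k] one
    less than in the statement, they are [Q_i(s) > 0] for [i <= k], [Q_(k+1)(s) <= 0], and a sign at
    -1 for [Q_k(s) Q_(k+1) - Q_(k+1)(s) Q_k]. The first two make both factors of the decomposition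
    of f nonnegative combinations; the third prevents any node from falling below -1. Jacobi
    polynomials, defined by an explicit sum, matter through their zeros. They are therefore
    identified only up to a nonzero factor, by their differential equation, with families built from
    Gegenbauer polynomials of dimension n + 2, whose recurrences have coefficients of known sign.
    For n = 2 the weight is unbounded. Analysis of the weight is confined to integrability,
    linearity, one integration by parts and the positivity of the total mass; orthogonality and
    norms then follow algebraically. Schoenberg's inequality is obtained without a measure on the
    sphere, the Fischer product on polynomials taking the place of integration. *)

Module Harmonic.
Import mpoly.

Section Fischer.
Variables (R : realFieldType) (n : nat).
Implicit Types (p q : {mpoly R[n]}) (x y : 'I_n -> R).

Definition mfact (m : 'X_{1..n}) : R := \prod_(i < n) ((m i)`!)%:R.

(** The Fischer product: monomials are orthogonal and multiplication by a variable is adjoint to the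
    derivative in it. Hence [linform x] is adjoint to [dirder x], and [normsq] to the Laplacian. *)
Definition fischer p q : R := \sum_(m <- msupp q) p@_m * (q@_m * mfact m).

Lemma fischerDl q : {morph fischer^~ q : p1 p2 / p1 + p2}.
Proof.
move=> p1 p2; rewrite /fischer -big_split /=; apply: eq_bigr => m _.
by rewrite mcoeffD mulrDl.
Qed.

Lemma fischerZl c p q : fischer (c *: p) q = c * fischer p q.
Proof. by rewrite /fischer mulr_sumr; apply: eq_bigr => m _; rewrite mcoeffZ -mulrA. Qed.

Lemma fischer0l q : fischer 0 q = 0.
Proof. by rewrite /fischer big1 // => m _; rewrite mcoeff0 mul0r. Qed.

Lemma fischerXl m q : fischer 'X_[m] q = q@_m * mfact m.
Proof.
rewrite /fischer; have [mq|mq] := boolP (m \in msupp q).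
  rewrite (bigD1_seq m) ?msupp_uniq //= mcoeffX eqxx mul1r big1 ?addr0 // => j jm.
  by rewrite mcoeffX eq_sym (negbTE jm) mul0r.
rewrite (memN_msupp_eq0 mq) mul0r big_seq big1 // => j jq; rewrite mcoeffX.
by case: eqP => [mj|_]; rewrite ?mul0r //; move: mq; rewrite mj jq.
Qed.

Lemma fischerE p q : fischer p q = \sum_(m <- msupp p) p@_m * (q@_m * mfact m).
Proof.
rewrite {1}[p]mpolyE (big_morph (fischer^~ q) (fischerDl q) (fischer0l q)).
by apply: eq_bigr => m _; rewrite fischerZl fischerXl.
Qed.

Lemma fischerC p q : fischer p q = fischer q p.
Proof. by rewrite fischerE; apply: eq_bigr => m _; rewrite mulrCA. Qed.

Lemma fischerDr p : {morph fischer p : q1 q2 / q1 + q2}.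
Proof. by move=> q1 q2; rewrite !(fischerC p) fischerDl. Qed.

Lemma fischerZr c p q : fischer p (c *: q) = c * fischer p q.
Proof. by rewrite !(fischerC p) fischerZl. Qed.

Lemma fischer0r p : fischer p 0 = 0.
Proof. by rewrite fischerC fischer0l. Qed.

Lemma fischer_sumr (I : Type) (r : seq I) p (F : I -> {mpoly R[n]}) :
  fischer p (\sum_(i <- r) F i) = \sum_(i <- r) fischer p (F i).
Proof. by rewrite (big_morph (fischer p) (fischerDr p) (fischer0r p)). Qed.

Lemma fischer_suml (I : Type) (r : seq I) q (F : I -> {mpoly R[n]}) :
  fischer (\sum_(i <- r) F i) q = \sum_(i <- r) fischer (F i) q.
Proof. by rewrite (big_morph (fischer^~ q) (fischerDl q) (fischer0l q)). Qed.

Lemma fischer_ge0 p : 0 <= fischer p p.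
Proof.
apply: sumr_ge0 => m _; rewrite mulrA mulr_ge0 -?expr2 ?sqr_ge0 //.
by apply: prodr_ge0 => i _; rewrite ler0n.
Qed.

Lemma mfactD1 i (m : 'X_{1..n}) : mfact (m + U_(i)) = (m i).+1%:R * mfact m.
Proof.
rewrite /mfact (bigD1 i) //= [in RHS](bigD1 i) //= mnmDE mnm1E eqxx addn1.
rewrite factS natrM mulrA; congr (_ * _); apply: eq_bigr => j ji.
by rewrite mnmDE mnm1E eq_sym (negbTE ji) addn0.
Qed.

Lemma fischerXM i p q : fischer ('X_i * p) q = fischer p q^`M(i).
Proof.
rewrite [p]mpolyE mulr_sumr !fischer_suml; apply: eq_bigr => m _.
rewrite -scalerAr !fischerZl -mpolyXD !fischerXl mcoeff_deriv addmC mfactD1.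
by rewrite -[in RHS]mulr_natr -[in RHS]mulrA.
Qed.

Definition linform x : {mpoly R[n]} := \sum_(i < n) x i *: 'X_i.
Definition normsq : {mpoly R[n]} := \sum_(i < n) 'X_i ^+ 2.
Definition dirder x p : {mpoly R[n]} := \sum_(i < n) x i *: p^`M(i).
Definition lap p : {mpoly R[n]} := \sum_(i < n) p^`M(i)^`M(i).

Lemma fischer_linform x p q : fischer (linform x * p) q = fischer p (dirder x q).
Proof.
rewrite mulr_suml fischer_suml fischer_sumr; apply: eq_bigr => i _.
by rewrite -scalerAl fischerZl fischerZr fischerXM.
Qed.

Lemma fischer_normsq p q : fischer (normsq * p) q = fischer p (lap q).
Proof.
rewrite mulr_suml fischer_suml fischer_sumr; apply: eq_bigr => i _.
by rewrite expr2 -mulrA !fischerXM.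
Qed.

Lemma mderivXU (i j : 'I_n) : ('X_j : {mpoly R[n]})^`M(i) = (i == j)%:R.
Proof.
rewrite mderivX mnm1E eq_sym; case: eqP => [->|_]; last by rewrite scale0r.
by rewrite scale1r -[X in (X - _)%MM]add0m addmK mpolyX0.
Qed.

Lemma mderiv_sum (I : Type) (r : seq I) i (F : I -> {mpoly R[n]}) :
  (\sum_(j <- r) F j)^`M(i) = \sum_(j <- r) (F j)^`M(i).
Proof. exact: raddf_sum. Qed.

Lemma mderiv_linform x i : (linform x)^`M(i) = (x i)%:MP.
Proof.
rewrite mderiv_sum (bigD1 i) //= mderivZ mderivXU eqxx big1 ?addr0 => [|j ji].
  by rewrite -mul_mpolyC mulr1.
by rewrite mderivZ mderivXU eq_sym (negbTE ji) scaler0.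
Qed.

Lemma mderiv_normsq i : normsq^`M(i) = 2 *: 'X_i.
Proof.
rewrite mderiv_sum (bigD1 i) //= expr2 mderivM mderivXU eqxx mul1r mulr1.
rewrite big1 ?addr0 ?scaler_nat ?mulr2n // => j ji.
by rewrite expr2 mderivM mderivXU eq_sym (negbTE ji) mul0r mulr0 addr0.
Qed.

Lemma dirderM x p q : dirder x (p * q) = dirder x p * q + p * dirder x q.
Proof.
rewrite mulr_suml mulr_sumr -big_split; apply: eq_bigr => i _ /=.
by rewrite mderivM scalerDr scalerAl scalerAr.
Qed.

Lemma dirderD x : {morph dirder x : p q / p + q}.
Proof.
by move=> p q; rewrite -big_split; apply: eq_bigr => i _; rewrite mderivD scalerDr.
Qed.

Lemma dirderZ x c p : dirder x (c *: p) = c *: dirder x p.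
Proof.
by rewrite scaler_sumr; apply: eq_bigr => i _; rewrite mderivZ !scalerA mulrC.
Qed.

Lemma dirderB x p q : dirder x (p - q) = dirder x p - dirder x q.
Proof. by rewrite dirderD -scaleN1r dirderZ scaleN1r. Qed.

Lemma lapD : {morph lap : p q / p + q}.
Proof.
by move=> p q; rewrite -big_split; apply: eq_bigr => i _; rewrite !mderivD.
Qed.

Lemma lapZ c p : lap (c *: p) = c *: lap p.
Proof. by rewrite scaler_sumr; apply: eq_bigr => i _; rewrite !mderivZ. Qed.

Lemma lapB p q : lap (p - q) = lap p - lap q.
Proof. by rewrite lapD -scaleN1r lapZ scaleN1r. Qed.

Lemma lap_linformM x p : lap (linform x * p) = linform x * lap p + 2 *: dirder x p.
Proof.
rewrite scaler_sumr mulr_sumr -big_split; apply: eq_bigr => i _ /=.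
rewrite mderivM mderiv_linform mderivD mderiv_mulC mderivM mderiv_linform.
rewrite -!mul_mpolyC [2%:MP]mpolyC_nat mulr_natl mulr2n.
by rewrite [LHS]addrA [LHS]addrC.
Qed.

Lemma lap_normsqM p :
  lap (normsq * p) =
  normsq * lap p + 4 *: (\sum_(i < n) 'X_i * p^`M(i)) + (2 * n%:R) *: p.
Proof.
have -> : (2 * n%:R) *: p = \sum_(i < n) 2 *: p.
  by rewrite sumr_const card_ord -scaler_nat scalerA mulrC.
rewrite scaler_sumr mulr_sumr -!big_split; apply: eq_bigr => i _ /=.
rewrite mderivM mderiv_normsq mderivD -scalerAl mderivZ !mderivM mderiv_normsq.
rewrite mderivXU eqxx mul1r -!mul_mpolyC !mpolyC_nat.
ring.
Qed.

Lemma mderiv_dhomog d i p : p \is d.+1.-homog -> p^`M(i) \is d.-homog.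
Proof.
move=> /dhomogP hp; apply/dhomogP => m; rewrite mcoeff_msupp mcoeff_deriv => h.
suff: (m + U_(i))%MM \in msupp p by move=> /hp; rewrite /= mdegD mdeg1 addn1 => -[].
by rewrite mcoeff_msupp; apply: contraNneq h => ->; rewrite mul0rn.
Qed.

Lemma dirder_dhomog d x p : p \is d.+1.-homog -> dirder x p \is d.-homog.
Proof. by move=> hp; apply: rpred_sum => i _; apply: rpredZ; exact: mderiv_dhomog. Qed.

Lemma euler d p : p \is d.-homog -> \sum_(i < n) 'X_i * p^`M(i) = d%:R *: p.
Proof.
move=> /dhomogP hp; rewrite {1}[p]mpolyE.
under eq_bigr => i _ do rewrite mderiv_sum mulr_sumr.
rewrite exchange_big /= [X in _ = _ *: X]mpolyE scaler_sumr; apply: eq_big_seq => m /hp /= <-.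
rewrite scalerA mulrC -scalerA mdegE natr_sum scaler_suml scaler_sumr.
apply: eq_bigr => i _; rewrite mderivZ -scalerAr mderivX -scalerAr -mpolyXD.
have [->|mi] := eqVneq (m i) 0%N; first by rewrite !scale0r.
by rewrite addmC submK // lep1mP.
Qed.

(** Reproducing property: each factor [linform x] moved to the other side becomes a derivative along
    [x], and by Euler's identity such a derivative, evaluated at [x] itself, multiplies the value by
    the degree. *)
Lemma fischer_linformX d x p :
  p \is d.-homog -> fischer (linform x ^+ d) p = d`!%:R * p.@[x].
Proof.
elim: d p => [|d IHd] p hp.
  rewrite expr0 fact0 mul1r -mpolyX0 fischerXl /mfact big1 ?mulr1 => [|i _].
    rewrite {2}[p]mpolyE raddf_sum /= -[LHS]mulr1.
    have [p0|p0] := boolP (0%MM \in msupp p).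
      rewrite (bigD1_seq 0%MM) ?msupp_uniq //= mevalZ mevalX.
      rewrite [X in _ * X + _]big1 ?big1_seq ?addr0 ?mulr1 // => [m /andP[m0 mp]|i _].
        by have := dhomog_mf hp mp => /eqP; rewrite /= mdeg_eq0 (negbTE m0).
      by rewrite mnm0E.
    rewrite (memN_msupp_eq0 p0) mul0r big1_seq // => m /andP[_ mp].
    by have := dhomog_mf hp mp => /eqP; rewrite /= mdeg_eq0 => /eqP m0; rewrite -m0 mp in p0.
  by rewrite mnm0E fact0.
rewrite exprS fischer_linform IHd ?dirder_dhomog // factS mulnC natrM -mulrA.
congr (_ * _); have := congr1 (meval x) (euler hp); rewrite mevalZ => <-.
rewrite /dirder !raddf_sum /=; apply: eq_bigr => i _.
by rewrite mevalZ mevalM mevalXU.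
Qed.

Section Zonal.
Variable x : 'I_n -> R.
Hypotheses (n_ge2 : (2 <= n)%N) (x_unit : \sum_(i < n) x i ^+ 2 = 1).

(** The homogenized Gegenbauer polynomial [|X|^k P_k(<x, X> / |X|)], for a unit vector [x]. *)
Fixpoint zonal (k : nat) : {mpoly R[n]} :=
  match k with
  | 0 => 1
  | 1 => linform x
  | (j.+1 as k').+1 =>
      (k'%:R + n%:R - 2)^-1 *:
        ((2 * k'%:R + n%:R - 2) *: (linform x * zonal k')
         - k'%:R *: (normsq * zonal j))
  end.

Let mpolyE0 := (mpolyCD, mpolyCB, mpolyCN, mpolyCM, mpolyC1).

Lemma zonal_den k : k.+1%:R + n%:R - 2 != 0 :> R.
Proof.
have h2 : (2 : R) <= n%:R by rewrite (ler_nat R 2 n).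
by have hk : (0 : R) <= k%:R; [exact: ler0n|rewrite -[k.+1%:R]natr1 lt0r_neq0 //; lra].
Qed.

Lemma zonalSS k :
  (k.+1%:R + n%:R - 2) *: zonal k.+2 =
  (2 * k.+1%:R + n%:R - 2) *: (linform x * zonal k.+1) - k.+1%:R *: (normsq * zonal k).
Proof. by rewrite /= scalerA divff ?zonal_den // scale1r. Qed.

Lemma dirder_linform : dirder x (linform x) = 1.
Proof.
rewrite /dirder; under eq_bigr => i _ do rewrite mderiv_linform -mul_mpolyC -mpolyCM -expr2.
by rewrite -(raddf_sum (@mpolyC n R)) x_unit.
Qed.

Lemma dirder_normsq : dirder x normsq = 2 *: linform x.
Proof.
rewrite scaler_sumr; apply: eq_bigr => i _.
by rewrite mderiv_normsq !scalerA mulrC.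
Qed.

Lemma dirder1 : dirder x 1 = 0.
Proof. by rewrite /dirder big1 // => i _; rewrite (mderivC i 1) scaler0. Qed.

(** Evaluates the cross term that [lap_linformM] produces in the proof of harmonicity. *)
Lemma dirder_zonal k : dirder x (zonal k.+1) = k.+1%:R *: zonal k.
Proof.
elim/ltn_ind: k => -[|k] IHk; first by rewrite dirder_linform scale1r.
apply: (scalerI (zonal_den k)); rewrite -dirderZ zonalSS dirderB !dirderZ !dirderM.
rewrite dirder_linform dirder_normsq IHk //.
case: k IHk => [|k] IHk.
  rewrite dirder1 mulr0 addr0 mul1r mulr1 /= -!natr1; move: n%:R => b.
  by rewrite -!mul_mpolyC !mpolyE0; ring.
have := zonalSS k; rewrite (IHk k) //.
move: (zonal k.+2) (zonal k.+1) (zonal k) (linform x) normsq => z2 z1 z0 L N.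
rewrite -!natr1; move: k%:R n%:R => a b.
rewrite -!mul_mpolyC !mpolyE0 => /eqP; rewrite -subr_eq0 => /eqP E.
rewrite -[LHS]addr0 -[X in _ + X = _](mulr0 (a%:MP + 1 + 1)) -E.
by ring.
Qed.

Lemma zonal_dhomog k : zonal k \is k.-homog.
Proof.
have L1 : linform x \is 1.-homog.
  by apply: rpred_sum => i _; apply: rpredZ; rewrite dhomogX /= mdeg1.
have N2 : normsq \is 2.-homog.
  by apply: rpred_sum => i _; rewrite mpolyXn dhomogX /= mdegMn mdeg1.
elim/ltn_ind: k => -[|[|k]] IHk //; first exact: dhomog1.
apply: rpredZ; apply: rpredB; apply: rpredZ.
  by rewrite -[k.+2]add1n; apply: dhomogM => //; apply: IHk.
by rewrite -[k.+2]add2n; apply: dhomogM => //; apply: IHk.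
Qed.

Lemma lap_zonal k : lap (zonal k) = 0.
Proof.
elim/ltn_ind: k => -[|[|k]] IHk.
- by rewrite /lap big1 // => i _; rewrite (mderivC i 1) mderiv0.
- by rewrite /lap big1 // => i _; rewrite mderiv_linform mderivC.
apply: (scalerI (zonal_den k)); rewrite -lapZ zonalSS lapB !lapZ lap_linformM lap_normsqM.
rewrite !IHk // dirder_zonal (euler (zonal_dhomog k)) !mulr0 scaler0 !add0r.
move: (zonal k.+1) (zonal k) (linform x) normsq => z1 z0 L N.
rewrite -!natr1; move: k%:R n%:R => a b.
by rewrite -!mul_mpolyC !mpolyE0; ring.
Qed.

(** The inverse of the leading coefficient of [P_k], so that [linform x ^+ k] and
    [zonal_coef k *: zonal k] agree modulo [normsq]. *)
Fixpoint zonal_coef (k : nat) : R :=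
  match k with
  | 0 | 1 => 1
  | (_.+1 as k').+1 => zonal_coef k' * (k'%:R + n%:R - 2) / (2 * k'%:R + n%:R - 2)
  end.

Lemma zonal_coef_gt0 k : 0 < zonal_coef k.
Proof.
have h2 : (2 : R) <= n%:R by rewrite (ler_nat R 2 n).
elim: k => [|[|k] IHk] //; rewrite -[zonal_coef k.+2]/(_ * _ / _) -[k.+1%:R]natr1.
have hk : (0 : R) <= k%:R by exact: ler0n.
by rewrite divr_gt0 ?mulr_gt0 //; lra.
Qed.

Lemma linformX_zonal k :
  exists w, linform x ^+ k = zonal_coef k *: zonal k + normsq * w.
Proof.
have h2 : (2 : R) <= n%:R by rewrite (ler_nat R 2 n).
elim: k => [|[|k] [w IHk]].
- by exists 0; rewrite expr0 scale1r mulr0 addr0.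
- by exists 0; rewrite expr1 scale1r mulr0 addr0.
have hk : (0 : R) <= k%:R by exact: ler0n.
pose d : R := 2 * k.+1%:R + n%:R - 2.
have d0 : d != 0 by rewrite lt0r_neq0 // /d -[k.+1%:R]natr1; lra.
exists (linform x * w + (zonal_coef k.+1 / d * k.+1%:R) *: zonal k).
have -> : zonal_coef k.+2 *: zonal k.+2 =
    (zonal_coef k.+1 / d) *: ((k.+1%:R + n%:R - 2) *: zonal k.+2).
  by rewrite [RHS]scalerA; congr (_ *: _); rewrite -[LHS]/(_ * _ / d) mulrAC.
rewrite zonalSS -/d exprS IHk scalerBr !scalerA divfK //.
by rewrite -!mul_mpolyC; ring.
Qed.

End Zonal.

Lemma meval_zonal (G : nat -> {poly R}) x y k :
  (2 <= n)%N -> \sum_(i < n) y i ^+ 2 = 1 ->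
  G 0 = 1 -> G 1 = 'X ->
  (forall j, (j.+1%:R + n%:R - 2) *: G j.+2 =
     (2 * j.+1%:R + n%:R - 2) *: ('X * G j.+1) - j.+1%:R *: G j) ->
  (zonal x k).@[y] = (G k).[\sum_(i < n) x i * y i].
Proof.
move=> n2 y1 G0 G1 GS.
have evL : (linform x).@[y] = \sum_(i < n) x i * y i.
  by rewrite raddf_sum; apply: eq_bigr => i _; rewrite /= mevalZ mevalXU.
elim/ltn_ind: k => -[|[|k]] IHk; first by rewrite meval1 G0 hornerC.
  by rewrite G1 hornerX.
apply: (mulfI (zonal_den n2 k)).
rewrite -mevalZ zonalSS // -hornerZ GS mevalB !mevalZ !mevalM.
rewrite !(hornerD, hornerN, hornerZ, hornerM, hornerX) evL !IHk //.
have -> : normsq.@[y] = 1.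
  by rewrite -y1 raddf_sum; apply: eq_bigr => i _; rewrite /= expr2 mevalM mevalXU expr2.
by rewrite mul1r.
Qed.

(* The matrix of the [G k] at the inner products is a Gram matrix for the Fischer
   product: a zonal harmonic is orthogonal to the multiples of [|X|^2], hence
   pairing with it amounts, up to a positive constant, to evaluation. *)
Lemma zonal_sum_ge0 (G : nat -> {poly R}) (T : eqType) (v : T -> 'I_n -> R)
    (s : seq T) k :
  (2 <= n)%N -> {in s, forall a, \sum_(i < n) v a i ^+ 2 = 1} ->
  G 0 = 1 -> G 1 = 'X ->
  (forall j, (j.+1%:R + n%:R - 2) *: G j.+2 =
     (2 * j.+1%:R + n%:R - 2) *: ('X * G j.+1) - j.+1%:R *: G j) ->
  0 <= \sum_(a <- s) \sum_(b <- s) (G k).[\sum_(i < n) v a i * v b i].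
Proof.
move=> n2 v1 G0 G1 GS; pose W : {mpoly R[n]} := \sum_(a <- s) zonal (v a) k.
have -> : \sum_(a <- s) \sum_(b <- s) (G k).[\sum_(i < n) v a i * v b i] =
    \sum_(b <- s) W.@[v b].
  rewrite exchange_big; apply: eq_big_seq => b /v1 b1; rewrite raddf_sum.
  by apply: eq_bigr => a _; rewrite /= (meval_zonal _ _ n2 b1 G0 G1 GS).
have Wh : W \is k.-homog.
  rewrite /W big_seq; apply: rpred_sum => a /v1 a1; exact: zonal_dhomog.
have WL : lap W = 0.
  rewrite /W (big_morph lap (@lapD) (id1 := 0)); last first.
    by rewrite -[0 in LHS](scale0r 0) lapZ scale0r.
  by apply: big1_seq => a /= /v1 a1; exact: lap_zonal.
suff : 0 <= k`!%:R * \sum_(b <- s) W.@[v b] by rewrite pmulr_rge0 // ltr0n fact_gt0.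
suff -> : k`!%:R * \sum_(b <- s) W.@[v b] = zonal_coef k * fischer W W.
  by rewrite mulr_ge0 ?fischer_ge0 // ltW // zonal_coef_gt0.
rewrite {2}/W fischer_suml !mulr_sumr; apply: eq_big_seq => b /v1 b1.
rewrite -fischer_linformX //; have [w ->] := linformX_zonal (v b) n2 k.
by rewrite fischerDl fischerZl fischer_normsq WL fischer0r addr0.
Qed.

End Fischer.
End Harmonic.

From mathcomp Require Import finmap.
From mathcomp Require Import all_classical all_reals all_analysis.
From mathcomp Require Import measurable_realfun.

Import Order.TTheory GRing.Theory Num.Theory.
Import numFieldNormedType.Exports.

Arguments gegenbauer : simpl never.
Arguments tzero : simpl never.

(** Subtracts [c] times a known equation from the goal. The cofactors supplied in the proofs below
    are certificates of ideal membership: once all equations are used, [ring] closes the goal. *)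
Lemma sub_lincomb (A : pzRingType) (c l r a b : A) :
  l = r -> a - c * l = b - c * r -> a = b.
Proof. by move=> -> /addIr. Qed.
Arguments sub_lincomb {A} c {l r a b} _ _.

Definition polyE0 := (polyCD, polyCB, polyCN, polyCM, polyC1).

(** * Gegenbauer polynomials *)

Section GegenbauerAlgebra.
Variable R : realType.

Section Basic.
Variables (n : nat) (n_ge2 : (2 <= n)%N).
Local Notation P := (gegenbauer R n).

Lemma gegenbauer_den_neq0 k : k.+1%:R + n%:R - 2 != 0 :> R.
Proof.
have n2 : (2 : R) <= n%:R by rewrite (ler_nat R 2 n).
have hk : (0 : R) <= k%:R by exact: ler0n.
by rewrite -[k.+1%:R]natr1 lt0r_neq0 //; lra.
Qed.

Lemma gegenbauer_rec k :
  (k.+1%:R + n%:R - 2) *: P k.+2 =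
  (2 * k.+1%:R + n%:R - 2) *: ('X * P k.+1) - k.+1%:R *: P k.
Proof.
have -> : P k.+2 = (k.+1 + n - 2)%:R^-1 *:
   ((2 * k.+1 + n - 2)%:R *: ('X * P k.+1) - k.+1%:R *: P k) by [].
rewrite !natrB ?natrD ?natrM; [|by rewrite (leq_trans n_ge2) ?leq_addl..].
by rewrite scalerA divff ?scale1r ?gegenbauer_den_neq0.
Qed.

(** Uniform in [k]: at [k = 0] the factor [k%:R] kills the meaningless [P k.-1]. *)
Lemma gegenbauer_recC k :
  (k%:R + n%:R - 2)%:P * P k.+1 =
  (2 * k%:R + n%:R - 2)%:P * ('X * P k) - k%:R%:P * P k.-1.
Proof.
case: k => [|k]; last by rewrite !mul_polyC gegenbauer_rec.
by rewrite mulr0 !add0r /gegenbauer mulr1 polyC0 mul0r subr0.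
Qed.

Lemma gegenbauer_deriv k :
  (1 - 'X ^+ 2) * (P k)^`() = k%:R%:P * (P k.-1 - 'X * P k).
Proof.
elim/ltn_ind: k => -[|[|k]] IHk; first by rewrite /gegenbauer derivC polyC0; ring.
  by rewrite /gegenbauer derivX polyC1; ring.
have Rk := gegenbauer_recC k.+1; have dRk := congr1 (@deriv R) Rk.
move: Rk dRk; rewrite [X in _ = X -> _]/= derivB !deriv_mulC derivM derivX.
have := IHk k.+1 (ltnSn _); have := IHk k (ltnW (ltnSn _)).
have Rk' := gegenbauer_recC k; move: Rk'.
have : (k.+1%:R + n%:R - 2)%:P != 0 :> {poly R} by rewrite polyC_eq0 gegenbauer_den_neq0.
rewrite [k.+2.-1]/= [k.+1.-1]/=.
move: (P k.+2) (P k.+1) (P k) (P k.-1) => p3 p2 p1 p0.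
rewrite -[k.+2%:R]natr1 -[k.+1%:R]natr1.
move: (k%:R) (n%:R) => a b; rewrite !polyE0 => b0 E0 E1 E2 E3 E4.
apply: (mulfI b0); apply: (sub_lincomb (1 - 'X ^+ 2 : {poly R}) E4).
apply: (sub_lincomb ((2 * a%:P + b%:P) * 'X : {poly R}) E2).
apply: (sub_lincomb (- (a%:P + 1) : {poly R}) E1).
apply: (sub_lincomb ((a%:P + 2) * 'X : {poly R}) E3).
by apply: (sub_lincomb (- (a%:P + 1) : {poly R}) E0); ring.
Qed.

Lemma gegenbauer_deriv_pred k :
  (1 - 'X ^+ 2) * (P k)^`() =
  (k%:R + n%:R - 2)%:P * ('X * P k - P k.+1).
Proof.
apply: (sub_lincomb 1 (gegenbauer_deriv k)).
apply: (sub_lincomb 1 (gegenbauer_recC k)).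
by move: (k%:R) (n%:R) => a b; rewrite !polyE0; ring.
Qed.

Lemma onemX2_neq0 : 1 - 'X ^+ 2 != 0 :> {poly R}.
Proof.
rewrite -oppr_eq0 opprB -(polyC1 R) -[X in X != 0]/('X^2 - 1%:P).
by apply/monic_neq0/monicXnsubC.
Qed.

Lemma deriv_onemX2 : (1 - 'X ^+ 2 : {poly R})^`() = - ('X *+ 2).
Proof. by rewrite derivB (derivC 1) derivXn sub0r expr1. Qed.

Lemma gegenbauer_ode k :
  (1 - 'X ^+ 2) * (P k)^`()^`() =
  (n%:R - 1)%:P * ('X * (P k)^`()) - (k%:R * (k%:R + n%:R - 2))%:P * P k.
Proof.
have E1 := gegenbauer_deriv k; have := congr1 (@deriv R) E1.
rewrite deriv_mulC derivM deriv_onemX2 !derivB derivM derivX.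
(* Differentiating [gegenbauer_deriv] leaves one foreign term, the derivative of [P k.-1]. The
   companion formula at [k - 1] eliminates it, and the factor [k%:R] covers [k = 0]. *)
have : k%:R%:P * ((1 - 'X ^+ 2) * (P k.-1)^`()) =
    k%:R%:P * ((k%:R + n%:R - 3)%:P * ('X * P k.-1 - P k)).
  case: (k) => [|j]; first by rewrite polyC0 !mul0r.
  rewrite gegenbauer_deriv_pred -[j.+1%:R]natr1; congr (_ * (_%:P * _)).
  by ring.
move: E1; move: (P k) (P k.-1) (k%:R) (n%:R) => p1 p0 a b.
rewrite !polyE0 => E1 E2 E3; apply: (mulfI onemX2_neq0).
apply: (sub_lincomb (1 - 'X ^+ 2 : {poly R}) E3); apply: (sub_lincomb 1 E2).
apply: (sub_lincomb ((3 - a%:P - b%:P) * 'X : {poly R}) E1).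
by ring.
Qed.

Lemma horner_gegenbauer_rec k (x : R) :
  (k.+1%:R + n%:R - 2) * (P k.+2).[x] =
  (2 * k.+1%:R + n%:R - 2) * (x * (P k.+1).[x]) - k.+1%:R * (P k).[x].
Proof.
have := congr1 (horner^~ x) (gegenbauer_rec k).
by rewrite !(hornerD, hornerN, hornerZ, hornerM, hornerX).
Qed.

Lemma gegenbauer_ge1 k (x : R) : 1 <= x -> 1 <= (P k).[x].
Proof.
move=> x1; have n2 : (2 : R) <= n%:R by rewrite (ler_nat R 2 n).
(* The recurrence has a negative term, so the bound is strengthened with monotonicity in the
   degree. *)
suff H j : 1 <= (P j).[x] /\ (P j).[x] <= (P j.+1).[x] by case: (H k).
elim: j => [|j [H1 H2]]; first by rewrite /gegenbauer hornerC hornerX lexx.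
have hj : (0 : R) <= j%:R by exact: ler0n.
have j0 := gegenbauer_den_neq0 j.
split; first exact: le_trans H2.
have := horner_gegenbauer_rec j x; rewrite -[j.+1%:R]natr1 in j0 *.
move: ((P j.+2).[x]) ((P j.+1).[x]) ((P j).[x]) H1 H2 => p2 p1 p0 H1 H2 E.
have K : 0 < j%:R + 1 + n%:R - 2 :> R by lra.
rewrite -(ler_pM2l K) E.
have : p1 <= x * p1 by rewrite ler_peMl //; lra.
by nra.
Qed.

Lemma gegenbauerN k (x : R) : (P k).[- x] = (-1) ^+ k * (P k).[x].
Proof.
elim/ltn_ind: k => -[|[|k]] IHk; first by rewrite /gegenbauer !hornerC mulr1.
  by rewrite /gegenbauer !hornerX expr1 mulN1r.
apply: (mulfI (gegenbauer_den_neq0 k)).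
rewrite horner_gegenbauer_rec [in RHS]mulrCA horner_gegenbauer_rec !IHk // !exprS.
by ring.
Qed.

Lemma gegenbauer_at1 k : (P k).[1] = 1.
Proof.
elim/ltn_ind: k => -[|[|k]] IHk; first by rewrite /gegenbauer hornerC.
  by rewrite /gegenbauer hornerX.
apply: (mulfI (gegenbauer_den_neq0 k)).
by rewrite horner_gegenbauer_rec !IHk //; ring.
Qed.

Lemma gegenbauer_sign k (x : R) : x <= -1 -> 0 < (-1) ^+ k * (P k).[x].
Proof.
by move=> x1; rewrite -gegenbauerN (lt_le_trans ltr01) // gegenbauer_ge1 // lerNr.
Qed.

End Basic.
End GegenbauerAlgebra.

(** * Adjacent families: dimension n + 2, and the weight with an extra factor 1 - t *)

Section AdjacentGegenbauer.
Variable R : realType.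
Variables (n : nat) (n_ge2 : (2 <= n)%N).
Local Notation P := (gegenbauer R n).
Local Notation q := (gegenbauer R n.+2).

Let n2_ge2 : (2 <= n.+2)%N. Proof. by []. Qed.

Lemma gegenbauer_den_gt0 k : 0 < 2 * k%:R + n%:R :> R.
Proof.
have n2 : (2 : R) <= n%:R by rewrite (ler_nat R 2 n).
by have hk : (0 : R) <= k%:R; [exact: ler0n | lra].
Qed.

Lemma gegenbauer_dim_neq0 : n%:R - 1 != 0 :> R.
Proof.
have n2 : (2 : R) <= n%:R by rewrite (ler_nat R 2 n).
by rewrite lt0r_neq0 //; lra.
Qed.

Lemma onemX_neq0 : 1 - 'X != 0 :> {poly R}.
Proof. by rewrite -oppr_eq0 opprB -(polyC1 R) polyXsubC_eq0. Qed.

Lemma onepX_neq0 : 'X + 1 != 0 :> {poly R}.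
Proof. by rewrite -(polyC1 R) -[1%:P]opprK -polyCN polyXsubC_eq0. Qed.

(** Contiguity between dimensions n and n + 2. Both sides obey three-term recurrences, so two
    initial cases and the cofactors below suffice. It is the source of the expansions of [q] and
    [p10] in the [P i]. *)
Lemma onemX2_gegenbauer k :
  (2 * k%:R + n%:R)%:P * ((1 - 'X ^+ 2) * q k) = (n%:R - 1)%:P * (P k - P k.+2).
Proof.
have d0 j : (2 * j%:R + n%:R)%:P != 0 :> {poly R}.
  by rewrite polyC_eq0 gt_eqF // gegenbauer_den_gt0.
have b0 : n%:R - 1 != 0 :> R := gegenbauer_dim_neq0.
elim/ltn_ind: k => -[|[|k]] IHk.
- have := gegenbauer_rec R n_ge2 0; rewrite -!mul_polyC.
  have -> : P 0 = 1 by []. have -> : P 1 = 'X by []. have -> : q 0 = 1 by [].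
  rewrite mulr1n mulr0n; move: (P 2) (n%:R) => p2 b; rewrite !polyE0 => E.
  by apply: (sub_lincomb (1 : {poly R}) E); ring.
- have := gegenbauer_rec R n_ge2 1; have := gegenbauer_rec R n_ge2 0.
  rewrite -!mul_polyC.
  have -> : P 0 = 1 by []. have -> : P 1 = 'X by []. have -> : q 1 = 'X by [].
  have c0 : (n%:R)%:P != 0 :> {poly R} by have := d0 0; rewrite mulr0 add0r.
  rewrite mulr1n; move: (P 3) (P 2) (n%:R) c0 => p3 p2 b c0; rewrite !polyE0 => E1 E2.
  apply: (mulfI c0).
  apply: (sub_lincomb (b%:P - 1 : {poly R}) E2).
  by apply: (sub_lincomb ((b%:P + 2) * 'X : {poly R}) E1); ring.
have nz : (k.+1%:R + n.+2%:R - 2)%:P != 0 :> {poly R}.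
  by rewrite polyC_eq0 gegenbauer_den_neq0.
have := gegenbauer_recC R n2_ge2 k.+1.
have := gegenbauer_recC R n_ge2 k.+1; have := gegenbauer_recC R n_ge2 k.+3.
have := IHk k (ltnW (ltnSn _)); have := IHk k.+1 (ltnSn _).
have := d0 k; have := d0 k.+1; have := d0 k.+2; move: nz.
rewrite [k.+3.-1]/= [k.+1.-1]/=.
move: (P k.+4) (P k.+3) (P k.+2) (P k.+1) (P k) => p4 p3 p2 p1 p0.
move: (q k.+2) (q k.+1) (q k) => q2 q1 q0.
rewrite -[k.+3%:R]natr1 -[k.+2%:R]natr1 -[k.+1%:R]natr1 -[n.+2%:R]natr1 -[n.+1%:R]natr1.
move: (k%:R) (n%:R) => a b; rewrite !polyE0 => nz h2 h1 h0 E1 E0 R3 R1 Q1.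
apply: (mulfI nz); apply: (mulfI h0).
set A := a%:P in nz h2 h1 h0 E1 E0 R3 R1 Q1 *.
set B := b%:P in nz h2 h1 h0 E1 E0 R3 R1 Q1 *.
apply: (sub_lincomb ((2 * A + B) * (2 * A + 4 + B) * (1 - 'X ^+ 2) : {poly R}) Q1).
apply: (sub_lincomb ((2 * A + B) * (2 * A + 4 + B) * 'X : {poly R}) E1).
apply: (sub_lincomb (- (A + 1) * (2 * A + 4 + B) : {poly R}) E0).
apply: (sub_lincomb ((2 * A + B) * (B - 1) : {poly R}) R3).
apply: (sub_lincomb (- (2 * A + 4 + B) * (B - 1) : {poly R}) R1).
by ring.
Qed.

(* Orthogonal for the weight [(1 - t) gweight t], as [gegenbauer n.+2] is for
   [(1 - t ^+ 2) gweight t]. *)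
Definition gegenbauer10 (k : nat) : {poly R} :=
  (k%:R + n%:R - 1) *: q k + k%:R *: q k.-1.
Local Notation p10 := gegenbauer10.

Lemma onemX_gegenbauer10 k :
  (1 - 'X) * p10 k = (n%:R - 1)%:P * (P k - P k.+1).
Proof.
rewrite /p10 -!mul_polyC; case: k => [|k].
  by rewrite /gegenbauer !mulr0n add0r polyC0; ring.
have d0 j : (2 * j%:R + n%:R)%:P != 0 :> {poly R}.
  by rewrite polyC_eq0 gt_eqF // gegenbauer_den_gt0.
have := onemX2_gegenbauer k; have := onemX2_gegenbauer k.+1.
have := gegenbauer_recC R n_ge2 k.+2; have := gegenbauer_recC R n_ge2 k.+1.
have := d0 k; have := d0 k.+1; rewrite [k.+2.-1]/= [k.+1.-1]/=.
move: (P k.+3) (P k.+2) (P k.+1) (P k) (q k.+1) (q k) => p3 p2 p1 p0 q1 q0.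
rewrite -[k.+2%:R]natr1 -[k.+1%:R]natr1.
move: (k%:R) (n%:R) => a b; rewrite !polyE0 => h1 h0 R1 R2 E1 E0.
apply: (mulfI onepX_neq0); apply: (mulfI h1); apply: (mulfI h0).
set A := a%:P in h1 h0 E1 E0 R2 R1 *; set B := b%:P in h1 h0 E1 E0 R2 R1 *.
apply: (sub_lincomb ((2 * A + B) * (A + B) : {poly R}) E1).
apply: (sub_lincomb ((2 * A + 2 + B) * (A + 1) : {poly R}) E0).
apply: (sub_lincomb ((B - 1) * (2 * A + 2 + B) : {poly R}) R1).
by apply: (sub_lincomb (- (B - 1) * (2 * A + B) : {poly R}) R2); ring.
Qed.

Lemma onepX_gegenbauer k :
  (2 * k%:R + n%:R)%:P * (('X + 1) * q k) = p10 k + p10 k.+1.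
Proof.
apply: (mulfI onemX_neq0).
apply: (sub_lincomb (-1 : {poly R}) (onemX_gegenbauer10 k)).
apply: (sub_lincomb (-1 : {poly R}) (onemX_gegenbauer10 k.+1)).
by apply: (sub_lincomb 1 (onemX2_gegenbauer k)); ring.
Qed.

(** [gga k] and [gal k] are the coefficients of ['X * P k] on its upper and lower neighbours; their
    sum is 1 because every [P i] is 1 at 1. For [n = 2], [gal 0] is a division by zero, whose
    default value 0 is the right one. *)
Definition gal (k : nat) : R := k%:R / (2 * k%:R + n%:R - 2).
Definition gga (k : nat) : R := 1 - gal k.

Lemma gal0 : gal 0 = 0. Proof. by rewrite /gal mul0r. Qed.

Lemma gdenS_gt0 k : 0 < 2 * k.+1%:R + n%:R - 2 :> R.
Proof. by have := gegenbauer_den_gt0 k; rewrite -[k.+1%:R]natr1; lra. Qed.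

Lemma gal_gt0 k : 0 < gal k.+1.
Proof. by rewrite divr_gt0 ?gdenS_gt0 // ltr0n. Qed.

Lemma gal_ge0 k : 0 <= gal k.
Proof. by case: k => [|k]; rewrite ?gal0 // ltW ?gal_gt0. Qed.

Lemma gal_le_half k : 2 * gal k <= 1.
Proof.
case: k => [|k]; first by rewrite gal0 mulr0.
have n2 : (2 : R) <= n%:R by rewrite (ler_nat R 2 n).
by rewrite /gal mulrA ler_pdivrMr ?gdenS_gt0 //; lra.
Qed.

Lemma gal_homo i j : (i <= j)%N -> gal i <= gal j.
Proof.
case: i => [|i]; first by rewrite gal0 gal_ge0.
case: j => [|j] // ij; rewrite /gal ler_pdivrMr ?gdenS_gt0 // mulrAC.
rewrite ler_pdivlMr ?gdenS_gt0 //.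
have n2 : (2 : R) <= n%:R by rewrite (ler_nat R 2 n).
have : i.+1%:R <= j.+1%:R :> R by rewrite ler_nat.
by nra.
Qed.

Lemma gga_gt0 k : 0 < gga k.
Proof. by rewrite /gga; have := gal_le_half k; lra. Qed.

Lemma gegenbauerX k : 'X * P k = gga k *: P k.+1 + gal k *: P k.-1.
Proof.
rewrite -!mul_polyC; case: k => [|k].
  by rewrite /gga gal0 subr0 polyC0 mul0r addr0 /gegenbauer mulr1 mul1r.
have h0 : (2 * k.+1%:R + n%:R - 2)%:P != 0 :> {poly R}.
  by rewrite polyC_eq0 gt_eqF // gdenS_gt0.
apply: (mulfI h0); apply: (sub_lincomb (-1 : {poly R}) (gegenbauer_recC R n_ge2 k.+1)).
have E : (2 * k.+1%:R + n%:R - 2) * gal k.+1 = k.+1%:R.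
  by rewrite mulrC divfK // gt_eqF // gdenS_gt0.
have := congr1 (@polyC R) E; rewrite /gga.
move: (k.+1%:R) (n%:R) (gal k.+1) => a b c; rewrite !polyE0 => E'.
apply: (sub_lincomb (P k.+2 - P k : {poly R}) E').
by rewrite [k.+1.-1]/=; ring.
Qed.

Lemma gegenbauer10X k :
  'X * p10 k =
  gga k.+1 *: p10 k.+1 + (gal k - gal k.+1) *: p10 k + gal k *: p10 k.-1.
Proof.
apply: (mulfI onemX_neq0).
have := gegenbauerX k; have := gegenbauerX k.+1.
have := onemX_gegenbauer10 k; have := onemX_gegenbauer10 k.+1.
have : (gal k)%:P * ((1 - 'X) * p10 k.-1) =
       (gal k)%:P * ((n%:R - 1)%:P * (P k.-1 - P k)).
  case: (k) => [|j]; first by rewrite gal0 polyC0 !mul0r.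
  by rewrite onemX_gegenbauer10.
move: (p10 k) (p10 k.+1) (p10 k.-1) => u v w; rewrite /gga [k.+1.-1]/= -!mul_polyC.
move: (P k.+2) (P k.+1) (P k) (P k.-1) (gal k.+1) (gal k) n%:R => p2 p1 p0 pm a1 a0 b.
rewrite !polyE0 => Ew Ev Eu R1 R0.
apply: (sub_lincomb (- 1 : {poly R}) Ew).
apply: (sub_lincomb (- (1 - a1%:P) : {poly R}) Ev).
apply: (sub_lincomb ('X - a0%:P + a1%:P : {poly R}) Eu).
apply: (sub_lincomb (b%:P - 1 : {poly R}) R0).
by apply: (sub_lincomb (- (b%:P - 1) : {poly R}) R1); ring.
Qed.

(** Unrolled, it makes [p10 k] a combination of all [P i], [i <= k], with positive coefficients: up
    to a scalar, [p10 k] is their Christoffel-Darboux kernel at 1. *)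
Lemma gegenbauer10_pred k :
  gga k *: p10 k = (n%:R - 1) *: P k + gal k *: p10 k.-1.
Proof.
apply: (mulfI onemX_neq0).
have := gegenbauerX k; have := onemX_gegenbauer10 k.
have : (gal k)%:P * ((1 - 'X) * p10 k.-1) =
       (gal k)%:P * ((n%:R - 1)%:P * (P k.-1 - P k)).
  case: (k) => [|j]; first by rewrite gal0 polyC0 !mul0r.
  by rewrite onemX_gegenbauer10.
move: (p10 k) (p10 k.-1) => u w; rewrite /gga -!mul_polyC.
move: (P k.+1) (P k) (P k.-1) (gal k) n%:R => p1 p0 pm a0 b.
rewrite !polyE0 => Ew Eu R0.
apply: (sub_lincomb (- 1 : {poly R}) Ew).
apply: (sub_lincomb (1 - a0%:P : {poly R}) Eu).
by apply: (sub_lincomb (b%:P - 1 : {poly R}) R0); ring.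
Qed.

(** The analogue for [q], which must descend by two: [q k] has the parity of [k], so only the [P i]
    of that parity occur. *)
Lemma gegenbauer_dim_pred k :
  (gga k.+2 * gga k.+3 * (2 * k.+2%:R + n%:R)) *: q k.+2 =
  (n%:R - 1) *: P k.+2 + (gal k.+2 * gal k.+1 * (2 * k%:R + n%:R)) *: q k.
Proof.
apply: (mulfI (onemX2_neq0 R)); rewrite -!mul_polyC.
have := gegenbauerX k.+1; have := gegenbauerX k.+2; have := gegenbauerX k.+3.
have := onemX2_gegenbauer k; have := onemX2_gegenbauer k.+2.
rewrite /gga /= -!mul_polyC.
move: (P k.+4) (P k.+3) (P k.+2) (P k.+1) (P k) (q k.+2) (q k) => p4 p3 p2 p1 p0 q2 q0.
move: (gal k.+3) (gal k.+2) (gal k.+1) (k.+2%:R) (k%:R) (n%:R) => a3 a2 a1 k2 k0 b.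
rewrite !polyE0 => E2 E0 R3 R2 R1.
apply: (sub_lincomb ((1 - a2%:P) * (1 - a3%:P) : {poly R}) E2).
apply: (sub_lincomb (- a2%:P * a1%:P : {poly R}) E0).
apply: (sub_lincomb ((b%:P - 1) * 'X : {poly R}) R2).
apply: (sub_lincomb ((b%:P - 1) * (1 - a2%:P) : {poly R}) R3).
by apply: (sub_lincomb ((b%:P - 1) * a2%:P : {poly R}) R1); ring.
Qed.

(** The equations of [q k] and [q k.-1] have different eigenvalues; this identity absorbs the
    difference when they are added in [gegenbauer10_ode]. *)
Lemma gegenbauer10_deriv k :
  (1 - 'X) * (p10 k)^`() =
  (k%:R * (k%:R + n%:R - 1))%:P * (q k.-1 - q k).
Proof.
apply: (mulfI onepX_neq0); rewrite /p10 derivD !derivZ -!mul_polyC.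
have E1 := gegenbauer_deriv R n2_ge2 k.
case: k E1 => [|k] E1.
  by rewrite ?mulr0n ?mul0r ?polyC0 [q 0]/(1 : {poly R}) (derivC 1); ring.
have := gegenbauer_deriv_pred R n2_ge2 k; move: E1; rewrite [k.+1.-1]/=.
move: (q k.+1) (q k) => q1 q0.
rewrite -[k.+1%:R]natr1 -[n.+2%:R]natr1 -[n.+1%:R]natr1.
move: (k%:R) (n%:R) => a b; rewrite !polyE0 => E1 E0.
apply: (sub_lincomb (a%:P + b%:P : {poly R}) E1).
by apply: (sub_lincomb (a%:P + 1 : {poly R}) E0); ring.
Qed.

Lemma gegenbauer10_ode k :
  (1 - 'X ^+ 2) * (p10 k)^`()^`() =
  (1 + n%:R *: 'X) * (p10 k)^`() - (k%:R * (k%:R + n%:R - 1))%:P * p10 k.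
Proof.
have := gegenbauer10_deriv k.
have := gegenbauer_ode R n2_ge2 k; rewrite /p10 !derivD !derivZ -!mul_polyC.
case: k => [|k].
  by rewrite /gegenbauer (derivC 1) (derivC 0) !mulr0n mul0r polyC0 => _ _; ring.
have := gegenbauer_ode R n2_ge2 k; rewrite [k.+1.-1]/=.
move: (q k.+1) (q k) => q1 q0.
rewrite -[k.+1%:R]natr1 -[n.+2%:R]natr1 -[n.+1%:R]natr1.
move: (k%:R) (n%:R) => a b; rewrite !polyE0 => E0 E1 D.
apply: (sub_lincomb (a%:P + b%:P : {poly R}) E1).
apply: (sub_lincomb (a%:P + 1 : {poly R}) E0).
by apply: (sub_lincomb (-1 : {poly R}) D); ring.
Qed.

Lemma gegenbauer10_sign k (x : R) : x <= -1 -> 0 < (-1) ^+ k * (p10 k).[x].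
Proof.
move=> x1; have n2 : (2 : R) <= n%:R by rewrite (ler_nat R 2 n).
have E : (1 - x) * (p10 k).[x] = (n%:R - 1) * ((P k).[x] - (P k.+1).[x]).
  have := congr1 (horner^~ x) (onemX_gegenbauer10 k).
  by rewrite /= !(hornerD, hornerN, hornerM, hornerX, hornerC).
have x0 : 0 < 1 - x by lra.
rewrite -(pmulr_rgt0 _ x0) mulrCA E mulrCA pmulr_rgt0; last by lra.
rewrite mulrBr subr_gt0 (@lt_trans _ _ 0) ?gegenbauer_sign //.
by have := gegenbauer_sign n_ge2 k.+1 x1; rewrite exprS mulN1r mulNr oppr_gt0.
Qed.

End AdjacentGegenbauer.

(** * Orthogonal polynomials given by a recurrence *)

Section RealRoots.
Variable R : realType.
Implicit Types (p : {poly R}) (x t u : R).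

Lemma exists_largest_root p u : p != 0 -> root p u ->
  exists t, [/\ u <= t, root p t & forall x, t < x -> ~~ root p x].
Proof.
have [m] := ubnP (size p); elim: m p u => // m IHm p u pm p0 pu.
have /factor_theorem[p1 Ep] := pu.
have p10 : p1 != 0 by apply: contraNneq p0 => p10; rewrite Ep p10 mul0r.
have [[v uv p1v]|H] := pselect (exists2 v, u < v & root p1 v).
  have sp1 : (size p1 < m)%N.
    by move: pm; rewrite Ep size_Mmonic ?monicXsubC // size_XsubC addn2 /= ltnS.
  have [t [vt p1t tmax]] := IHm p1 v sp1 p10 p1v.
  exists t; split; first by rewrite (le_trans (ltW uv)).
    by rewrite Ep rootM p1t.
  move=> x tx; rewrite Ep rootM (negbTE (tmax _ tx)) root_XsubC /=.
  by rewrite gt_eqF // (lt_trans uv) // (le_lt_trans vt).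
exists u; split=> // x ux; rewrite Ep rootM root_XsubC negb_or gt_eqF // andbT.
by apply/negP => p1x; apply: H; exists x.
Qed.

Lemma pos_right_of_root p t x b : (forall y, t < y -> ~~ root p y) ->
  t < x -> t < b -> 0 < p.[b] -> 0 < p.[x].
Proof.
move=> H tx tb pb; rewrite ltNge; apply/negP => px.
have [xb|bx] := leP x b.
  have [|y /andP[xy _] py] := @poly_ivt R p x b xb; first by rewrite px ltW.
  by have := H y (lt_le_trans tx xy); rewrite py.
have [|y /andP[yb _] py] := @poly_ivt R (- p) b x (ltW bx).
  by rewrite !hornerN oppr_le0 oppr_ge0 ltW.
by have := H y (lt_le_trans tb yb); rewrite -rootN py.
Qed.

Lemma sup_roots p t : root p t -> (forall x, t < x -> ~~ root p x) ->
  sup [set x | root p x]%classic = t.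
Proof.
move=> pt H; have ub : ubound [set x | root p x]%classic t.
  by move=> x /= px; rewrite leNgt; apply/negP => /H; rewrite px.
apply/eqP; rewrite eq_le (ge_sup _ ub) /=; last by exists t.
by apply: ub_le_sup => //; exists t.
Qed.

End RealRoots.

Section ThreeTermRecurrence.
Variables (R : realType) (Q : nat -> {poly R}) (A B C : nat -> R) (c : R).
Hypotheses (c_gt0 : 0 < c) (Q0 : Q 0 = c%:P)
  (A_gt0 : forall k, 0 < A k) (C0 : C 0 = 0) (C_gt0 : forall k, 0 < C k.+1)
  (QX : forall k, 'X * Q k = A k *: Q k.+1 + B k *: Q k + C k *: Q k.-1).

(** Up to a common factor, the inverse squared norms of the [Q k] for a functional making them
    orthogonal; here they are determined by [cdw k.+1 * C k.+1 = cdw k * A k], which makes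
    Christoffel-Darboux telescope. *)
Fixpoint cdw (k : nat) : R :=
  if k is k'.+1 then cdw k' * A k' / C k'.+1 else 1.

Lemma cdw_gt0 k : 0 < cdw k.
Proof. by elim: k => [|k IHk] /=; rewrite ?ltr01 // divr_gt0 ?mulr_gt0. Qed.

Definition cdker (s : R) (k : nat) : {poly R} :=
  \sum_(i < k) (cdw i * (Q i).[s]) *: Q i.

Lemma horner_QX k x :
  x * (Q k).[x] = A k * (Q k.+1).[x] + B k * (Q k).[x] + C k * (Q k.-1).[x].
Proof.
have := congr1 (horner^~ x) (QX k).
by rewrite /= !(hornerD, hornerZ, hornerM, hornerX).
Qed.

Lemma christoffel_darboux s k :
  ('X - s%:P) * cdker s k.+1 =
  (cdw k * A k) *: ((Q k).[s] *: Q k.+1 - (Q k.+1).[s] *: Q k).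
Proof.
have cd0 i : ('X - s%:P) * ((Q i).[s] *: Q i) =
    A i *: ((Q i).[s] *: Q i.+1 - (Q i.+1).[s] *: Q i)
    - C i *: ((Q i.-1).[s] *: Q i - (Q i).[s] *: Q i.-1).
  have := QX i; have := congr1 (@polyC R) (horner_QX i s); rewrite -!mul_polyC.
  move: (Q i.+1) (Q i) (Q i.-1) (A i) (B i) (C i) => q1 q0 qm a b d.
  rewrite !polyE0 => E1 E2.
  apply: (sub_lincomb ((q0.[s])%:P : {poly R}) E2).
  by apply: (sub_lincomb (- q0 : {poly R}) E1); ring.
elim: k => [|k IHk].
  by rewrite /cdker big_ord1 -scalerA -scalerAr cd0 C0 scale0r subr0 scalerA.
rewrite /cdker big_ord_recr /= mulrDr -/(cdker s k.+1) IHk.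
rewrite -[X in _ + _ * X]scalerA -[X in _ + X]scalerAr cd0 -[k.+1.-1]/k.
have E : cdw k.+1 * C k.+1 = cdw k * A k by rewrite /= divfK ?gt_eqF.
have := congr1 (@polyC R) E; rewrite -/(cdw k.+1) -!mul_polyC.
move: (cdw k.+1) (cdw k) => w1 w0; rewrite !polyE0 => E'.
by apply: (sub_lincomb ((Q k.+1).[s]%:P * Q k - (Q k).[s]%:P * Q k.+1) E'); ring.
Qed.

Lemma size_recQ k : size (Q k) = k.+1.
Proof.
elim/ltn_ind: k => -[|k] IHk; first by rewrite Q0 size_polyC gt_eqF.
rewrite -(@size_scale _ (A k)) ?gt_eqF //.
have -> : A k *: Q k.+1 = 'X * Q k - (B k *: Q k + C k *: Q k.-1).
  by rewrite QX -[X in X - _]addrA addrK.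
have sX : size ('X * Q k) = k.+2.
  by rewrite mulrC size_mulX ?IHk // -size_poly_eq0 IHk.
rewrite size_polyDl sX // size_polyN ltnS (leq_trans (size_polyD _ _)) // geq_max.
apply/andP; split; apply: leq_trans (size_scale_leq _ _) _; first by rewrite IHk.
by case: k IHk {sX} => [|k] IHk; rewrite IHk.
Qed.

Lemma recQ_neq0 k : Q k != 0.
Proof. by rewrite -size_poly_eq0 size_recQ. Qed.

Hypothesis Q_gt0 : forall k x, 1 <= x -> 0 < (Q k).[x].

(** Largest zeros increase with the degree: at the largest zero [t] of [Q k.+1] the recurrence gives
    [A Q_(k+2)(t) = - C Q_k(t) < 0], so [Q k.+2] vanishes between [t] and 1. *)
Lemma recQ_largest_root k : exists t, [/\ root (Q k.+1) t, t < 1,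
  forall x, t < x -> ~~ root (Q k.+1) x &
  forall i x, (i <= k)%N -> t <= x -> 0 < (Q i).[x]].
Proof.
have Hex j u : u < 1 -> (Q j).[u] < 0 -> exists t, [/\ u < t, root (Q j) t, t < 1 &
    forall x, t < x -> ~~ root (Q j) x].
  move=> u1 Qu; have [|v /andP[uv v1] Qv] := @poly_ivt R (Q j) u 1 (ltW u1).
    by rewrite (ltW Qu) ltW ?Q_gt0.
  have [t [vt Qt tmax]] := exists_largest_root (recQ_neq0 j) Qv.
  exists t; split => //; last first.
    by rewrite ltNge; apply/negP => /(Q_gt0 j); rewrite (rootP Qt) ltxx.
  rewrite (lt_le_trans _ vt) // lt_neqAle uv andbT.
  by apply: contraTneq Qu => ->; rewrite (rootP Qv) ltxx.
elim: k => [|k [t [Qt t1 tmax tpos]]].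
  have [u [u1 Qu]] : exists u, u < 1 /\ (Q 1).[u] < 0.
    have E x : x * c = A 0 * (Q 1).[x] + B 0 * c.
      by have := horner_QX 0 x; rewrite C0 Q0 !hornerC mul0r addr0.
    (* [Q 1] is a positive multiple of ['X - (B 0)%:P]; any point below both 1 and [B 0] would
       do. *)
    pose u := Num.min 0 (B 0 - 1); exists u; split.
      by rewrite /u gt_min ltr01.
    have ub : u < B 0 by rewrite /u gt_min ltrBlDr ltrDl ltr01 orbT.
    rewrite -(pmulr_rlt0 _ (A_gt0 0)) -(addrK (B 0 * c) (_ * _)) -E -mulrBl.
    by rewrite pmulr_llt0 // subr_lt0.
  have [t [_ Qt t1 tmax]] := Hex _ _ u1 Qu.
  exists t; split => // i x; rewrite leqn0 => /eqP -> _.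
  by rewrite Q0 hornerC.
have Qt2 : (Q k.+2).[t] < 0.
  have := horner_QX k.+1 t; rewrite (rootP Qt) !mulr0 addr0 /= => /eqP.
  rewrite eq_sym addr_eq0 => /eqP E.
  by rewrite -(pmulr_rlt0 _ (A_gt0 k.+1)) E oppr_lt0 mulr_gt0 ?tpos.
have [t' [tt' Qt' t'1 t'max]] := Hex _ _ t1 Qt2.
exists t'; split=> // i x; rewrite leq_eqVlt => /orP[/eqP -> t'x|]; last first.
  by rewrite ltnS => ik t'x; apply: tpos => //; rewrite (le_trans (ltW tt')).
by apply: (pos_right_of_root tmax _ t1); rewrite ?Q_gt0 // (lt_le_trans tt').
Qed.

(** At a zero [t] of [Q k.+1], Christoffel-Darboux expresses [(Q k.+1).[x]] as a positive multiple
    of [x - t] times the kernel, here a sum of nonnegative terms. Being left of [t] would not be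
    enough alone, since [Q k.+1] may have smaller zeros. *)
Lemma recQ_le0 k t x : root (Q k.+1) t -> (forall i, (i <= k)%N -> 0 < (Q i).[t]) ->
  x <= t -> (forall i, (i <= k)%N -> 0 <= (Q i).[x]) -> (Q k.+1).[x] <= 0.
Proof.
move=> Qt tpos xt xpos.
have := congr1 (horner^~ x) (christoffel_darboux t k).
rewrite /= /cdker !(hornerM, hornerD, hornerN, hornerX, hornerC, hornerZ).
rewrite (rootP Qt) mul0r subr0 horner_sum => E.
have AQ : 0 < cdw k * A k * (Q k).[t] by rewrite !mulr_gt0 ?cdw_gt0 ?tpos.
rewrite -(pmulr_rle0 _ AQ) -[leLHS]mulrA -E mulr_le0_ge0 ?subr_le0 // sumr_ge0 // => i _.
have ik : (i <= k)%N by rewrite -ltnS.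
rewrite hornerZ; apply: mulr_ge0; last exact: xpos.
by apply: mulr_ge0; apply: ltW; [exact: cdw_gt0 | exact: tpos].
Qed.

Hypothesis Q_sign : forall k x, x <= -1 -> 0 < (-1) ^+ k * (Q k).[x].

(** Left of -1 each [Q i] keeps the sign it has at -1, so the kernel at -1 is positive there and
    [Q_k(-1) Q_(k+1)(t) - Q_(k+1)(-1) Q_k(t)] is negative. At a zero [t] of the combination, the
    ratio of [Q k.+1] to [Q k] would be the same at [t] and at [s], and the sign assumed at -1 would
    contradict this. *)
Lemma recQ_comb_neq0 k s t : 0 < (Q k).[s] ->
  0 <= (-1) ^+ k.+1 * ((Q k).[s] * (Q k.+1).[-1] - (Q k.+1).[s] * (Q k).[-1]) ->
  t < -1 -> (Q k).[s] * (Q k.+1).[t] - (Q k.+1).[s] * (Q k).[t] != 0.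
Proof.
move=> Qs H t1.
have := congr1 (horner^~ t) (christoffel_darboux (-1) k).
rewrite /= /cdker !(hornerM, hornerD, hornerN, hornerX, hornerC, hornerZ) horner_sum.
have rA : 0 < cdw k * A k by rewrite mulr_gt0 ?cdw_gt0.
set S := \sum_(i < k.+1) _.
have Sp : 0 < S.
  have Spos i : 0 < (cdw i * (Q i).[-1] *: Q i).[t].
    rewrite hornerZ -mulrA mulr_gt0 ?cdw_gt0 //.
    have := mulr_gt0 (Q_sign i (lexx (-1))) (Q_sign i (ltW t1)).
    by rewrite mulrACA -expr2 sqrr_sign mul1r.
  by rewrite /S big_ord_recl ltr_wpDr ?Spos // sumr_ge0 // => i _; rewrite ltW ?Spos.
have q1 := Q_sign k (lexx (-1)); have qt := Q_sign k (ltW t1).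
have e1 : (-1) ^+ k * (-1) ^+ k = 1 :> R by rewrite -expr2 sqrr_sign.
rewrite exprS in H.
move: ((Q k.+1).[-1]) ((Q k.+1).[t]) ((Q k.+1).[s]) => p1 pt tau in H *.
move: ((-1) ^+ k) e1 ((Q k).[-1]) ((Q k).[t]) ((Q k).[s]) Qs q1 qt H
  => e e1 y1 yt sigma Qs q1 qt H E.
apply/eqP => F.
have D : y1 * pt - p1 * yt < 0.
  rewrite -(pmulr_rlt0 _ rA) -E pmulr_llt0 //.
  by lra.
have : 0 <= sigma * (y1 * pt - p1 * yt).
  have -> : sigma * (y1 * pt - p1 * yt) =
      (e * yt) * (-1 * e * (sigma * p1 - tau * y1)).
    apply: (sub_lincomb y1 F).
    by apply: (sub_lincomb (yt * (sigma * p1 - tau * y1)) e1); ring.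
  by rewrite mulr_ge0 // ltW.
by rewrite leNgt pmulr_rlt0 // D.
Qed.

End ThreeTermRecurrence.

(** * Jacobi polynomials *)

Section JacobiODE.
Variable R : realType.
Implicit Types (a b x : R) (y z w : {poly R}).

Definition jode a b (i : nat) y :=
  (1 - 'X ^+ 2) * y^`()^`() + ((b - a)%:P - (a + b + 2) *: 'X) * y^`()
  + (i%:R * (i%:R + a + b + 1)) *: y.

Lemma jodeD a b i : {morph jode a b i : y z / y + z}.
Proof. by move=> y z; rewrite /jode !derivD !mulrDr scalerDr; ring. Qed.

Lemma jodeZ a b i (c : R) y : jode a b i (c *: y) = c *: jode a b i y.
Proof. by rewrite /jode !derivZ !scalerDr -!scalerAr !scalerA [c * _]mulrC. Qed.

Lemma jode_sum a b i (I : Type) (r : seq I) (F : I -> {poly R}) :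
  jode a b i (\sum_(j <- r) F j) = \sum_(j <- r) jode a b i (F j).
Proof.
apply: (big_morph _ (jodeD a b i)).
by rewrite /jode !(derivC 0) scaler0 !mulr0 !addr0.
Qed.

(* [U] and [V] stand for [(X - 1) / 2] and [(X + 1) / 2]. *)
Section Basis.
Variables U V : {poly R}.
Hypotheses (XU : 'X = 2 * U + 1) (VU : V = U + 1).
Hypotheses (dU : 2 * U^`() = 1) (dV : 2 * V^`() = 1).

Lemma deriv_UV j l : 2 * (U ^+ j * V ^+ l)^`() =
  j%:R%:P * (U ^+ j.-1 * V ^+ l) + l%:R%:P * (U ^+ j * V ^+ l.-1).
Proof.
rewrite derivM !deriv_exp -!(mulr_natl (_ * _)) -!polyC_natr.
move: (U ^+ j) (U ^+ j.-1) (V ^+ l) (V ^+ l.-1) (j%:R%:P) (l%:R%:P)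
  => p p1 q q1 c d.
apply: (sub_lincomb (c * p1 * q) dU).
by apply: (sub_lincomb (d * p * q1) dV); ring.
Qed.

Lemma jode_UV a b j l : jode a b (j + l) (U ^+ j * V ^+ l) =
  (j%:R * (j%:R + a)) *: (U ^+ j * V ^+ l - U ^+ j.-1 * V ^+ l.+1)
  - (l%:R * (l%:R + b)) *: (U ^+ j.+1 * V ^+ l.-1 - U ^+ j * V ^+ l).
Proof.
have D1 := deriv_UV j l.
have D2 := congr1 (@deriv R) D1; rewrite -polyC_natr derivD !deriv_mulC polyC_natr in D2.
have := deriv_UV j.-1 l; have := deriv_UV j l.-1; move: D1 D2.
have Cp (y : {poly R}) k : k%:R%:P * (y * y ^+ k.-1) = k%:R%:P * y ^+ k.
  by case: k => [|k]; rewrite ?polyC0 ?mul0r // exprS.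
have natp k : k%:R%:P * k.-1%:R%:P = k%:R%:P * (k%:R%:P - 1) :> {poly R}.
  by case: k => [|k]; rewrite ?polyC0 ?mul0r // -[k.+1%:R]natr1 polyCD polyC1 addrK.
have := Cp U j; have := Cp U j.-1; have := Cp V l; have := Cp V l.-1.
have := natp j; have := natp l.
rewrite /jode !exprS natrD -!mul_polyC VU XU.
move: (U ^+ j.-1.-1) (U ^+ j) (U ^+ j.-1) => p2 p p1.
move: ((U + 1) ^+ l.-1.-1) ((U + 1) ^+ l) ((U + 1) ^+ l.-1) => q2 q q1.
move: (j%:R) (j.-1%:R) (l%:R) (l.-1%:R) => c c1 d d1.
move: ((p * q)^`()^`()) ((p * q)^`()) ((p1 * q)^`()) ((p * q1)^`()) => z2 z1 y1 x1.
rewrite !polyE0; move: (a%:P) (b%:P) (c%:P) (c1%:P) (d%:P) (d1%:P).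
move=> {}a {}b {}c {}c1 {}d {}d1 N2 N1 B2 B1 A2 A1 D1 D2 D12 D11.
apply: (sub_lincomb (- 2 * U * (U + 1)) D2).
apply: (sub_lincomb (- U * (U + 1) * c) D11).
apply: (sub_lincomb (- U * (U + 1) * d) D12).
apply: (sub_lincomb (- (a + 1 + (a + b + 2) * U)) D1).
apply: (sub_lincomb (- c * (U + 1) * q) A2).
apply: (sub_lincomb (- (U + 1) * p1 * q) N1).
apply: (sub_lincomb (- d * U * p) B2).
apply: (sub_lincomb (- U * p * q1) N2).
apply: (sub_lincomb (- 2 * d * (U + 1) * q1 - (b + 1) * q) A1).
apply: (sub_lincomb (- 2 * c * p - (a + 1) * p) B1).
by ring.
Qed.

End Basis.

Lemma gbinomS (x : R) k : gbinom x k.+1 * k.+1%:R = gbinom x k * (x - k%:R).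
Proof.
rewrite /gbinom big_ord_recr /= factS natrM.
have k1 : k.+1%:R != 0 :> R by rewrite pnatr_eq0.
have f0 : k`!%:R != 0 :> R by rewrite pnatr_eq0 -lt0n fact_gt0.
move: (\prod_(i < k) _) (k.+1%:R) (k`!%:R) k1 f0 => P u v u0 v0.
by field; rewrite u0 v0.
Qed.

Lemma gbinom_gt0 (x : R) k : k%:R - 1 < x -> 0 < gbinom x k.
Proof.
move=> kx; rewrite divr_gt0 ?ltr0n ?fact_gt0 // prodr_gt0 // => i _.
have : i%:R + 1 <= k%:R :> R by rewrite natr1 ler_nat.
by lra.
Qed.

(** By [jode_UV] the operator sends each term of the explicit sum to two differences. The ratio of
    consecutive coefficients makes the second difference at [j] cancel the first one at [j.+1]. *)
Lemma jode_jacobi a b i : jode a b i (jacobi a b i) = 0.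
Proof.
pose U : {poly R} := 2^-1 *: ('X - 1); pose V : {poly R} := 2^-1 *: ('X + 1).
have h2 : 2 * (2^-1)%:P = 1 :> {poly R}.
  by rewrite -(polyC_natr R 2) -polyCM divff.
have XU : 'X = 2 * U + 1 by rewrite /U -mul_polyC mulrA h2 mul1r subrK.
have VU : V = U + 1.
  by rewrite /V /U -!mul_polyC; apply: (sub_lincomb 1 h2); ring.
have dU : 2 * U^`() = 1.
  by rewrite derivZ derivB derivX (derivC 1) subr0 -mul_polyC mulr1.
have dV : 2 * V^`() = 1.
  by rewrite derivZ derivD derivX (derivC 1) addr0 -mul_polyC mulr1.
pose A j : R := gbinom (i%:R + a) (i - j) * gbinom (i%:R + b) j.
(* Both ends of the telescope vanish: [W 0] by its factor [j%:R], and [W i.+1] by convention. *)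
pose W j : {poly R} := if (j <= i)%N then (A j * (j%:R * (j%:R + a))) *:
  (U ^+ j * V ^+ (i - j) - U ^+ j.-1 * V ^+ (i - j).+1) else 0.
rewrite /jacobi jode_sum (eq_bigr (fun j : 'I_i.+1 => - W j.+1 - - W j)); last first.
  move=> [j /=]; rewrite ltnS => ji _; rewrite opprK [RHS]addrC jodeZ -/U -/V -/(A j).
  rewrite -{1}(subnKC ji) jode_UV // scalerBr !scalerA /W ji.
  congr (_ *: _ - _); have [ij|] := ltnP j i; last first.
    by rewrite -subn_eq0 => /eqP ->; rewrite mul0r mulr0 scale0r.
  rewrite subnSK //; congr (_ *: (_ - _)); last by rewrite subnS.
  rewrite /A; have -> : (i - j = (i - j.+1).+1)%N by rewrite subnSK.
  have := gbinomS (i%:R + b) j; have := gbinomS (i%:R + a) (i - j.+1).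
  have : i%:R = j%:R + 1 + (i - j.+1)%N%:R :> R by rewrite natr1 -natrD subnKC.
  move: (gbinom _ _.+1) (gbinom _ (i - j.+1)) (gbinom _ j.+1) (gbinom _ j).
  rewrite -[(_ - _).+1%:R]natr1 -[j.+1%:R]natr1.
  move: (i%:R) (j%:R) ((i - j.+1)%:R) => x y z g1 g0 h1 h0 -> E1 E2.
  apply: (sub_lincomb (h0 * (z + 1 + b)) E1).
  by apply: (sub_lincomb (- g0 * (y + 1 + a)) E2); ring.
rewrite -(big_mkord xpredT (fun j => - W j.+1 - - W j)).
rewrite (telescope_sumr (fun j => - W j)) //.
by rewrite /W ltnn mul0r mulr0 scale0r leq0n subrr.
Qed.

Lemma jacobi_at1 a b i : -1 < a -> (jacobi a b i).[1] != 0.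
Proof.
move=> a1; rewrite /jacobi horner_sum big_ord_recl big1 => [|j _].
  rewrite addr0 subn0 expr0 mul1r hornerZ horner_exp hornerZ hornerD hornerX.
  rewrite (hornerC 1) (_ : 2^-1 * (1 + 1) = 1) ?mulVf // expr1n mulr1.
  rewrite [gbinom _ (ord0 : 'I__)]/gbinom big_ord0 fact0 divr1 mulr1.
  by rewrite gt_eqF // gbinom_gt0 //; lra.
rewrite hornerZ hornerM horner_exp hornerZ hornerD hornerN hornerX (hornerC 1).
by rewrite subrr mulr0 expr0n /= mul0r mulr0.
Qed.

Lemma size_jacobi a b i : (size (jacobi a b i) <= i.+1)%N.
Proof.
apply: leq_trans (size_sum _ _ _) _; apply/bigmax_leqP => j _.
have ji : (j <= i)%N by rewrite -ltnS.
apply: leq_trans (size_scale_leq _ _) _.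
have sz (y : {poly R}) k : (size y <= 2 -> size (y ^+ k) <= k.+1)%N.
  move=> y2; apply: leq_trans (size_poly_exp_leq _ _) _; rewrite ltnS.
  by case: (size y) y2 => [|[|[|]]] //= _; rewrite ?mul0n ?mul1n.
apply: leq_trans (size_polyMleq _ _) _.
have s1 : (size (2^-1 *: ('X - 1) : {poly R})%R <= 2)%N.
  by apply: leq_trans (size_scale_leq _ _) _; rewrite -polyC1 size_XsubC.
have s2 : (size (2^-1 *: ('X + 1) : {poly R})%R <= 2)%N.
  by apply: leq_trans (size_scale_leq _ _) _; rewrite -polyC1 size_XaddC.
have /= := leq_add (sz _ j s1) (sz _ (i - j)%N s2).
by rewrite addSn addnS subnKC //; case: (_ + _)%N.
Qed.

Lemma coef_jode a b i y k : (size y <= k.+1)%N ->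
  (jode a b i y)`_k =
  (i%:R * (i%:R + a + b + 1) - k%:R * (k%:R + a + b + 1)) * y`_k.
Proof.
move=> yk; have y0 : y`_k.+1 = 0 by rewrite nth_default.
have y1 : y`_k.+2 = 0 by rewrite nth_default // (leq_trans yk).
rewrite /jode mulrBl mul1r mulrBl !(coefD, coefN, coefZ) coefXnM coefCM -scalerAl coefZ.
rewrite coefXM !coef_deriv y0 y1 !mul0rn mulr0.
case: k {yk} y0 y1 => [|[|k]] y0 y1 /=.
- by ring.
- by rewrite mulr1n; ring.
rewrite !subn2 [k.+2.-2]/= -[_ *+ k.+2 *+ _]mulr_natr -![_`_k.+2 *+ k.+2]mulr_natr.
rewrite -[k.+2%:R]natr1 -[k.+1%:R]natr1.
by ring.
Qed.

(** Once the terms of degree [i] are cancelled, [coef_jode] multiplies the leading coefficient of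
    the difference by a gap between two eigenvalues, which is positive when [0 < a + b + 2]. *)
Lemma jode_unique a b i y z : 0 < a + b + 2 -> (size y <= i.+1)%N -> size z = i.+1 ->
  jode a b i y = 0 -> jode a b i z = 0 -> exists c, y = c *: z.
Proof.
move=> ab sy sz yE zE; have lz : z`_i != 0.
  by have := lead_coef_eq0 z; rewrite lead_coefE sz -size_poly_eq0 sz => ->.
exists (y`_i / z`_i); apply/eqP; rewrite -subr_eq0; set w := y - _.
have wE : jode a b i w = 0.
  by rewrite /w -scaleNr jodeD jodeZ yE zE scaler0 addr0.
have sw : (size w <= i)%N.
  apply/leq_sizeP => j; rewrite leq_eqVlt => /orP[/eqP <-|ij].
    by rewrite /w coefB coefZ divfK // subrr.
  by rewrite /w coefB coefZ (nth_default _ (leq_trans sy ij)) [z`_j]nth_default ?sz // mulr0 subrr.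
apply: contraT => w0.
have [k sk] : exists k, size w = k.+1.
  by exists (size w).-1; rewrite prednK // lt0n size_poly_eq0.
have := coef_jode a b i (eq_leq sk); rewrite wE coef0 => /esym/eqP.
rewrite mulf_eq0 orbC -[w`_k]/(w`_k.+1.-1) -sk -lead_coefE lead_coef_eq0 (negbTE w0) /=.
move=> /eqP E; exfalso; move: E.
have : k%:R + 1 <= i%:R :> R by rewrite natr1 ler_nat -sk.
have : 0 <= k%:R :> R by exact: ler0n.
move: (k%:R) (i%:R) => u v u0 uv.
have -> : v * (v + a + b + 1) - u * (u + a + b + 1) =
  (v - u) * (v + u - 1) + (v - u) * (a + b + 2) by ring.
have : 0 < (v - u) * (a + b + 2) by rewrite mulr_gt0 //; lra.
have : 0 <= (v - u) * (v + u - 1) by rewrite mulr_ge0 //; lra.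
lra.
Qed.

Lemma jacobi_unique a b i z : -1 < a -> 0 < a + b + 2 -> size z = i.+1 ->
  jode a b i z = 0 -> exists2 c, c != 0 & jacobi a b i = c *: z.
Proof.
move=> a1 ab sz zE.
have [c E] := jode_unique ab (size_jacobi a b i) sz (jode_jacobi a b i) zE.
exists c => //; apply: contraNneq (jacobi_at1 b i a1) => c0.
by rewrite E c0 scale0r horner0.
Qed.

End JacobiODE.

(** * Integration against the Gegenbauer weight *)

Section ImproperFTC.
Variable R : realType.
Notation mu := (@lebesgue_measure R).
Local Open Scope classical_set_scope.

(** [f] may blow up at the endpoints. On the open interval [F] differs by a constant from the
    indefinite integral of [f], and one-sided continuity of both carries this to the ends. *)
Lemma FTC2_oo (f F : R -> R) (a b : R) : a < b ->
  mu.-integrable `[a, b] (EFin \o f) ->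
  {in `]a, b[, continuous f} ->
  (forall x, a < x < b -> is_derive x 1 F (f x)) ->
  F x @[x --> a^'+] --> F a -> F x @[x --> b^'-] --> F b ->
  \int[mu]_(x in `[a, b]) f x = F b - F a.
Proof.
move=> ab intf fc dF Fa Fb.
pose H x := \int[mu]_(t in `[a, x]) f t.
have /(continuous_within_itvP _ ab)[_ Ha Hb] :
  {within `[a, b], continuous H} := parameterized_integral_continuous (ltW ab) intf.
pose D x := F x - H x.
have Da : D x @[x --> a^'+] --> D a by apply: cvgB.
have Db : D x @[x --> b^'-] --> D b by apply: cvgB.
have Dxy x y : a < x -> x < y -> y < b -> D x = D y.
  move=> ax xy yb.
  have intf' c : c <= b -> mu.-integrable `[a, c] (EFin \o f).
    move=> cb; apply: integrableS intf => //.
    by apply: subset_itvl; rewrite bnd_simp.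
  have E1 : H y - H x = \int[mu]_(t in `]x, y]) f t.
    apply: Rintegral_itvB; rewrite ?bnd_simp ?ltW //.
      by apply: intf'; rewrite ltW.
  have fxy : {within `[x, y], continuous f}.
    apply: continuous_in_subspaceT => z; rewrite inE /= ?in_itv /= => /andP[xz zy].
    by apply: fc; rewrite inE /= in_itv /= (lt_le_trans ax) // (le_lt_trans zy).
  have E2 : \int[mu]_(t in `[x, y]) f t = F y - F x.
    rewrite /Rintegral (continuous_FTC2 xy fxy (F := F)) //; last first.
      move=> z; rewrite in_itv /= => /andP[xz zy].
      have dz : is_derive z 1 F (f z) by apply: dF; rewrite (lt_trans ax) // (lt_trans zy).
      by rewrite derive1E derive_val.
    have Fc z : a < z < b -> {for z, continuous F}.
      move=> azb; apply: differentiable_continuous; apply/derivable1_diffP.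
      by have [] := dF z azb.
    split.
    - move=> z; rewrite in_itv /= => /andP[xz zy].
      by have [] : is_derive z 1 F (f z) by apply: dF; rewrite (lt_trans ax) // (lt_trans zy).
    - by apply: cvg_at_right_filter; apply: Fc; rewrite ax (lt_trans xy).
    - by apply: cvg_at_left_filter; apply: Fc; rewrite yb (lt_trans ax).
  have E3 : \int[mu]_(t in `]x, y]) f t = \int[mu]_(t in `[x, y]) f t.
    apply: Rintegral_itv_obnd_cbnd; apply: integrableS intf => //.
    by apply: subset_itv; rewrite bnd_simp ltW.
  by move: E1; rewrite E3 E2 /D; move: (H x) (H y) (F x) (F y) => u v p q; lra.
pose m := (a + b) / 2; have am : a < m by rewrite /m; lra.
have mb : m < b by rewrite /m; lra.
have Dam : D a = D m.
  apply: (cvg_unique _ Da) => //; apply: cvg_near_cst; near=> x.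
  by apply: Dxy mb; near: x; [exact: nbhs_right_gt | exact: nbhs_right_lt].
have Dbm : D b = D m.
  apply: (cvg_unique _ Db) => //; apply: cvg_near_cst; near=> x; apply/esym.
  by apply: Dxy am _ _; near: x; [exact: nbhs_left_gt | exact: nbhs_left_lt].
have E : D b = D a by rewrite Dam.
have Ha0 : H a = 0 by rewrite /H set_itv1 Rintegral_set1.
by move: E; rewrite /D Ha0 -/(H b); lra.
Unshelve. all: end_near. Qed.

End ImproperFTC.

Section ArcWeight.
Variable R : realType.
Notation mu := (@lebesgue_measure R).
Local Open Scope classical_set_scope.

Definition ultraweight (c t : R) : R := (1 - t ^+ 2) `^ c.

Lemma onemX2_gt0 (t : R) : -1 < t < 1 -> 0 < 1 - t ^+ 2.
Proof. by move=> /andP[? ?]; nra. Qed.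

Lemma is_derive_powR (a c : R) : 0 < a -> is_derive a 1 (@powR R ^~ c) (c * a `^ (c - 1)).
Proof.
move=> a0; have ha : a \in `]0, +oo[%R by rewrite in_itv /= andbT.
apply: DeriveDef; first exact: derivable_powR.
by rewrite -derive1E powR_derive1.
Qed.

Lemma is_derive_ultraweight (c t : R) : -1 < t < 1 ->
  is_derive t 1 (ultraweight c) (c * ultraweight (c - 1) t * (- (2 * t))).
Proof.
move=> t1; have -> : ultraweight c = @powR R ^~ c \o horner (1 - 'X ^+ 2).
  by apply/funext => x /=; rewrite hornerD hornerN hornerXn hornerC.
have -> : - (2 * t) = (1 - 'X ^+ 2 : {poly R})^`().[t].
  by rewrite deriv_onemX2 hornerN hornerMn hornerX mulr_natl.
apply: is_derive1_comp.
have -> : (1 - 'X ^+ 2).[t] = 1 - t ^+ 2 by rewrite hornerD hornerN hornerXn hornerC.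
by apply: is_derive_powR; exact: onemX2_gt0.
Qed.

Lemma continuous_ultraweight (c t : R) : -1 < t < 1 -> {for t, continuous (ultraweight c)}.
Proof.
move=> t1; apply: differentiable_continuous; apply/derivable1_diffP.
by have [] := is_derive_ultraweight c t1.
Qed.

Lemma measurable_ultraweight (c : R) : measurable_fun setT (ultraweight c).
Proof.
apply: (measurableT_comp (measurable_powR c)).
apply: measurable_funB; first exact: measurable_cst.
by apply: measurable_funX; exact: measurable_id.
Qed.

Lemma is_derive_asin_ultraweight (t : R) : -1 < t < 1 ->
  is_derive t 1 asin (ultraweight (- 2^-1) t).
Proof.
move=> t1; rewrite /ultraweight powRN powR12_sqrt ?ltW ?onemX2_gt0 //.
exact: is_derive1_asin.
Qed.

(* The case [n = 2], in which the weight is the largest near the endpoints. *)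
Lemma integrable_arcweight :
  mu.-integrable `[-1, 1] (EFin \o ultraweight (- 2^-1)).
Proof.
set w := ultraweight _.
have mf (A : set R) : measurable_fun A (EFin \o w).
  by apply: measurable_funTS; apply/measurable_EFinP; exact: measurable_ultraweight.
have w0 t : 0 <= w t by exact: powR_ge0.
apply/integrableP; split; first exact: mf.
under eq_integral => t _ do rewrite /= ger0_norm //.
rewrite integral_itv_bndoo; last exact: mf.
pose e k : R := k.+2%:R^-1.
have e0 k : 0 < e k by rewrite invr_gt0 ltr0n.
have e1 k : e k < 1 by rewrite invf_lt1 ?ltr0n // ltr1n.
pose A k : set R := `[- 1 + e k, 1 - e k].
have -> : `]-1, 1[ = \bigcup_k A k.
  apply/seteqP; split => t /=; rewrite in_itv /=.
    move=> /andP[t1 t2].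
    pose d := Num.min (t + 1) (1 - t); have d0 : 0 < d by rewrite lt_min; lra.
    pose k := Num.truncn d^-1.
    exists k => //; rewrite /A /= in_itv /=.
    have : e k <= d.
      rewrite /e invf_ple ?posrE ?ltr0n // (le_trans (ltW (truncnS_gt _))) //.
      by rewrite ler_nat.
    by rewrite le_min => /andP[? ?]; lra.
  move=> [k _]; rewrite /A /= in_itv /= => /andP[? ?].
  by have := e0 k; lra.
(* On each compact interval of the exhaustion the integral is an increment of [asin], hence at most
   [pi]; monotone convergence concludes. *)
apply: (@le_lt_trans _ _ (pi : R)%:E); last exact: ltry.
have ndA : nondecreasing_seq A.
  move=> i j ij; rewrite subsetEset; apply: subset_itv; rewrite bnd_simp.
    by rewrite lerD2l lef_pV2 ?posrE ?ltr0n // ler_nat.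
  by rewrite lerB // lef_pV2 ?posrE ?ltr0n // ler_nat.
have cvgA : (\int[mu]_(x in A i) (w x)%:E)%E @[i --> \oo] -->
    (\int[mu]_(x in \bigcup_i A i) (w x)%:E)%E.
  apply: ge0_nondecreasing_set_cvg_integral => //.
  - by move=> i; exact: measurable_itv.
  - by move=> i; exact: mf.
  - by move=> i x _; rewrite lee_fin.
rewrite -(cvg_lim _ cvgA) //; apply: lime_le; first by apply/cvg_ex; eexists; exact: cvgA.
apply: nearW => k.
have ak : - 1 + e k < 1 - e k.
  have : e k <= 2^-1 by rewrite lef_pV2 ?posrE ?ltr0n // ler_nat.
  have : 2^-1 < 1 :> R by rewrite invf_lt1 ?ltr1n.
  by lra.
have w1 t : - 1 + e k <= t <= 1 - e k -> -1 < t < 1.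
  by have := e0 k; move=> ? /andP[? ?]; lra.
rewrite /= (continuous_FTC2 ak (F := asin)).
- rewrite -EFinB lee_fin.
  have : asin (1 - e k) <= pi / 2 by apply: asin_lepi2; have := e1 k; have := e0 k; lra.
  have : - (pi / 2) <= asin (- 1 + e k).
    by apply: asin_geNpi2; have := e1 k; have := e0 k; lra.
  by move: (pi : R) => p; lra.
- apply: continuous_in_subspaceT => z; rewrite inE /= in_itv /= => zk.
  by apply: continuous_ultraweight; exact: w1.
- split.
  + move=> z; rewrite in_itv /= => /andP[z1 z2].
    by have [] : is_derive z 1 asin (w z) by apply/is_derive_asin_ultraweight/w1; rewrite !ltW.
  + apply: cvg_at_right_filter; apply: continuous_asin.
    by apply: w1; rewrite lexx ltW.
  + apply: cvg_at_left_filter; apply: continuous_asin.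
    by apply: w1; rewrite lexx ltW.
- move=> z; rewrite in_itv /= => /andP[z1 z2].
  have dz : is_derive z 1 asin (w z) by apply/is_derive_asin_ultraweight/w1; rewrite !ltW.
  by rewrite derive1E derive_val.
Qed.

End ArcWeight.

Section Functional.
Variables (R : realType) (n : nat) (n_ge2 : (2 <= n)%N).
Notation mu := (@lebesgue_measure R).
Local Notation P := (gegenbauer R n).
Local Open Scope classical_set_scope.

Let n2R : (2 : R) <= n%:R. Proof. by rewrite (ler_nat R 2 n). Qed.

Lemma gweight_ge0 t : 0 <= gweight n t :> R.
Proof. exact: powR_ge0. Qed.

(** The exponent is at least -1/2 and the base at most 1. The summand 1 serves at the endpoints: for
    [n = 3] the weight is zero to the power zero, that is 1, while [ultraweight (- 2^-1)] takes
    there the default value 0. *)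
Lemma gweight_le t : -1 <= t <= 1 ->
  gweight n t <= 1 + ultraweight (- 2^-1) t :> R.
Proof.
move=> /andP[t1 t2]; rewrite /gweight /ultraweight.
have : 0 <= 1 - t ^+ 2 by nra.
have v1 : 1 - t ^+ 2 <= 1 by rewrite lerBlDr lerDl sqr_ge0.
rewrite le_eqVlt => /predU1P[<-|v0].
  have [->|c0] := eqVneq ((n%:R - 3) / 2 : R) 0.
    by rewrite powRr0 lerDl powR_ge0.
  by rewrite powR0 // addr_ge0 ?powR_ge0.
have hn := n2R.
rewrite (@le_trans _ _ ((1 - t ^+ 2) `^ (- 2^-1))) ?lerDr //.
by apply: ger_powR; [rewrite v0|lra].
Qed.

Lemma integrable_poly_gweight (p : {poly R}) :
  mu.-integrable `[-1, 1] (EFin \o (fun t => p.[t] * gweight n t)).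
Proof.
have pc : {within `[(-1 : R), 1], continuous (fun t => `|p.[t]|)}.
  apply: continuous_subspaceT => t; apply: continuous_comp; first exact: continuous_horner.
  exact: norm_continuous.
have N11 : (-1 : R) <= 1 by lra.
have [x _ xmax] := EVT_max N11 pc; pose c := `|p.[x]|.
have mp : measurable_fun `[(-1 : R), 1] (EFin \o (fun t => p.[t] * gweight n t)).
  apply/measurable_EFinP; apply: measurable_funTS; apply: measurable_funM.
    exact: measurable_poly.
  exact: measurable_ultraweight.
pose G := EFin \o (fun t => c * (1 + ultraweight (- 2^-1) t)).
refine (@le_integrable _ _ R mu _ _ _ G mp _ _) => /=.
- exact: measurable_itv.
- move=> t; rewrite in_itv /= => t1; rewrite lee_fin normrM (ger0_norm (gweight_ge0 t)).
  rewrite [leRHS]ger0_norm; last first.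
    by apply: mulr_ge0; [exact: normr_ge0 | rewrite addr_ge0 ?powR_ge0].
  by apply: ler_pM => //; [exact: gweight_ge0|apply: xmax; rewrite in_itv|exact: gweight_le].
rewrite /G; have -> : EFin \o (fun t => c * (1 + ultraweight (- 2^-1) t)) =
    (fun t => c%:E * (cst 1 t + (ultraweight (- 2^-1) t)%:E))%E.
  by apply/funext => t.
apply: integrableZl; first exact: measurable_itv.
apply: integrableD; first exact: measurable_itv.
  apply: (@continuous_compact_integrable _ (cst 1)); first exact: segment_compact.
  by apply: continuous_subspaceT => t; exact: cvg_cst.
exact: integrable_arcweight.
Qed.

Let mD11 : measurable (`[-1, 1] : set (measurableTypeR R)) := measurable_itv _.

Definition glam (p : {poly R}) : R :=
  \int[mu]_(t in `[-1, 1]) (p.[t] * gweight n t).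

Lemma glamD p q : glam (p + q) = glam p + glam q.
Proof.
rewrite /glam.
rewrite -(@RintegralD _ _ R mu _ _ _ mD11 (integrable_poly_gweight p) (integrable_poly_gweight q)).
by apply: eq_Rintegral => t _; rewrite hornerD mulrDl.
Qed.

Lemma glamZ c p : glam (c *: p) = c * glam p.
Proof.
rewrite /glam -(@RintegralZl _ _ R mu _ _ c mD11 (integrable_poly_gweight p)).
by apply: eq_Rintegral => t _; rewrite hornerZ mulrA.
Qed.

Lemma ultraweight_cvg0 (G : set_system R) (FG : ProperFilter G) (c x : R) :
  2^-1 <= c -> 1 - x ^+ 2 = 0 -> G --> x -> (\forall t \near G, -1 < t < 1) ->
  ultraweight c t @[t --> G] --> 0.
Proof.
move=> c2 x1 Gx G1.
apply: (@squeeze_cvgr _ _ _ _ (cst 0) (fun t => Num.sqrt (1 - t ^+ 2))).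
- near=> t; have t1 : -1 < t < 1 by near: t.
  have v0 := onemX2_gt0 t1; rewrite powR_ge0 /= -(powR12_sqrt (ltW v0)) /ultraweight.
  by apply: ger_powR => //; rewrite v0 lerBlDr lerDl sqr_ge0.
- exact: cvg_cst.
- rewrite -(sqrtr0 R) -x1.
  apply: (@continuous_cvg _ _ _ _ _ _ (@Num.sqrt R)); first exact: sqrt_continuous.
  by apply: cvgB; [exact: cvg_cst | apply: cvgM].
Unshelve. all: end_near. Qed.

(** The integrand is the derivative of [p(t) (1 - t^2)^((n-1)/2)], which vanishes at both
    endpoints. *)
Lemma glam_parts p :
  glam ((1 - 'X ^+ 2) * p^`() - (n%:R - 1) *: ('X * p)) = 0.
Proof.
pose c : R := (n%:R - 1) / 2.
have c0 : 0 < c by rewrite /c; have := n2R; lra.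
have cE : c - 1 = (n%:R - 3) / 2 by rewrite /c; field.
pose F t := p.[t] * ultraweight c t.
have wE t : -1 < t < 1 -> ultraweight c t = (1 - t ^+ 2) * gweight n t.
  move=> t1; rewrite /gweight -cE /ultraweight -{2}(powRr1 (ltW (onemX2_gt0 t1))).
  by rewrite -powRD ?(gt_eqF (onemX2_gt0 t1)) ?implybT // [1 + (c - 1)]addrC subrK.
have w1 : ultraweight c 1 = 0 by rewrite /ultraweight expr1n subrr powR0 // gt_eqF.
have wN1 : ultraweight c (-1) = 0.
  by rewrite /ultraweight sqrrN expr1n subrr powR0 // gt_eqF.
have F0 : F 1 - F (-1) = 0 by rewrite /F w1 wN1 !mulr0 subrr.
rewrite -F0 /glam; apply: FTC2_oo.
- by lra.
- exact: integrable_poly_gweight.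
- move=> t; rewrite inE /= in_itv /= => t1.
  apply: cvgM; first exact: continuous_horner.
  exact: continuous_ultraweight.
- move=> t t1.
  have dw := is_derive_ultraweight c t1.
  have := is_deriveM (is_derive_poly p t) dw.
  rewrite /F; set d := (X in is_derive _ _ _ X -> _).
  suff -> : d = ((1 - 'X^2) * p^`() - (n%:R - 1) *: ('X * p)).[t] * gweight n t by [].
  rewrite /d wE // cE -[ultraweight ((n%:R - 3) / 2) t]/(gweight n t).
  rewrite !(hornerD, hornerN, hornerM, hornerZ, hornerX, hornerXn, hornerC).
  by rewrite /GRing.scale /= /c; field.
- have c2 : 2^-1 <= c by rewrite /c; have := n2R; lra.
  rewrite {2}/F wN1 mulr0 -(mulr0 p.[-1]); apply: cvgM.
    by apply: cvg_at_right_filter; exact: continuous_horner.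
  apply: (@ultraweight_cvg0 _ _ c (-1)) => //.
  - by rewrite sqrrN expr1n subrr.
  - exact: cvg_within.
  near=> t; apply/andP; split; near: t.
    exact: nbhs_right_gt.
  by apply: nbhs_right_lt; lra.
- have c2 : 2^-1 <= c by rewrite /c; have := n2R; lra.
  rewrite {2}/F w1 mulr0 -(mulr0 p.[1]); apply: cvgM.
    by apply: cvg_at_left_filter; exact: continuous_horner.
  apply: (@ultraweight_cvg0 _ _ c 1) => //.
  - by rewrite expr1n subrr.
  - exact: cvg_within.
  near=> t; apply/andP; split; near: t.
    by apply: nbhs_left_gt; lra.
  exact: nbhs_left_lt.
Unshelve. all: end_near. Qed.

Lemma glam1_gt0 : 0 < glam 1.
Proof.
(* On [J] the base [1 - t ^+ 2] lies in [3/4, 1] and the exponent is at most [n], so the bound below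
   holds whatever the sign of the exponent. *)
pose J : set R := `[0, 2^-1].
have wJ t : J t -> (3 / 4) `^ n%:R <= 1%:P.[t] * gweight n t :> R.
  rewrite /J /= in_itv /= hornerC mul1r => /andP[t0 t1].
  have v1 : 3 / 4 <= 1 - t ^+ 2 by nra.
  apply: (@le_trans _ _ ((1 - t ^+ 2) `^ n%:R)).
    by apply: ge0_ler_powR; rewrite ?nnegrE ?ler0n //; lra.
  apply: ger_powR; last by have := n2R; lra.
  by apply/andP; split; [lra | rewrite lerBlDr lerDl sqr_ge0].
have intw := integrable_poly_gweight 1.
have mJ : measurable (J : set (measurableTypeR R)) by exact: measurable_itv.
have JS : J `<=` `[-1, 1] by apply: subset_itv; rewrite bnd_simp; lra.
have intJ : mu.-integrable J (EFin \o (fun t => 1%:P.[t] * gweight n t)).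
  by apply: integrableS intw => //; rewrite polyC1.
have w0 t : 0 <= 1%:P.[t] * gweight n t :> R.
  by rewrite hornerC mul1r gweight_ge0.
apply: (@lt_le_trans _ _ ((3 / 4) `^ n%:R * 2^-1)).
  by rewrite mulr_gt0 ?powR_gt0 ?invr_gt0 //; lra.
rewrite -lee_fin.
pose I : set R := `[-1, 1].
have -> : (glam 1)%:E = (\int[mu]_(t in I) (1%:P.[t] * gweight n t)%:E)%E.
  by rewrite /glam /Rintegral fineK //; apply: integrable_fin_num.
apply: (@le_trans _ _ (\int[mu]_(t in J) (1%:P.[t] * gweight n t)%:E)%E); last first.
  apply: ge0_subset_integral => //.
    by have /integrableP[] := intw.
  by move=> t _; rewrite lee_fin; exact: w0.
rewrite EFinM.
have -> : (2^-1)%:E = mu J.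
  by rewrite lebesgue_measure_itv /= lte_fin invr_gt0 ltr0n /= -EFinB subr0.
rewrite -integral_cst //; apply: ge0_le_integral => //.
- by move=> t _; rewrite lee_fin powR_ge0.
- by have /integrableP[] := intJ.
Qed.

(* Sturm-Liouville operator, symmetric for [(p, q) |-> glam (p * q)]. *)
Definition gsl (p : {poly R}) : {poly R} :=
  (1 - 'X ^+ 2) * p^`()^`() - (n%:R - 1) *: ('X * p^`()).

Lemma glam_gsl p q : glam (q * gsl p) = - glam ((1 - 'X ^+ 2) * p^`() * q^`()).
Proof.
apply/eqP; rewrite -addr_eq0 -glamD -(glam_parts (q * p^`())).
apply/eqP; congr glam; rewrite derivM /gsl -!mul_polyC; ring.
Qed.

Lemma gsl_gegenbauer k : gsl (P k) = - (k%:R * (k%:R + n%:R - 2)) *: P k.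
Proof.
rewrite /gsl (gegenbauer_ode R n_ge2 k) -!mul_polyC polyCN.
by ring.
Qed.

Lemma gsl_eigenvalue_neq i j : i != j ->
  i%:R * (i%:R + n%:R - 2) != j%:R * (j%:R + n%:R - 2) :> R.
Proof.
wlog lij : i j / (i < j)%N => [H ij|_].
  have := ij; rewrite neq_ltn => /orP[] l; first exact: H.
  by rewrite eq_sym; apply: H; rewrite // eq_sym.
rewrite lt_eqF //; have := n2R; have : i%:R + 1 <= j%:R :> R by rewrite natr1 ler_nat.
have : 0 <= i%:R :> R by exact: ler0n.
by move: (i%:R) (j%:R) (n%:R) => a b c ? ? ?; nra.
Qed.

Lemma glam_orth i j : i != j -> glam (P i * P j) = 0.
Proof.
move=> ij; have := glam_gsl (P i) (P j).
have -> : (1 - 'X ^+ 2) * (P i)^`() * (P j)^`() = (1 - 'X ^+ 2) * (P j)^`() * (P i)^`().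
  by rewrite mulrAC.
rewrite -(glam_gsl (P j) (P i)) !gsl_gegenbauer -!scalerAr !glamZ [P j * P i]mulrC.
move=> /eqP; rewrite -subr_eq0 -mulrBl mulf_eq0 => /orP[|/eqP //].
by rewrite subr_eq0 eqr_opp (negbTE (gsl_eigenvalue_neq ij)).
Qed.

(** Expanding ['X * P i * P i.+1] by the recurrence of either factor gives, by orthogonality,
    [gga_i |P_(i+1)|^2 = gal_(i+1) |P_i|^2]: positivity propagates from [glam1_gt0]. *)
Lemma glam_sqr_gt0 i : 0 < glam (P i * P i).
Proof.
elim: i => [|i IHi]; first by rewrite mulr1 glam1_gt0.
have := gegenbauerX R n_ge2 i => /(congr1 (fun p => glam (p * P i.+1))).
rewrite [_ * P i.+1 in LHS]mulrAC (gegenbauerX R n_ge2 i.+1) !mulrDl !glamD.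
have O1 : glam (P i.+2 * P i) = 0 by rewrite glam_orth // gtn_eqF // ltnW.
have O2 : glam (P i.-1 * P i.+1) = 0.
  by rewrite glam_orth // ltn_eqF // ltnS leq_pred.
rewrite [i.+1.-1]/=; move: O1 O2 IHi.
move: (P i.+2) (P i.+1) (P i) (P i.-1) => p2 p1 p0 pm O1 O2 IHi.
rewrite -!scalerAl !glamZ O1 O2 !mulr0 addr0 add0r => E.
by rewrite -(pmulr_rgt0 _ (gga_gt0 R n_ge2 i)) -E mulr_gt0 // gal_gt0.
Qed.

Lemma size_gegenbauer i : size (P i) = i.+1.
Proof.
apply: (@size_recQ R P (gga R n) (fun=> 0) (gal R n) 1) => //.
- exact: gga_gt0.
- by move=> k; rewrite scale0r addr0; exact: gegenbauerX.
Qed.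

Lemma pcoefE (p : {poly R}) i : pcoef n p i = glam (p * P i) / glam (P i * P i).
Proof.
rewrite /pcoef /gcoef /glam; congr (_ / _); apply: eq_Rintegral => t _.
  by rewrite hornerM.
by rewrite hornerM expr2.
Qed.

Lemma pcoefD (p q : {poly R}) i : pcoef n (p + q) i = pcoef n p i + pcoef n q i.
Proof. by rewrite !pcoefE mulrDl glamD mulrDl. Qed.

Lemma pcoefZ c (p : {poly R}) i : pcoef n (c *: p) i = c * pcoef n p i.
Proof. by rewrite !pcoefE -scalerAl glamZ mulrA. Qed.

Lemma pcoef0 i : pcoef n (0 : {poly R}) i = 0.
Proof. by rewrite -(scale0r (0 : {poly R})) pcoefZ mul0r. Qed.

Lemma pcoef_sum (I : Type) (r : seq I) (F : I -> {poly R}) i :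
  pcoef n (\sum_(j <- r) F j) i = \sum_(j <- r) pcoef n (F j) i.
Proof. exact: (big_morph _ (fun p q => pcoefD p q i) (pcoef0 i)). Qed.

Lemma pcoef_gegenbauer j i : pcoef n (P j) i = (i == j)%:R.
Proof.
rewrite pcoefE; case: eqVneq => [->|ij]; first by rewrite divff // gt_eqF // glam_sqr_gt0.
by rewrite glam_orth 1?eq_sym // mul0r.
Qed.

Lemma gegenbauer_expansion d (p : {poly R}) : (size p <= d)%N ->
  p = \sum_(i < d) pcoef n p i *: P i.
Proof.
move=> pd; suff [c E] : exists c : 'I_d -> R, p = \sum_(i < d) c i *: P i.
  rewrite {1}E; apply: eq_bigr => i _; congr (_ *: _); rewrite E pcoef_sum.
  rewrite (bigD1 i) //= pcoefZ pcoef_gegenbauer eqxx mulr1 big1 ?addr0 // => j ji.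
  by rewrite pcoefZ pcoef_gegenbauer eq_sym -val_eqE /= in ji *; rewrite (negbTE ji) mulr0.
elim: d p pd => [|d IHd] p pd.
  exists (fun=> 0); rewrite big_ord0; apply/eqP; by rewrite -size_poly_eq0 -leqn0.
have lP : lead_coef (P d) != 0 by rewrite lead_coef_eq0 -size_poly_eq0 size_gegenbauer.
have [|c E] := IHd (p - (p`_d / lead_coef (P d)) *: P d).
  apply/leq_sizeP => j; rewrite leq_eqVlt coefB coefZ => /orP[/eqP <-|dj].
    have -> : (P d)`_d = lead_coef (P d) by rewrite lead_coefE size_gegenbauer.
    by rewrite divfK // subrr.
  rewrite (nth_default _ (leq_trans pd dj)) [(P d)`_j]nth_default ?size_gegenbauer //.
  by rewrite mulr0 subrr.
exists (fun i => if unlift ord_max i is Some j then c j else p`_d / lead_coef (P d)).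
rewrite big_ord_recr /= unlift_none -[LHS](subrK ((p`_d / lead_coef (P d)) *: P d)) E.
congr (_ + _); apply: eq_bigr => i _.
have -> : widen_ord (leqnSn d) i = lift ord_max i
  by apply: val_inj; rewrite /= /bump leqNgt ltn_ord.
by rewrite liftK.
Qed.

Lemma pcoef_default (p : {poly R}) i : (size p <= i)%N -> pcoef n p i = 0.
Proof.
move=> pi; rewrite {1}(gegenbauer_expansion pi) pcoef_sum big1 // => j _.
by rewrite pcoefZ pcoef_gegenbauer gtn_eqF ?mulr0.
Qed.

End Functional.

(** * Products of Gegenbauer polynomials *)

Section Linearization.
Variables (R : realType) (n : nat) (n_ge2 : (2 <= n)%N).
Local Notation P := (gegenbauer R n).
Local Notation al := (gal R n).
Local Notation ga := (gga R n).
Implicit Types p q : {poly R}.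

Definition gcone p := forall i, 0 <= pcoef n p i.

Lemma gconeD p q : gcone p -> gcone q -> gcone (p + q).
Proof. by move=> cp cq i; rewrite pcoefD // addr_ge0. Qed.

Lemma gconeZ c p : 0 <= c -> gcone p -> gcone (c *: p).
Proof. by move=> c0 cp i; rewrite pcoefZ // mulr_ge0. Qed.

Lemma gcone0 : gcone 0.
Proof. by move=> i; rewrite pcoef0. Qed.

Lemma gcone_sum (I : Type) (r : seq I) (F : I -> {poly R}) :
  (forall i, gcone (F i)) -> gcone (\sum_(i <- r) F i).
Proof. by move=> cF; apply: big_ind => //; [exact: gcone0 | exact: gconeD]. Qed.

Lemma gcone_gegenbauer k : gcone (P k).
Proof. by move=> i; rewrite pcoef_gegenbauer. Qed.

Local Notation pk k := (cdw ga al k *: P k).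
Let u i j := pk i * pk j.

(** The weights [cdw] transpose the recurrence: each neighbour [j] now carries its own [al j] or
    [ga j], two numbers of sum one. *)
Lemma dual_recurrence k :
  'X * pk k = al k.+1 *: pk k.+1 + (if k is k'.+1 then ga k' else 0) *: pk k.-1.
Proof.
rewrite -scalerAr gegenbauerX // scalerDr !scalerA; congr (_ + _).
  congr (_ *: _); rewrite /= [RHS]mulrC divfK //.
  by rewrite gt_eqF // gal_gt0.
case: k => [|k]; first by rewrite gal0 mulr0 mul0r.
congr (_ *: _); rewrite /= divfK 1?mulrC //.
by rewrite gt_eqF // gal_gt0.
Qed.

Fixpoint rdiag (i m : nat) : {poly R} :=
  if m is m'.+1 then (al i.+1 - al m') *: u i.+1 m' + rdiag i.+1 m' else 0.

Fixpoint ldiag (i m : nat) : {poly R} :=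
  if m is m'.+1 then (ga i.-1 - al m') *: u i.-1 m' + ldiag i.-1 m' else 0.

(* The coefficients of the dual recurrence sum to one, so that the sum of the
   discrete wave equation [u X (i, m) = X u (i, m)] over the triangle below
   [(i, m)] telescopes to its two slanted edges. *)
Lemma al_u_diag i m : (m <= i)%N -> al m *: u i m = rdiag i m + ldiag i m.
Proof.
elim/ltn_ind: m i => -[|m] IHm i mi; first by rewrite gal0 scale0r addr0.
case: i mi => // i mi.
have E : al m.+1 *: u i.+1 m.+1 + (if m is m'.+1 then ga m' else 0) *: u i.+1 m.-1 =
    al i.+2 *: u i.+2 m + ga i *: u i m.
  have := dual_recurrence m; have := dual_recurrence i.+1; rewrite /u [i.+1.-1]/=.
  move: (pk i.+2) (pk i.+1) (pk i) (pk m.+1) (pk m) (pk m.-1) => a2 a1 a0 b1 b0 bm.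
  move: (if m is _.+1 then _ else _) => gm; rewrite -!mul_polyC => E1 E2.
  apply: (sub_lincomb b0 E1).
  by apply: (sub_lincomb (- a1) E2); ring.
have Hg : ldiag i.+2 m + rdiag i m = (if m is m'.+1 then ga m' else 0) *: u i.+1 m.-1.
  case: m mi IHm {E} => [|m] mi IHm /=; first by rewrite scale0r addr0.
  have mi1 : (m <= i.+1)%N by rewrite (leq_trans (leqnSn m)) // ltnW.
  have := IHm m (ltnW (ltnSn _)) i.+1 mi1; rewrite /gga.
  move: (rdiag _ _) (ldiag _ _) (u _ _) (al _) (al _) => r l v a b.
  rewrite -!mul_polyC !polyE0 => E.
  by apply: (sub_lincomb (-1 : {poly R}) E); ring.
have H1 := IHm m (ltnSn _) i.+2 (leq_trans mi (leqW (leqnSn _))).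
have H0 := IHm m (ltnSn _) i mi.
rewrite [rdiag i.+1 m.+1]/= [ldiag i.+1 m.+1]/=.
move: E Hg H1 H0; move: (if m is _.+1 then _ else _) => gm.
move: (rdiag i.+2 m) (ldiag i m) (ldiag i.+2 m) (rdiag i m) => r2 l0 l2 r0.
move: (u i.+2 m) (u i m) (u i.+1 m.+1) (u i.+1 m.-1) => u2 u0 u1 um.
move: (al m.+1) (al m) (al i.+2) (ga i) => a1 a0 a2 g0.
rewrite -!mul_polyC !polyE0 => E Hg H1 H0.
apply: (sub_lincomb 1 E); apply: (sub_lincomb 1 Hg).
by apply: (sub_lincomb 1 H1); apply: (sub_lincomb 1 H0); ring.
Qed.

(** The two edges involve only smaller second indices, and their coefficients are nonnegative: on
    the right because [gal] is nondecreasing, on the left because [gal <= 1/2 <= gga]. *)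
Lemma gcone_u i m : (m <= i)%N -> gcone (u i m).
Proof.
elim/ltn_ind: m i => -[|m] IHm i mi.
  have -> : u i 0 = cdw ga al i *: P i by rewrite /u /= scale1r mulr1.
  by apply: gconeZ; [rewrite ltW // cdw_gt0 //; [exact: gga_gt0 | exact: gal_gt0]
                    | exact: gcone_gegenbauer].
have a0 : 0 < al m.+1 by exact: gal_gt0.
have -> : u i m.+1 = (al m.+1)^-1 *: (rdiag i m.+1 + ldiag i m.+1).
  by rewrite -al_u_diag // scalerA mulVf ?gt_eqF // scale1r.
apply: gconeZ; first by rewrite invr_ge0 ltW.
have cr l j : (l <= m.+1)%N -> (l <= j.+1)%N -> gcone (rdiag j l).
  elim: l j => [|l IHl] j lm lj; first exact: gcone0.
  apply: gconeD; last by apply: IHl => //; rewrite ltnW // ltnW.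
  apply: gconeZ; first by rewrite subr_ge0 gal_homo // ltnW // ltnW.
  by apply: IHm => //; rewrite ltnW // ltnW.
have cl l j : (l <= m.+1)%N -> (l <= j)%N -> gcone (ldiag j l).
  elim: l j => [|l IHl] [|j] // lm lj; try exact: gcone0.
  apply: gconeD; last by apply: IHl => //; rewrite ltnW.
  apply: gconeZ; last by apply: IHm.
  by rewrite subr_ge0 /gga; have := gal_le_half R n_ge2 l;
     have := gal_le_half R n_ge2 j; rewrite /=; lra.
by apply: gconeD; [apply: cr => //; rewrite ltnW // ltnS | apply: cl].
Qed.

Lemma gcone_gegenbauerM i j : gcone (P i * P j).
Proof.
have cdw0 k : 0 < cdw ga al k by apply: cdw_gt0; [exact: gga_gt0 | exact: gal_gt0].
wlog ij : i j / (j <= i)%N => [H|].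
  by have [/H //|/ltnW/H] := leqP j i; rewrite mulrC.
have -> : P i * P j = (cdw ga al i * cdw ga al j)^-1 *: u i j.
  rewrite /u -scalerAl -scalerAr !scalerA -mulrA mulVf ?scale1r //.
  by rewrite mulf_neq0 // gt_eqF.
by apply: gconeZ; [rewrite invr_ge0 mulr_ge0 // ltW | exact: gcone_u].
Qed.

Lemma gconeM p q : gcone p -> gcone q -> gcone (p * q).
Proof.
move=> cp cq; rewrite (gegenbauer_expansion n_ge2 (leqnn (size p))).
rewrite (gegenbauer_expansion n_ge2 (leqnn (size q))) mulr_suml.
apply: gcone_sum => i; rewrite mulr_sumr; apply: gcone_sum => j.
rewrite -scalerAl -scalerAr scalerA; apply: gconeZ; last exact: gcone_gegenbauerM.
exact: mulr_ge0.
Qed.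

Lemma lead_gegenbauer_gt0 k : 0 < lead_coef (P k).
Proof.
rewrite lead_coefE size_gegenbauer //=; elim: k => [|k IHk].
  by rewrite [P 0]/(1 : {poly R}) coef1.
have := congr1 (fun p : {poly R} => p`_k.+1) (gegenbauerX R n_ge2 k).
rewrite coefXM coefD !coefZ [X in _ + _ * X]nth_default; last first.
  by rewrite size_gegenbauer //; case: (k).
rewrite mulr0 addr0 /= => E.
by rewrite -(pmulr_rgt0 _ (gga_gt0 R n_ge2 k)) -E.
Qed.

Lemma pcoef_lead p k : size p = k.+1 -> pcoef n p k = lead_coef p / lead_coef (P k).
Proof.
move=> sp; have l0 := lead_gegenbauer_gt0 k.
apply/(canRL (mulfK (lt0r_neq0 l0))); rewrite lead_coefE size_gegenbauer //=.
rewrite [in RHS]lead_coefE sp /= {2}(gegenbauer_expansion n_ge2 (eq_leq sp)).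
rewrite coef_sum big_ord_recr /= coefZ big1 ?add0r // => i _.
by rewrite coefZ nth_default ?mulr0 // size_gegenbauer // ltn_ord.
Qed.

Definition gfull (d : nat) p := gcone p /\ forall i, (i <= d)%N -> 0 < pcoef n p i.

Lemma gfullD d p q : gfull d p -> gcone q -> gfull d (p + q).
Proof.
move=> [cp fp] cq; split; first exact: gconeD.
by move=> i id; rewrite pcoefD // ltr_wpDr // fp.
Qed.

Lemma gfullZ c d p : 0 < c -> gfull d p -> gfull d (c *: p).
Proof.
move=> c0 [cp fp]; split; first exact/gconeZ/cp/ltW.
by move=> i id; rewrite pcoefZ // mulr_gt0 // fp.
Qed.

Lemma gfullM d e p q : gfull d p -> gfull e q -> gfull (d + e) (p * q).
Proof.
move=> [cp fp] [cq fq]; split; first exact: gconeM.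
(* With [k = i + j], [i <= d] and [j <= e], the product [P i * P j] has degree exactly [k] and a
   positive coefficient there; all remaining terms stay in the cone. *)
move=> k kde; pose i := minn k d; pose j := (k - i)%N.
have ik : (i <= k)%N by rewrite geq_minl.
have id : (i <= d)%N by rewrite geq_minr.
have je : (j <= e)%N by rewrite /j /i; lia.
pose p' := p - pcoef n p i *: P i; pose q' := q - pcoef n q j *: P j.
have cone_sub r l : gcone r -> gcone (r - pcoef n r l *: P l).
  move=> cr a; rewrite -scaleNr pcoefD // pcoefZ // pcoef_gegenbauer //.
  by case: eqVneq => [->|_]; rewrite ?mulr1 ?subrr // mulr0 addr0.
have -> : p * q = pcoef n p i *: (pcoef n q j *: (P i * P j)) +
    (pcoef n p i *: (P i * q') + p' * q).
  by rewrite /p' /q' -!mul_polyC; ring.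
have cR : gcone (pcoef n p i *: (P i * q') + p' * q).
  apply: gconeD.
    by apply: gconeZ => //; apply: gconeM; [exact: gcone_gegenbauer | exact: cone_sub].
  by apply: gconeM => //; exact: cone_sub.
rewrite pcoefD // ltr_wpDr ?cR // !pcoefZ //.
rewrite (mulr_gt0 (fp _ id)) ?(mulr_gt0 (fq _ je)) //.
have ijk : (i + j = k)%N by rewrite subnKC.
have P0 l : P l != 0 by rewrite -size_poly_eq0 size_gegenbauer.
rewrite pcoef_lead; last by rewrite size_mul // !size_gegenbauer // addnS /= -ijk.
by rewrite lead_coefM divr_gt0 ?mulr_gt0 // lead_gegenbauer_gt0.
Qed.

End Linearization.

(** * Levenshtein polynomials *)

Section AdjacentSystems.
Variables (R : realType) (n : nat) (n_ge2 : (2 <= n)%N).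
Local Notation P := (gegenbauer R n).
Local Notation q := (gegenbauer R n.+2).
Local Notation p10 := (gegenbauer10 R n).

Let n2_ge2 : (2 <= n.+2)%N. Proof. by []. Qed.

(** Nonzero multiples of the Jacobi polynomials defining the nodes, scaled so that the recurrence
    coefficients come from [gal] and [gga]. *)
Definition levQ (e : bool) (k : nat) : {poly R} := if e then q k else p10 k.
Definition levA (e : bool) (k : nat) : R := if e then gga R n.+2 k else gga R n k.+1.
Definition levB (e : bool) (k : nat) : R := if e then 0 else gal R n k - gal R n k.+1.
Definition levC (e : bool) (k : nat) : R := if e then gal R n.+2 k else gal R n k.
Definition levc (e : bool) : R := if e then 1 else n%:R - 1.

Lemma levc_gt0 e : 0 < levc e.
Proof.
case: e; rewrite /levc ?ltr01 //.
have : (2 : R) <= n%:R by rewrite (ler_nat R 2 n).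
by lra.
Qed.

Lemma levQ0 e : levQ e 0 = (levc e)%:P.
Proof.
case: e => //=; rewrite /gegenbauer10 /gegenbauer scale0r addr0 add0r.
by rewrite -mul_polyC mulr1.
Qed.

Lemma levA_gt0 e k : 0 < levA e k.
Proof. by case: e; exact: gga_gt0. Qed.

Lemma levC0 e : levC e 0 = 0.
Proof. by case: e; exact: gal0. Qed.

Lemma levC_gt0 e k : 0 < levC e k.+1.
Proof. by case: e; exact: gal_gt0. Qed.

Lemma levQX e k :
  'X * levQ e k =
  levA e k *: levQ e k.+1 + levB e k *: levQ e k + levC e k *: levQ e k.-1.
Proof.
case: e; rewrite /levQ /levA /levB /levC.
  by rewrite scale0r addr0 gegenbauerX.
exact: gegenbauer10X.
Qed.

Lemma horner_gegenbauer10 k x :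
  (p10 k).[x] = (k%:R + n%:R - 1) * (q k).[x] + k%:R * (q k.-1).[x].
Proof. by rewrite /gegenbauer10 hornerD !hornerZ. Qed.

Lemma levQ_gt0 e k x : 1 <= x -> 0 < (levQ e k).[x].
Proof.
move=> x1; have q0 j : 0 < (q j).[x] by rewrite (lt_le_trans ltr01) // gegenbauer_ge1.
case: e => //=; rewrite horner_gegenbauer10 ltr_wpDr ?mulr_ge0 ?(ltW (q0 _)) //.
rewrite mulr_gt0 //.
have : (2 : R) <= n%:R by rewrite (ler_nat R 2 n).
by have := ler0n R k; lra.
Qed.

Lemma levQ_sign e k x : x <= -1 -> 0 < (-1) ^+ k * (levQ e k).[x].
Proof. by case: e => x1; [exact: gegenbauer_sign | exact: gegenbauer10_sign]. Qed.

Lemma size_levQ e k : size (levQ e k) = k.+1.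
Proof.
exact: (size_recQ (levc_gt0 e) (levQ0 e) (levA_gt0 e) (levQX e)).
Qed.

Lemma ajacobi_levQ e k : exists2 c, c != 0 & ajacobi R n true e k = c *: levQ e k.
Proof.
have n2 : (2 : R) <= n%:R by rewrite (ler_nat R 2 n).
have e0 : (0 : R) <= e%:R by [].
apply: jacobi_unique; rewrite ?size_levQ //=; [lra|lra|].
rewrite /jode; case: e {e0}.
  rewrite /= subrr sub0r (gegenbauer_ode R n2_ge2 k).
  have -> : 1%:R + (n%:R - 3) / 2 + (1%:R + (n%:R - 3) / 2) + 2 = n.+2%:R - 1 :> R.
    by rewrite -[n.+2%:R]natr1 -[n.+1%:R]natr1; field.
  have -> : k%:R + (1%:R + (n%:R - 3) / 2) + (1%:R + (n%:R - 3) / 2) + 1 =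
     k%:R + n.+2%:R - 2 :> R by rewrite -[n.+2%:R]natr1 -[n.+1%:R]natr1; field.
  by rewrite -!mul_polyC; ring.
rewrite /= (gegenbauer10_ode R n k).
have -> : 0 + (n%:R - 3) / 2 - (1%:R + (n%:R - 3) / 2) = - 1 :> R by ring.
have -> : 1%:R + (n%:R - 3) / 2 + (0 + (n%:R - 3) / 2) + 2 = n%:R :> R by field.
have -> : k%:R + (1%:R + (n%:R - 3) / 2) + (0 + (n%:R - 3) / 2) + 1 =
     k%:R + n%:R - 1 :> R by field.
by rewrite -!mul_polyC polyCN polyC1; ring.
Qed.

Lemma levQ_largest_root e k : exists t, [/\ tzero R n true e k.+1 = t,
  root (levQ e k.+1) t, t < 1, forall x, t < x -> 0 < (levQ e k.+1).[x] &
  forall i x, (i <= k)%N -> t <= x -> 0 < (levQ e i).[x]].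
Proof.
have [t [Qt t1 tmax tpos]] := recQ_largest_root (levc_gt0 e) (levQ0 e) (levA_gt0 e)
  (levC0 e) (levC_gt0 e) (levQX e) (@levQ_gt0 e) k.
exists t; split=> //; last first.
  by move=> x tx; apply: (pos_right_of_root tmax tx t1); exact: levQ_gt0.
rewrite /tzero /Defs.maxset; have [c c0 ->] := ajacobi_levQ e k.+1.
have -> : [set x | root (c *: levQ e k.+1) x]%classic = [set x | root (levQ e k.+1) x]%classic.
  by apply/seteqP; split=> x /=; rewrite rootZ.
exact: sup_roots.
Qed.

(** The right end of the interval yields the second sign through [recQ_le0]. The left end is
    governed by the other family and yields the other two: the values at -1 alternate, so the last
    quantity is a positive multiple of [Q_k(s) + Q_(k+1)(s)]. For [e] true this sum is nonnegative
    because [p10 k.+1] is nonnegative and [q k.+1] nonpositive at [s]; for [e] false it is a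
    positive multiple of [(1 + s) q_k(s)]. *)
Lemma levQ_interval e k s : -1 <= s -> lev_interval n k.+1 e s ->
  [/\ forall i, (i <= k)%N -> 0 < (levQ e i).[s], (levQ e k.+1).[s] <= 0 &
     0 <= (-1) ^+ k.+1 * ((levQ e k).[s] * (levQ e k.+1).[-1]
                          - (levQ e k.+1).[s] * (levQ e k).[-1])].
Proof.
have n2 : (2 : R) <= n%:R by rewrite (ler_nat R 2 n).
have le0 x : (forall i, (i <= k)%N -> 0 < (levQ e i).[x]) ->
    x <= tzero R n true e k.+1 -> (levQ e k.+1).[x] <= 0.
  move=> xpos; have [t [-> Qt t1 tmax tpos]] := levQ_largest_root e k => xt.
  apply: (recQ_le0 (levA_gt0 e) (levC0 e) (levC_gt0 e) (levQX e) Qt _ xt).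
    by move=> i ik; apply: tpos.
  by move=> i ik; rewrite ltW ?xpos.
have qN1 j : (q j).[-1] = (-1) ^+ j by rewrite gegenbauerN // gegenbauer_at1 // mulr1.
move=> s1; case: e le0 => le0; rewrite /lev_interval /= in_itv /= ?subn1 => /andP[sl su].
  have [t' [Et' Qt' _ t'max t'pos]] := levQ_largest_root false k; rewrite Et' in sl.
  have pos i : (i <= k)%N -> 0 < (q i).[s].
    case: k {le0 su} Et' Qt' t'max t'pos => [|k] Et' Qt' t'max t'pos.
      by rewrite leqn0 => /eqP ->; rewrite [q 0]/(1 : {poly R}) hornerC.
    have [tau [_ Qtau tau1 taumax taupos]] := levQ_largest_root true k.
    (* At the zero [tau] of [q k.+1], [p10 k.+2] reduces to a positive multiple of [q k.+2], which
       the recurrence makes negative. *)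
    have tt : tau < t'.
      rewrite ltNge; apply/negP => t'tau.
      have p10_ge0 : 0 <= (p10 k.+2).[tau].
        move: t'tau; rewrite le_eqVlt => /predU1P[<-|/t'max /ltW //].
        by rewrite (rootP Qt').
      have := horner_QX (levQX true) k.+1 tau.
      rewrite /= (rootP Qtau) mulr0 mul0r addr0 => E.
      have Q2 : (q k.+2).[tau] < 0.
        rewrite -(pmulr_rlt0 _ (gga_gt0 R n2_ge2 k.+1)).
        have := mulr_gt0 (gal_gt0 R n2_ge2 k) (taupos k tau (leqnn _) (lexx _)).
        by move: E; rewrite /levQ /=; lra.
      move: p10_ge0; rewrite horner_gegenbauer10 (rootP Qtau) mulr0 addr0 leNgt.
      rewrite pmulr_rlt0 ?Q2 //.
    rewrite leq_eqVlt => /predU1P[->|]; first by apply: taumax; rewrite (lt_le_trans tt).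
    by rewrite ltnS => ik; apply: (taupos i s ik); rewrite ltW // (lt_le_trans tt).
  split=> //; first exact: le0.
  have Qk : (q k.+1).[s] <= 0 by exact: le0.
  rewrite /levQ !qN1 [in X in X - _]exprS.
  have -> : (-1) ^+ k.+1 * ((q k).[s] * (-1 * (-1) ^+ k) - (q k.+1).[s] * (-1) ^+ k) =
     ((-1) ^+ k) ^+ 2 * ((q k).[s] + (q k.+1).[s]) :> R by rewrite exprS; ring.
  rewrite sqrr_sign mul1r.
  have : 0 <= (p10 k.+1).[s].
    move: sl; rewrite le_eqVlt => /predU1P[<-|/t'max /ltW //].
    by rewrite (rootP Qt').
  rewrite horner_gegenbauer10 [k.+1.-1]/= => H.
  have k1 : (0 : R) < k.+1%:R by rewrite ltr0n.
  rewrite -(pmulr_rge0 _ k1); move: H Qk k1.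
  by move: (k.+1%:R) (n%:R) ((q k.+1).[s]) ((q k).[s]) n2 => a b u v ? ? ? ?; nra.
have qpos : 0 <= (q k).[s] /\ forall i, (i < k)%N -> 0 < (q i).[s].
  case: k {le0 su} sl => [_|k sl].
    by split=> //; rewrite [q 0]/(1 : {poly R}) hornerC.
  have [tau [Etau Qtau tau1 taumax taupos]] := levQ_largest_root true k.
  rewrite Etau in sl; split; last by move=> i ik; apply: (taupos i s).
  move: sl; rewrite le_eqVlt => /predU1P[<-|/taumax /ltW //].
  by rewrite (rootP Qtau).
have pos i : (i <= k)%N -> 0 < (p10 i).[s].
  move=> ik; have [qk qi] := qpos.
  have q_ge0 j : (j <= k)%N -> 0 <= (q j).[s].
    by rewrite leq_eqVlt => /predU1P[->//|/qi/ltW].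
  have i0 : 0 < i%:R + n%:R - 1 :> R by have := ler0n R i; lra.
  rewrite horner_gegenbauer10; case: i ik i0 => [|i] ik i0.
    rewrite mul0r addr0 mulr_gt0 //.
    by rewrite [q 0]/(1 : {poly R}) hornerC.
  rewrite ltr_wpDl ?mulr_ge0 ?(ltW i0) ?q_ge0 //.
  by rewrite mulr_gt0 ?ltr0n // qi.
split=> //; first exact: le0.
rewrite /levQ !horner_gegenbauer10 -!horner_gegenbauer10.
have pN1 j : (p10 j).[-1] = (-1) ^+ j * (n%:R - 1).
  rewrite horner_gegenbauer10 !qN1; case: j => [|j]; first by ring.
  by rewrite /= exprS; ring.
rewrite !pN1.
have -> : (-1) ^+ k.+1 * ((p10 k).[s] * ((-1) ^+ k.+1 * (n%:R - 1)) -
   (p10 k.+1).[s] * ((-1) ^+ k * (n%:R - 1))) =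
   ((-1) ^+ k) ^+ 2 * (n%:R - 1) * ((p10 k).[s] + (p10 k.+1).[s]).
  by rewrite exprS; ring.
rewrite sqrr_sign mul1r mulr_ge0 //; first by lra.
have := congr1 (horner^~ s) (onepX_gegenbauer R n_ge2 k).
rewrite /= hornerM hornerM !hornerD hornerX !hornerC => <-.
have [qk _] := qpos.
rewrite mulr_ge0 ?(ltW (gegenbauer_den_gt0 R n_ge2 k)) // mulr_ge0 //.
by lra.
Qed.

End AdjacentSystems.

(** * Positivity and sign of the Levenshtein polynomial *)

Section LevenshteinPolynomial.
Variables (R : realType) (n : nat) (n_ge2 : (2 <= n)%N).
Local Notation P := (gegenbauer R n).
Local Notation q := (gegenbauer R n.+2).
Local Notation p10 := (gegenbauer10 R n).
Local Notation levQ := (@levQ R n).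

Lemma gfull_gegenbauer10 k : gfull n k (p10 k).
Proof.
have n2 : (2 : R) <= n%:R by rewrite (ler_nat R 2 n).
elim: k => [|k [ck fk]].
  rewrite -[p10 0]/(levQ false 0) levQ0 /levc -[_%:P]mulr1 mul_polyC.
  apply: gfullZ; [by []|by lra|split; first exact: gcone_gegenbauer n_ge2 0].
  by move=> i; rewrite leqn0 => /eqP ->; rewrite -[1]/(P 0) pcoef_gegenbauer.
have g0 := gga_gt0 R n_ge2 k.+1.
have -> : p10 k.+1 = (gga R n k.+1)^-1 *: (gga R n k.+1 *: p10 k.+1).
  by rewrite scalerA mulVf ?gt_eqF // scale1r.
rewrite gegenbauer10_pred //; apply: gfullZ => //; first by rewrite invr_gt0.
have c1 : gcone n ((n%:R - 1) *: P k.+1).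
  by apply: gconeZ => //; [lra | exact: gcone_gegenbauer].
have c2 : gcone n (gal R n k.+1 *: p10 k).
  by apply: gconeZ => //; rewrite ltW // gal_gt0.
split; first exact: gconeD.
move=> i; rewrite leq_eqVlt => /predU1P[->|]; rewrite pcoefD //.
  by rewrite ltr_wpDr // pcoefZ // pcoef_gegenbauer // eqxx mulr1; lra.
by rewrite ltnS => ik; rewrite ltr_wpDl // pcoefZ // mulr_gt0 ?gal_gt0 ?fk.
Qed.

Lemma gcone_gegenbauer_dim k : gcone n (q k) /\ 0 < pcoef n (q k) k.
Proof.
have n2 : (2 : R) <= n%:R by rewrite (ler_nat R 2 n).
elim/ltn_ind: k => -[|[|k]] IHk.
- rewrite -[q 0]/(P 0); split; first exact: gcone_gegenbauer.
  by rewrite pcoef_gegenbauer.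
- rewrite -[q 1]/(P 1); split; first exact: gcone_gegenbauer.
  by rewrite pcoef_gegenbauer.
have [ck fk] := IHk k (ltnW (ltnSn _)).
set c := gga R n k.+2 * gga R n k.+3 * (2 * k.+2%:R + n%:R).
have c0 : 0 < c by rewrite !mulr_gt0 ?gga_gt0 // gegenbauer_den_gt0.
have -> : q k.+2 = c^-1 *: (c *: q k.+2) by rewrite scalerA mulVf ?gt_eqF // scale1r.
rewrite gegenbauer_dim_pred //.
have c1 : gcone n ((n%:R - 1) *: P k.+2).
  by apply: gconeZ => //; [lra | exact: gcone_gegenbauer].
have c2 : gcone n ((gal R n k.+2 * gal R n k.+1 * (2 * k%:R + n%:R)) *: q k).
  apply: gconeZ => //; apply: mulr_ge0; last exact: ltW (gegenbauer_den_gt0 R n_ge2 k).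
  by apply: mulr_ge0; apply: ltW; exact: gal_gt0.
split; first by apply: gconeZ => //; [rewrite invr_ge0 ltW | exact: gconeD].
rewrite pcoefZ // mulr_gt0 ?invr_gt0 // pcoefD // ltr_wpDr //.
by rewrite pcoefZ // pcoef_gegenbauer // eqxx mulr1; lra.
Qed.

Lemma gcone_levQ e k : gcone n (levQ e k) /\ 0 < pcoef n (levQ e k) k.
Proof.
case: e; first exact: gcone_gegenbauer_dim.
by have [c f] := gfull_gegenbauer10 k; split=> //; exact: f.
Qed.

(** By parity, half of the coefficients of [q k] vanish; the factor ['X + 1] fills the gaps, as it
    turns [q k] into a multiple of [p10 k + p10 k.+1]. *)
Lemma gfull_onepX_levQ (e : bool) k : gfull n (k + e) (('X + 1) ^+ e * levQ e k).
Proof.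
case: e => /=; last by rewrite expr0 mul1r addn0; exact: gfull_gegenbauer10.
rewrite expr1 addn1; have d0 := gegenbauer_den_gt0 R n_ge2 k.
have -> : ('X + 1) * q k = (2 * k%:R + n%:R)^-1 *: (p10 k.+1 + p10 k).
  rewrite [p10 k.+1 + _]addrC -onepX_gegenbauer // mul_polyC scalerA mulVf ?gt_eqF // scale1r.
  by [].
apply: gfullZ; [by []|by rewrite invr_gt0|].
by apply: gfullD => //; [exact: gfull_gegenbauer10 | have [] := gfull_gegenbauer10 k].
Qed.

Section Nodes.
Variables (k : nat) (e : bool) (s : R) (alpha : nat -> R).
Hypotheses (s_itv : -1 <= s < 1) (s_lev : lev_interval n k.+1 e s)
  (alphaP : lev_nodes n k.+1 e s alpha).

Let s_geN1 : -1 <= s. Proof. by have /andP[] := s_itv. Qed.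

Let N : {poly R} := (levQ e k).[s] *: levQ e k.+1 - (levQ e k.+1).[s] *: levQ e k.

Let Qpos := levQ_interval n_ge2 s_geN1 s_lev.

Let size_N : size N = k.+2.
Proof.
have [Q0 _ _] := Qpos.
rewrite /N size_polyDl size_scale ?size_levQ // ?gt_eqF ?Q0 //.
by rewrite size_polyN (leq_ltn_trans (size_scale_leq _ _)) // size_levQ.
Qed.

Let D : {poly R} := ('X + 1) ^+ e * N.

Let root_D t : root D t <-> exists2 i, (i < k.+1 + e)%N & t = alpha i.
Proof.
have [_ _ <-] := alphaP.
rewrite /lev_node_poly subn1 /=.
have [c c0 ->] := ajacobi_levQ R n_ge2 e k.
have [d d0 ->] := ajacobi_levQ R n_ge2 e k.+1.
rewrite !hornerZ !scalerA.
have -> : (c * (levQ e k).[s] * d) *: levQ e k.+1 - (d * (levQ e k.+1).[s] * c) *: levQ e k =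
    (c * d) *: N.
  by rewrite /N scalerBr !scalerA; congr (_ *: _ - _ *: _); ring.
by rewrite -scalerAr rootZ ?mulf_neq0.
Qed.

Let root_D_ge t : root D t -> -1 <= t.
Proof.
have [Q0 _ Q2] := Qpos.
rewrite rootM => /orP[|].
  case: (e) => /=; last by rewrite expr0 /root hornerC oner_eq0.
  by rewrite expr1 /root hornerD hornerX hornerC addr_eq0 => /eqP ->.
rewrite leNgt => Nt; apply/negP => t1; move: Nt; apply/negP.
have := @recQ_comb_neq0 R (levQ e) (levA R n e) (levB R n e) (levC R n e)
  (levA_gt0 R n_ge2 e) (levC0 R n e) (levC_gt0 R n_ge2 e) (levQX R n_ge2 e)
  (@levQ_sign R n n_ge2 e) k s t (Q0 k (leqnn _)) Q2 t1.
by rewrite /root /N hornerD hornerN !hornerZ.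
Qed.

Lemma lev_nodes_ge i : (i < k.+1 + e)%N -> -1 <= alpha i.
Proof. by move=> ik; apply/root_D_ge/root_D; exists i. Qed.

Lemma lev_nodes_le i : (i < k.+1 + e)%N -> alpha i <= s.
Proof.
have [amono <- _] := alphaP; rewrite subn1 /= => ik.
have : (i <= k + e)%N by move: ik; rewrite addSn ltnS.
by rewrite leq_eqVlt => /predU1P[->//|ike]; rewrite ltW // amono // ike addSn ltnS leqnn.
Qed.

Lemma lev_nodes0 : e -> alpha 0 = -1.
Proof.
move=> he; apply/eqP; rewrite eq_le lev_nodes_ge ?addSn // andbT.
have /root_D[i ik ->] : root D (-1).
  by rewrite /D he rootM expr1 /root hornerD hornerX hornerC addNr eqxx.
case: i ik => // i ik; have [amono _ _] := alphaP.
by rewrite ltW // amono // ltnS.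
Qed.

Let alphas := [seq alpha i | i <- iota 0 (k.+1 + e)].

Let uniq_alphas : uniq alphas.
Proof.
have [amono _ _] := alphaP.
rewrite map_inj_in_uniq ?iota_uniq // => i j; rewrite !mem_iota !add0n /= => ik jk E.
case: (ltngtP i j) => // l; [have := amono i j | have := amono j i].
  by rewrite l jk E ltxx => /(_ isT).
by rewrite l ik E ltxx => /(_ isT).
Qed.

Let size_D : size D = (k.+1 + e).+1.
Proof.
have s1 : size ('X + 1 : {poly R})%R = 2 by rewrite -polyC1 size_XaddC.
have Xn0 : ('X + 1 : {poly R})%R != 0 by rewrite -size_poly_eq0 s1.
rewrite /D size_mul ?expf_neq0 // -?size_poly_eq0 size_N //.
by case: (e); rewrite ?expr0 ?expr1 ?s1 ?size_poly1 ?addn0 ?addn1.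
Qed.

Let D_factor : D = lead_coef D *: \prod_(a <- alphas) ('X - a%:P).
Proof.
apply: all_roots_prod_XsubC.
- by rewrite size_map size_iota size_D.
- apply/allP => a /mapP[i]; rewrite mem_iota add0n => /andP[_ ik] ->.
  by apply/root_D; exists i.
- by rewrite uniq_rootsE.
Qed.

Let lD0 : lead_coef D != 0.
Proof. by rewrite lead_coef_eq0 -size_poly_eq0 size_D. Qed.

Let doubled : {poly R} := \prod_(i <- iota e k) ('X - (alpha i)%:P).

Let alpha_last : alpha (k + e)%N = s.
Proof. by have [_ + _] := alphaP; rewrite subn1. Qed.

Lemma lev_poly_doubled :
  lev_poly (lev_T k.+1 e alpha) = ('X + 1) ^+ e * doubled ^+ 2 * ('X - s%:P).
Proof.
rewrite /lev_poly /lev_T subn1 /= !big_cat /= big_seq1 alpha_last big_map.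
have -> : \prod_(a <- if e then [:: alpha 0] else [::]) ('X - a%:P) = ('X + 1 : {poly R}) ^+ e.
  have := lev_nodes0; case: (e) => /= [->//|_]; last by rewrite big_nil.
  by rewrite big_seq1 expr1 polyCN opprK.
by rewrite expr2 -!mulrA.
Qed.

Let N_factor : N = lead_coef D *: (doubled * ('X - s%:P)).
Proof.
have Xn0 : ('X + 1 : {poly R})%R != 0 by rewrite -size_poly_eq0 -polyC1 size_XaddC.
apply: (mulfI (expf_neq0 e Xn0)); rewrite -/D {1}D_factor -scalerAr; congr (_ *: _).
rewrite /alphas big_map.
have -> : iota 0 (k.+1 + e) = iota 0 e ++ iota e k ++ [:: (k + e)%N].
  have -> : (k.+1 + e = e + (k + 1))%N by lia.
  by rewrite !iotaD add0n [(k + e)%N]addnC.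
rewrite !big_cat big_seq1 alpha_last /=; congr (_ * _).
have := lev_nodes0; case: (e) => /= [a0|_]; last by rewrite big_nil.
by rewrite big_seq1 a0 // expr1 polyCN opprK.
Qed.

(* By Christoffel-Darboux, the product of the doubled factors is a positive
   combination of the [levQ e i], [i <= k]: it remains to linearize its product
   with [D]. *)
Lemma lev_poly_full : gfull n (lev_m k.+1 e) (lev_poly (lev_T k.+1 e alpha)).
Proof.
have [Q0 Q1 _] := Qpos.
pose K := cdker (levQ e) (levA R n e) (levC R n e) s k.+1.
pose w : R := cdw (levA R n e) (levC R n e) k * levA R n e k.
have cdw0 i : 0 < cdw (levA R n e) (levC R n e) i.
  by apply: cdw_gt0; [exact: levA_gt0 | exact: levC_gt0].
have w0 : 0 < w by rewrite mulr_gt0 // levA_gt0.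
have CD : ('X - s%:P) * K = w *: N.
  exact: (christoffel_darboux (levC0 R n e) (levC_gt0 R n_ge2 e) (levQX R n_ge2 e)).
have KE : K = (w * lead_coef D) *: doubled.
  have Xs : 'X - s%:P != 0 :> {poly R} by rewrite polyXsubC_eq0.
  by apply: (mulfI Xs); rewrite CD {1}N_factor scalerA -scalerAr [doubled * _]mulrC.
have -> : lev_poly (lev_T k.+1 e alpha) = (w * lead_coef D ^+ 2)^-1 *: (D * K).
  have NE := N_factor; have L0 := lD0; move: (lead_coef D) KE NE L0 => L KE NE L0.
  have DE : D = ('X + 1) ^+ e * N by [].
  rewrite lev_poly_doubled KE DE NE.
  have cE : (w * L ^+ 2)^-1%:P * (w%:P * L%:P) * L%:P = 1 :> {poly R}.
    by rewrite -!polyCM -polyC1; congr (_%:P); field; rewrite L0 gt_eqF.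
  rewrite -!mul_polyC [(w * L)%:P]polyCM.
  move: cE; move: ((w * L ^+ 2)^-1%:P) (w%:P) (L%:P) (('X + 1) ^+ e) => c1 c2 c3 Y cE.
  by apply: (sub_lincomb (- (Y * doubled ^+ 2 * ('X - s%:P))) cE); ring.
apply: gfullZ => //; first by rewrite invr_gt0 mulr_gt0 // exprn_even_gt0.
have -> : lev_m k.+1 e = (k.+1 + e + k)%N by rewrite /lev_m; lia.
apply: gfullM => //.
  rewrite /D /N mulrBr -!scalerAr -scaleNr; apply: gfullD => //.
    by apply: gfullZ => //; [exact: Q0 | exact: gfull_onepX_levQ].
  apply: gconeZ => //; first by rewrite oppr_ge0.
  by have [] := gfull_onepX_levQ e k.
have cone_term i : (i <= k)%N ->
    gcone n ((cdw (levA R n e) (levC R n e) i * (levQ e i).[s]) *: levQ e i).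
  move=> ik; apply: gconeZ => //; first by rewrite mulr_ge0 ?ltW ?Q0.
  by have [] := gcone_levQ e i.
split.
  move=> j; rewrite /K /cdker pcoef_sum // sumr_ge0 // => i _.
  by apply: cone_term; rewrite -ltnS.
move=> j jk; rewrite /K /cdker pcoef_sum // (bigD1 (inord j)) //= inordK ?ltnS //.
rewrite ltr_wpDr //; first by apply: sumr_ge0 => i _; apply: cone_term; rewrite -ltnS.
rewrite pcoefZ //; apply: mulr_gt0; last by have [] := gcone_levQ e j.
by apply: mulr_gt0; [exact: cdw0 | exact: Q0].
Qed.

Lemma lev_poly_horner t :
  (lev_poly (lev_T k.+1 e alpha)).[t] = (t + 1) ^+ e * doubled.[t] ^+ 2 * (t - s).
Proof.
rewrite lev_poly_doubled !hornerM !horner_exp.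
by rewrite !(hornerD, hornerN, hornerX, hornerC).
Qed.

Lemma lev_poly_le0 t : -1 <= t <= s -> (lev_poly (lev_T k.+1 e alpha)).[t] <= 0.
Proof.
move=> /andP[t1 ts]; rewrite lev_poly_horner mulr_ge0_le0 ?subr_le0 //.
by rewrite mulr_ge0 ?sqr_ge0 // exprn_ge0 //; lra.
Qed.

End Nodes.

End LevenshteinPolynomial.

(** * Hermite interpolation of absolutely monotone functions *)

Section DerivIn.
Variable R : realType.
Local Open Scope classical_set_scope.
Implicit Types (f g : R -> R).

(** The derivative is an explicit function, so that the successive [hderiv h j] form a chain,
    one-sided at -1. *)
Definition din f f' := forall t, -1 <= t < 1 ->
  dquot f t u @[u --> deriv_filter t] --> f' t.

Lemma din_eps f f' (t e : R) : din f f' -> -1 <= t < 1 -> 0 < e ->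
  exists2 d, 0 < d & forall u, -1 <= u < 1 -> u != t -> `|t - u| < d ->
    `|f' t - dquot f t u| < e.
Proof.
move=> ff' t1 e0; have /cvgrPdist_lt /(_ e e0) := ff' t t1.
rewrite /deriv_filter near_withinE /dnbhs near_withinE => /nbhs_ballP[d /= d0 H].
exists d => // u u1 ut td; by apply: H => //=.
Qed.

Lemma din_is_derive f f' (t : R) : din f f' -> -1 < t < 1 -> is_derive t 1 f (f' t).
Proof.
move=> ff' /andP[t1 t2].
suff H : h^-1 *: ((f \o shift t) (h *: 1) - f t) @[h --> 0^'] --> f' t.
  by apply: DeriveDef; [apply/cvg_ex; exists (f' t) | apply: cvg_lim].
apply/cvgrPdist_lt => e e0.
have [d d0 H] := din_eps ff' (introT andP (conj (ltW t1) t2)) e0.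
near=> h; have h0 : h != 0 by near: h; exact: nbhs_dnbhs_neq.
have E : h^-1 *: ((f \o shift t) (h *: 1) - f t) = dquot f t (h + t).
  by rewrite /dquot /= addrK /GRing.scale /= mulr1 mulrC.
have hh : `|h| < Num.min d (Num.min (t + 1) (1 - t)).
  near: h; apply: dnbhs0_lt; rewrite !lt_min d0 /=; lra.
have [hd h1 h2] : [/\ `|h| < d, - (t + 1) < h & h < 1 - t].
  move: hh; rewrite !lt_min => /and3P[c0 c1 c2]; split; first exact: c0.
    by move: c1; rewrite ltr_norml => /andP[].
  by move: c2; rewrite ltr_norml => /andP[].
rewrite E; apply: H; first by apply/andP; split; lra.
  by rewrite -subr_eq0 addrK.
by rewrite opprD addrCA subrr addr0 normrN.
Unshelve. all: end_near. Qed.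

Lemma din_right_continuous f f' (t : R) : din f f' -> -1 <= t < 1 -> f x @[x --> t^'+] --> f t.
Proof.
move=> ff' t1.
have dq : dquot f t u @[u --> t^'+] --> f' t.
  apply/cvgrPdist_lt => e e0; have [d d0 H] := din_eps ff' t1 e0.
  have /andP[tN1 tlt1] := t1.
  near=> u; have tu : t < u by near: u; exact: nbhs_right_gt.
  have u1 : u < 1 by near: u; exact: nbhs_right_lt.
  have ud : u < t + d by near: u; apply: nbhs_right_lt; rewrite ltrDl.
  apply: H; [by rewrite (le_trans tN1) ?ltW | by rewrite gt_eqF |].
  by rewrite distrC ltr_norml; apply/andP; split; lra.
have E : f = (fun u => f t + dquot f t u * (u - t)).
  apply/funext => u; rewrite /dquot; have [->|ut] := eqVneq u t; first by rewrite !subrr mulr0 addr0.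
  by rewrite divfK ?subr_eq0 // addrC subrK.
rewrite [X in X x @[x --> _]]E -[X in _ --> X]addr0; apply: cvgD; first exact: cvg_cst.
rewrite -(mulr0 (f' t)); apply: cvgM => //.
rewrite -(subrr t); apply: cvgB; last exact: cvg_cst.
exact: cvg_within.
Unshelve. all: end_near. Qed.

Lemma din_within_continuous f f' (a b : R) : din f f' -> -1 <= a -> a < b -> b < 1 ->
  {within `[a, b], continuous f}.
Proof.
move=> ff' a1 ab b1; apply/(continuous_within_itvP _ ab).
have cc x : -1 < x < 1 -> {for x, continuous f}.
  move=> x1; apply: differentiable_continuous; apply/derivable1_diffP.
  by have [] := din_is_derive ff' x1.
split.
- move=> x; rewrite in_itv /= => /andP[ax xb]; apply: cc.
  by rewrite (le_lt_trans a1) // (lt_trans xb).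
- by apply: din_right_continuous ff' _; rewrite a1 (lt_trans ab).
- by apply: cvg_at_left_filter; apply: cc; rewrite (le_lt_trans a1).
Qed.

Lemma din_MVT f f' (a b : R) : din f f' -> -1 <= a -> a < b -> b < 1 ->
  exists2 c, a < c < b & f b - f a = f' c * (b - a).
Proof.
move=> ff' a1 ab b1.
have dF x : x \in `]a, b[%R -> is_derive x 1 f (f' x).
  rewrite in_itv /= => /andP[ax xb]; apply: (din_is_derive ff').
  by rewrite (le_lt_trans a1) // (lt_trans xb).
have [c cab E] := MVT ab dF (din_within_continuous ff' a1 ab b1).
by exists c => //; move: cab; rewrite in_itv.
Qed.

Lemma din_ndecr f f' (a b : R) : din f f' -> -1 <= a -> a <= b -> b < 1 ->
  (forall x, a < x < b -> 0 <= f' x) -> f a <= f b.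
Proof.
move=> ff' a1; rewrite le_eqVlt => /predU1P[->//|ab] b1 H.
have [c cab E] := din_MVT ff' a1 ab b1.
by rewrite -subr_ge0 E mulr_ge0 ?H // subr_ge0 ltW.
Qed.

Lemma din_horner (p : {poly R}) : din (horner p) (horner p^`()).
Proof.
move=> t t1.
have /factor_theorem[r Er] : root (p - p.[t]%:P) t.
  by rewrite /root hornerD hornerN hornerC subrr.
have rt : r.[t] = p^`().[t].
  have := congr1 (fun p : {poly R} => p^`().[t]) Er.
  rewrite derivB derivC subr0 derivM derivXsubC mulr1 hornerD hornerM hornerXsubC.
  by rewrite subrr mulr0 add0r.
rewrite -rt; apply/cvgrPdist_lt => e e0.
have /cvgrPdist_lt/(_ e e0) := @continuous_horner R r t.
rewrite /deriv_filter near_withinE /dnbhs near_withinE; apply: filterS => u H ut _.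
suff -> : dquot (horner p) t u = r.[u] by [].
have := congr1 (horner^~ u) Er; rewrite /= hornerD hornerN hornerC hornerM hornerXsubC => E.
by rewrite /dquot E mulfK // subr_eq0.
Qed.

Lemma dinB f f' g g' : din f f' -> din g g' ->
  din (fun t => f t - g t) (fun t => f' t - g' t).
Proof.
move=> df dg t t1.
have -> : dquot (fun t => f t - g t) t = (fun u => dquot f t u - dquot g t u).
  by apply/funext => u; rewrite /dquot -mulrBl; congr (_ / _); ring.
by apply: cvgB; [exact: df | exact: dg].
Qed.

Lemma din_linM g g' (a : R) : din g g' ->
  din (fun t => (t - a) * g t) (fun t => g t + (t - a) * g' t).
Proof.
move=> dg t t1.
have H : g t + (u - a) * dquot g t u @[u --> deriv_filter t] --> g t + (t - a) * g' t.
  apply: cvgD; first exact: cvg_cst.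
  apply: cvgM; last exact: dg.
  apply: cvgB; last exact: cvg_cst.
  apply: cvg_trans (cvg_within _) _; exact: cvg_within.
apply: cvg_trans H; apply: near_eq_cvg.
rewrite /deriv_filter near_withinE /dnbhs near_withinE; apply: nearW => u ut _.
by rewrite /dquot; field; rewrite subr_eq0.
Qed.

Lemma dinZ g g' (c : R) : din g g' -> din (fun t => c * g t) (fun t => c * g' t).
Proof.
move=> dg t t1.
have -> : dquot (fun t => c * g t) t = (fun u => c * dquot g t u).
  by apply/funext => u; rewrite /dquot -mulrBr mulrA.
by apply: cvgM; [exact: cvg_cst | exact: dg].
Qed.

End DerivIn.

(** * Counting zeros of derivatives *)

Section Zeros.
Variable R : realType.
Implicit Types (f : R -> R) (F : nat -> R -> R).

(* The boolean attached to a point tells whether it is a double zero. *)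
Lemma rolle_zeros f f' (x : R) (b : bool) (zs : seq (R * bool)) : din f f' ->
  path <%R x (unzip1 zs) -> -1 <= x -> last x (unzip1 zs) < 1 ->
  f x = 0 -> {in zs, forall z : R * bool, f z.1 = 0} ->
  (b -> f' x = 0) -> {in zs, forall z : R * bool, (z.2 : bool) -> f' z.1 = 0} ->
  exists ws, [/\ sorted <%R ws, size ws = (size zs + b + count snd zs)%N &
    forall w, w \in ws -> [/\ x <= w, w <= last x (unzip1 zs) & f' w = 0]].
Proof.
move=> ff'; elim: zs x b => [|[z c] zs IHzs] x b /=.
  move=> _ x1 _ fx _ bx _; exists (if b then [:: x] else [::]).
  by case: b bx => bx; split=> // w; rewrite ?inE // => /eqP ->; rewrite bx.
move=> /andP[xz zp] x1 z1 fx fz bx fz'.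
have lez : z <= last z (unzip1 zs).
  have := order_path_min lt_trans zp => /allP H.
  have := mem_last z (unzip1 zs); rewrite inE => /predU1P[->//|/H/ltW//].
have [|||||||ws [sw szw Hw]] := IHzs z c => //.
- by rewrite (le_trans x1) // ltW.
- by apply: (fz (z, c)); rewrite inE eqxx.
- by move=> w wz; apply: fz; rewrite inE wz orbT.
- by move=> hc; apply: (fz' (z, c)) hc; rewrite inE eqxx.
- by move=> w wz; apply: fz'; rewrite inE wz orbT.
have [xi /andP[xxi xiz] E] := din_MVT ff' x1 xz (le_lt_trans lez z1).
have f'xi : f' xi = 0.
  apply/eqP; move: E; rewrite fx (fz (z, c)) ?inE ?eqxx // subrr => /esym/eqP.
  by rewrite mulf_eq0 subr_eq0 (gt_eqF xz) orbF.
have pw : path <%R xi ws.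
  rewrite path_min_sorted //; apply/allP => w /Hw[zw _ _].
  exact: lt_le_trans zw.
exists (if b then [:: x, xi & ws] else xi :: ws); split.
- by case: (b); rewrite /= ?xxi pw.
- by case: (b); rewrite /= szw ?addn0 ?addn1 ?addSn ?addnS addnA.
move=> w; have Hw' : w \in xi :: ws -> [/\ x <= w, w <= last z (unzip1 zs) & f' w = 0].
  rewrite inE => /predU1P[->|/Hw[zw wl ->]]; split=> //; first exact: ltW.
    by rewrite (le_trans (ltW xiz)).
  by rewrite (le_trans _ zw) // ltW.
case: b bx => [/(_ isT) bx|_] //; rewrite inE => /predU1P[->|//]; split=> //.
by rewrite (le_trans (ltW xz)).
Qed.

Lemma rolle_iter F N j (ws : seq R) : (forall j, din (F j) (F j.+1)) ->
  sorted <%R ws -> (N < size ws)%N ->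
  (forall w, w \in ws -> -1 <= w < 1 /\ F j w = 0) ->
  exists2 xi, -1 <= xi < 1 & F (j + N)%N xi = 0.
Proof.
move=> dF; elim: N j ws => [|N IHN] j [|x ws] //= sw sz Hw.
  by have [? ?] := Hw x (mem_head _ _); exists x; rewrite // addn0.
have [|||||||ws' [sw' sz' Hw']] :=
    @rolle_zeros (F j) (F j.+1) x false [seq (w, false) | w <- ws] (dF j).
- by rewrite /unzip1 -map_comp map_id_in.
- by have [/andP[]] := Hw x (mem_head _ _).
- rewrite /unzip1 -map_comp map_id_in //.
  by have [/andP[]] := Hw _ (mem_last _ _).
- by have [] := Hw x (mem_head _ _).
- by move=> z /mapP[w wz ->] /=; have [] // := Hw w _; rewrite inE wz orbT.
- by [].
- by move=> z /mapP[w wz ->].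
rewrite -addSnnS; apply: (IHN _ ws') => //; first by rewrite sz' size_map; lia.
move=> w /Hw'[xw wl ->]; split=> //; apply/andP; split.
  by rewrite (le_trans _ xw) //; have [/andP[]] := Hw x (mem_head _ _).
rewrite (le_lt_trans wl) // /unzip1 -map_comp map_id_in //.
by have [/andP[]] := Hw _ (mem_last _ _).
Qed.

(** Multiplicities intervene only in the first derivative, where [rolle_zeros] adds the double
    points to the intermediate zeros; afterwards [rolle_iter] counts all zeros as simple. *)
Lemma derivative_zero F N (L : seq (R * bool)) : (forall j, din (F j) (F j.+1)) ->
  uniq (unzip1 L) -> (N < size L + count snd L)%N ->
  {in L, forall z : R * bool, [/\ -1 <= z.1 < 1, F 0%N z.1 = 0 &
    (z.2 : bool) -> F 1%N z.1 = 0]} ->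
  exists2 xi, -1 <= xi < 1 & F N xi = 0.
Proof.
move=> dF; pose le1 := fun z w : R * bool => z.1 <= w.1.
have pL : perm_eq (sort le1 L) L by rewrite perm_sort.
have sL : sorted <=%R (unzip1 (sort le1 L)).
  rewrite /unzip1 sorted_map; apply: sort_sorted => z w; exact: le_total.
have := pL; move: (sort le1 L) sL pL => L' sL' pL' _.
rewrite -(perm_uniq (perm_map fst pL')) -(perm_size pL') -(permP pL') => uL NL HL.
have {HL} HL : {in L', forall z : R * bool, [/\ -1 <= z.1 < 1, F 0%N z.1 = 0 &
    (z.2 : bool) -> F 1%N z.1 = 0]}.
  by move=> z zL; apply: HL; rewrite -(perm_mem pL').
have {uL sL'} sL : sorted <%R (unzip1 L') by rewrite lt_sorted_uniq_le uL.
case: L' sL NL HL {pL'} => [|[x b] zs] //= sL NL HL.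
have [/= x1 Fx bx] := HL (x, b) (mem_head _ _).
case: N NL => [|N] NL; first by exists x.
have lastP : -1 <= last x (unzip1 zs) < 1.
  have := mem_last x (unzip1 zs); rewrite inE => /predU1P[->//|/mapP[z zz ->]].
  by have [] // := HL z _; rewrite inE zz orbT.
have /andP[xN1 _] := x1; have /andP[_ l1] := lastP.
have [|||ws [sw sz Hw]] := @rolle_zeros _ _ x b zs (dF 0%N) sL xN1 l1 Fx.
- by move=> z zz; have [] // := HL z _; rewrite inE zz orbT.
- exact: bx.
- by move=> z zz; have [] // := HL z _; rewrite inE zz orbT.
have [||xi xi1 E] := @rolle_iter F N 1%N ws dF sw.
- by rewrite sz; move: NL; case: (b); lia.
- by move=> w /Hw[xw wl ->]; split=> //; rewrite (le_trans xN1) // (le_lt_trans wl).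
by exists xi.
Qed.

Lemma horner_derivn_size (p : {poly R}) d x : (size p <= d.+1)%N ->
  p^`(d).[x] = p`_d *+ d`!.
Proof.
move=> sp; have -> : p^`(d) = (p`_d *+ d`!)%:P.
  apply/polyP => i; rewrite coef_derivn coefC; case: i => [|i] /=.
    by rewrite addn0 ffactnn.
  by rewrite nth_default ?mul0rn // (leq_trans sp) // -addSnnS leq_addr.
by rewrite hornerC.
Qed.

End Zeros.

(** * Rigidity of absolutely monotone functions *)

Section AbsolutelyMonotone.
Variables (R : realType) (h : R -> \bar R).
Hypothesis hh : abs_monotone h.

Lemma hderiv_din j : din (hderiv h j) (hderiv h j.+1).
Proof.
by move=> t t1; have [_ _ H _ _] := hh; exact: H.
Qed.

Lemma hderiv_ge0 j t : -1 <= t < 1 -> 0 <= hderiv h j t.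
Proof. by have [_ _ _ H _] := hh; exact: H. Qed.

Lemma hderiv_ndecr j (a b : R) : -1 <= a -> a <= b -> b < 1 -> hderiv h j a <= hderiv h j b.
Proof.
move=> a1 ab b1; apply: (din_ndecr (@hderiv_din j) a1 ab b1) => x /andP[ax xb].
by apply: hderiv_ge0; rewrite (le_trans a1) ?(ltW ax) // (lt_trans xb).
Qed.

(* With all derivatives of order at least [1] vanishing at [a], induction on
   [N] gives [N h^(j+1) (y) <= (y - a) h^(j+2) (y)] for every [N]. *)
Lemma hderiv1_eq0 (a x : R) : -1 <= a -> a <= x -> x < 1 ->
  (forall j, hderiv h j.+1 a = 0) -> hderiv h 1 x = 0.
Proof.
move=> a1 ax x1 h0.
have key N j y : a <= y -> y < 1 ->
    N%:R * hderiv h j.+1 y <= (y - a) * hderiv h j.+2 y.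
  elim: N j y => [|N IHN] j y ay y1.
    rewrite mul0r; apply: mulr_ge0; first by rewrite subr_ge0.
    by apply: hderiv_ge0; rewrite (le_trans a1).
  have dU := dinB (@din_linM _ _ _ a (@hderiv_din j.+2)) (@dinZ _ _ _ N.+1%:R (@hderiv_din j.+1)).
  rewrite -subr_ge0 -[X in X <= _](_ : (a - a) * hderiv h j.+2 a -
    N.+1%:R * hderiv h j.+1 a = 0); last by rewrite !h0 !mulr0 subr0.
  apply: (din_ndecr dU a1 ay y1) => z /andP[az zy].
  have := IHN j.+1 z (ltW az) (lt_trans zy y1).
  by rewrite -subr_ge0 -natr1 => H; apply: le_trans H _; lra.
apply/eqP; rewrite eq_le hderiv_ge0 ?andbT; last by rewrite (le_trans a1).
rewrite leNgt; apply/negP => h1.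
have := key (Num.bound ((x - a) * hderiv h 2 x / hderiv h 1 x)) 0%N x ax x1.
apply/negP; rewrite -ltNge -ltr_pdivrMr //.
apply: archi_boundP; apply: divr_ge0; last exact: ltW.
apply: mulr_ge0; first by rewrite subr_ge0.
by apply: hderiv_ge0; rewrite (le_trans a1).
Qed.

(** A substitute for analytic continuation. Monotonicity makes [h] constant between [a] and [b], so
    all its derivatives vanish at [a]; [hderiv1_eq0] extends this to the right, and to the left [h']
    is squeezed between 0 and its value at [a]. *)
Lemma constant_of_eq (a b : R) : -1 <= a -> a < b -> b < 1 ->
  hderiv h 0 a = hderiv h 0 b ->
  forall x, -1 <= x < 1 -> hderiv h 0 x = hderiv h 0 a.
Proof.
move=> a1 ab b1 E.
have step j : (forall x, a <= x < b -> hderiv h j x = hderiv h j a) ->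
    forall x, a <= x < b -> hderiv h j.+1 x = 0.
  move=> Hj x /andP[ax xb]; have [xy yb] := midf_lt xb.
  set y := (x + b) / 2 in xy yb.
  have [c /andP[xc cy] Ec] := din_MVT (@hderiv_din j) (le_trans a1 ax) xy (lt_trans yb b1).
  have c0 : hderiv h j.+1 c = 0.
    apply/eqP; move/eqP: Ec; rewrite !Hj ?ax ?xb ?yb ?andbT //; last first.
      by rewrite (le_trans ax) ?ltW.
    by rewrite subrr eq_sym mulf_eq0 subr_eq0 (gt_eqF xy) orbF.
  apply/eqP; rewrite eq_le hderiv_ge0 ?andbT; last first.
    by rewrite (le_trans a1) ?(lt_trans xb).
  rewrite -c0; apply: hderiv_ndecr; first exact: le_trans ax.
    exact: ltW.
  exact: lt_trans (lt_trans cy yb) b1.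
have h0 x : a <= x < b -> hderiv h 0 x = hderiv h 0 a.
  move=> /andP[ax xb]; apply/eqP; rewrite eq_le; apply/andP; split.
    by rewrite E; apply: hderiv_ndecr => //; [exact: le_trans ax | exact: ltW].
  by apply: hderiv_ndecr => //; exact: lt_trans b1.
have hj j x : a <= x < b -> hderiv h j.+1 x = 0.
  elim: j x => [|j IHj] x xab; first by apply: (step 0%N).
  by apply: (step j.+1) => // y yab; rewrite !IHj // lexx.
have d1 x : -1 <= x < 1 -> hderiv h 1 x = 0.
  move=> /andP[xN1 x1]; have [ax|xa] := leP a x.
    by apply: (@hderiv1_eq0 a) => // j; apply: hj; rewrite lexx.
  apply/eqP; rewrite eq_le hderiv_ge0 ?xN1 ?x1 // andbT -(hj 0%N a) ?lexx //.
  by apply: hderiv_ndecr => //; [exact: ltW | exact: lt_trans b1].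
have eqh u v : -1 <= u -> u < v -> v < 1 -> hderiv h 0 u = hderiv h 0 v.
  move=> u1 uv v1; have [c /andP[uc cv] Ec] := din_MVT (@hderiv_din 0) u1 uv v1.
  apply/esym/eqP; rewrite -subr_eq0 Ec d1 ?mul0r //.
  by rewrite (le_trans u1) ?ltW // (lt_trans cv).
move=> x /andP[xN1 x1]; have [xa|ax|->//] := ltgtP x a.
  by apply: eqh => //; exact: lt_trans b1.
by apply/esym; exact: eqh.
Qed.

End AbsolutelyMonotone.

Lemma size_lev_T (R : realType) k e (alpha : nat -> R) :
  size (lev_T k.+1 e alpha) = lev_m k.+1 e.
Proof.
rewrite /lev_T /lev_m subn1 /= !size_cat size_map size_iota /=.
by case: e => /=; lia.
Qed.

(** * Hermite interpolation at the Levenshtein nodes *)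

Section Hermite.
Variables (R : realType) (n : nat) (n_ge2 : (2 <= n)%N) (s : R) (h : R -> \bar R).
Variables (k : nat) (e : bool) (alpha : nat -> R) (g : {poly R}).
Hypotheses (s_bounds : -1 <= s < 1) (hh : abs_monotone h).
Hypotheses (s_interval : lev_interval n k.+1 e s).
Hypotheses (alphaP : lev_nodes n k.+1 e s alpha).
Let T := lev_T k.+1 e alpha.
Let f := lev_poly T.
Hypothesis gP : hermite_interpolant h T g.

(** The simple nodes are [s] and, when [e] holds, -1. Counted with multiplicity there are
    [2k + 1 + e = size T] of them. *)
Let nodes : seq (R * bool) :=
  [seq (alpha i, (e <= i < k + e)%N) | i <- iota 0 (k.+1 + e)].

Let alpha_ge i (ik : (i < k.+1 + e)%N) : -1 <= alpha i :=
  lev_nodes_ge n_ge2 s_bounds s_interval alphaP ik.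
Let alpha_le i (ik : (i < k.+1 + e)%N) : alpha i <= s := lev_nodes_le alphaP ik.

Lemma size_lev_poly : size f = (size T).+1.
Proof. by rewrite size_prod_XsubC. Qed.

Lemma lead_coef_lev_poly : lead_coef f = 1.
Proof. exact/eqP/monic_prod_XsubC. Qed.

Lemma root_lev_poly t : root f t = (t \in T).
Proof. exact: root_prod_XsubC. Qed.

Lemma lev_TP t : reflect (exists2 i, (i < k.+1 + e)%N & t = alpha i) (t \in T).
Proof.
have eT i : (e <= i < k + e)%N -> alpha i \in [seq alpha i | i <- iota e k].
  by move=> /andP[ei ik]; apply: map_f; rewrite mem_iota ei addnC.
apply: (iffP idP).
  rewrite /T /lev_T subn1 /= !mem_cat => /orP[|/orP[|/orP[|]]].
  - by case: (e) => //; rewrite inE => /eqP ->; exists 0%N.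
  - by move=> /mapP[i]; rewrite mem_iota => /andP[_ ik] ->; exists i => //; lia.
  - by move=> /mapP[i]; rewrite mem_iota => /andP[_ ik] ->; exists i => //; lia.
  - by rewrite inE => /eqP ->; exists (k + e)%N; rewrite // addSn.
move=> [i ik ->]; rewrite /T /lev_T subn1 /= !mem_cat.
have [ie|ei] := ltnP i e.
  have [-> ->] : (e : bool) = true /\ i = 0%N by case: (e) ie => //; case: i {ik} => [|[]].
  by rewrite inE eqxx.
move: ik; rewrite addSn ltnS leq_eqVlt => /predU1P[->|ik].
  by rewrite mem_seq1 eqxx !orbT.
by rewrite eT ?ei // orbT.
Qed.

Lemma lev_poly_lt0 (t : R) : -1 <= t <= s -> t \notin T -> f.[t] < 0.
Proof.
move=> t1; rewrite -root_lev_poly => nf.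
by rewrite lt_neqAle nf; exact: (lev_poly_le0 n_ge2 s_bounds s_interval alphaP).
Qed.

Lemma interpolant_node (t : R) : t \in T -> g.[t] = fine (h t).
Proof.
by move=> tT; have [_ /(_ t 0%N)] := gP; apply; rewrite -has_count has_pred1.
Qed.

Lemma interpolant_doubled i : (e <= i < k + e)%N -> g^`().[alpha i] = hderiv h 1 (alpha i).
Proof.
move=> /andP[ei ik]; have [_ /(_ (alpha i) 1%N)] := gP; apply.
have c1 : (0 < count_mem (alpha i) [seq alpha i | i <- iota e k])%N.
  by rewrite -has_count has_pred1 map_f // mem_iota ei addnC.
rewrite /T /lev_T subn1 /= !count_cat; move: c1.
move: (count_mem _ (map alpha _)) => c c1; lia.
Qed.

Lemma lev_poly_deriv_doubled i : (e <= i < k + e)%N -> f^`().[alpha i] = 0.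
Proof.
move=> /andP[ei ik]; rewrite /f (lev_poly_doubled n_ge2 s_bounds s_interval alphaP).
set D := \prod_(j <- iota e k) _; set a := alpha i.
have Da : D.[a] = 0.
  apply/rootP; rewrite /D -(big_map alpha xpredT (fun z => 'X - z%:P)) root_prod_XsubC.
  by rewrite map_f // mem_iota ei addnC.
rewrite mulrAC derivM deriv_exp /= expr1 hornerD !hornerM horner_exp Da.
by rewrite hornerMn hornerM Da; ring.
Qed.

Lemma size_nodes : size nodes = (k.+1 + e)%N.
Proof. by rewrite size_map size_iota. Qed.

Lemma count_nodes : count snd nodes = k.
Proof.
rewrite /nodes; have -> : (k.+1 + e = e + (k + 1))%N by rewrite addn1 addnC.
rewrite count_map iotaD iotaD !count_cat /= add0n [(e + k)%N]addnC ltnn andbF !addn0.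
have -> : count (preim (fun i => (alpha i, (e <= i < k + e)%N)) snd) (iota 0 e) = 0%N.
  by case: (e).
rewrite add0n -[RHS](size_iota e k); apply/eqP; rewrite -all_count; apply/allP => i.
by rewrite mem_iota /= addnC.
Qed.

Lemma uniq_nodes : uniq (unzip1 nodes).
Proof.
have [amono _ _] := alphaP.
rewrite /unzip1 -map_comp map_inj_in_uniq ?iota_uniq // => i j.
rewrite !mem_iota !add0n => /andP[_ ik] /andP[_ jk] /=.
case: (ltngtP i j) => // ij E.
  by have := amono i j; rewrite ij jk E ltxx => /(_ isT).
by have := amono j i; rewrite ij ik E ltxx => /(_ isT).
Qed.

Lemma nodes_zeros (c : R) : {in nodes, forall z : R * bool,
  [/\ -1 <= z.1 < 1, hderiv h 0 z.1 - (g + c *: f)^`(0).[z.1] = 0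
    & (z.2 : bool) -> hderiv h 1 z.1 - (g + c *: f)^`(1).[z.1] = 0]}.
Proof.
move=> z /mapP[i]; rewrite mem_iota /= add0n => ik -> /=.
have aT : alpha i \in T by apply/lev_TP; exists i.
have /rootP fa : root f (alpha i) by rewrite root_lev_poly.
split=> [||ei].
- rewrite alpha_ge //=; apply: le_lt_trans (alpha_le ik) _; by case/andP: s_bounds.
- by rewrite ?derivn0 hornerD hornerZ fa mulr0 addr0 interpolant_node // subrr.
- rewrite ?derivn1 derivD derivZ hornerD hornerZ lev_poly_deriv_doubled // mulr0 addr0.
  by rewrite interpolant_doubled // subrr.
Qed.

Lemma din_interpolation_error (c : R) j :
  din (fun t => hderiv h j t - (g + c *: f)^`(j).[t])
      (fun t => hderiv h j.+1 t - (g + c *: f)^`(j.+1).[t]).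
Proof. by rewrite derivnS; apply: dinB; [exact: hderiv_din | exact: din_horner]. Qed.

(** The nodes alone give [h - g] at least [size g] zeros, enough to reach the derivative of order
    [deg g], at which [g] becomes constant. *)
Lemma lead_coef_interpolant : 0 <= lead_coef g.
Proof.
have [sg _] := gP.
have [->|g0] := eqVneq g 0; first by rewrite lead_coef0.
have [d sgd] : exists d, size g = d.+1.
  by exists (size g).-1; rewrite prednK // size_poly_gt0.
have [|xi xi1] :=
  @derivative_zero _ _ d nodes (@din_interpolation_error 0) uniq_nodes _ (nodes_zeros 0).
  rewrite size_nodes count_nodes; move: sg; rewrite sgd size_lev_T /lev_m; lia.
rewrite scale0r addr0 horner_derivn_size ?sgd // => /eqP; rewrite subr_eq0 => /eqP E.
have := hderiv_ge0 hh d xi1; rewrite E lead_coefE sgd /= pmulrn_lge0 //.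
exact: fact_gt0.
Qed.

Lemma interpolant_ge (t : R) : -1 <= t <= s -> fine (h t) <= g.[t].
Proof.
move=> t1; have [tT|tT] := boolP (t \in T); first by rewrite interpolant_node.
have ft := lev_poly_lt0 t1 tT.
(* With this [c], the point [t] is one more zero of [h - g - c f]. *)
pose c := (fine (h t) - g.[t]) / f.[t].
have cE : c * f.[t] = fine (h t) - g.[t] by rewrite /c divfK // lt_eqF.
have tn : t \notin unzip1 nodes.
  apply: contra tT => /mapP[z /mapP[i]]; rewrite mem_iota add0n => /andP[_ ik] -> E.
  by apply/lev_TP; exists i.
have uL : uniq (unzip1 ((t, false) :: nodes)).
  by apply/andP; split; [exact: tn | exact: uniq_nodes].
have [||xi xi1] := @derivative_zero _ _ (size T) _ (@din_interpolation_error c) uL.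
- change (size T < (size nodes).+1 + (0 + count snd nodes))%N.
  by rewrite size_nodes count_nodes size_lev_T /lev_m; lia.
- move=> z; rewrite inE => /predU1P[->|/nodes_zeros//] /=; split=> //.
    by case/andP: t1 => -> ts /=; apply: le_lt_trans ts _; case/andP: s_bounds.
  by rewrite ?derivn0 hornerD hornerZ cE; rewrite /hderiv /=; ring.
have [sg _] := gP.
rewrite horner_derivn_size; last first.
  rewrite (leq_trans (size_polyD _ _)) // geq_max (leq_trans sg) //=.
  by rewrite (leq_trans (size_scale_leq _ _)) // size_lev_poly.
have fT : f`_(size T) = 1 by rewrite -lead_coef_lev_poly lead_coefE size_lev_poly.
rewrite coefD coefZ fT mulr1 (nth_default _ sg) add0r => /eqP; rewrite subr_eq0 => /eqP E.
have := hderiv_ge0 hh (size T) xi1; rewrite E pmulrn_lge0 ?fact_gt0 // => c0.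
by rewrite -subr_ge0 -opprB -cE oppr_ge0 mulr_ge0_le0 // ltW.
Qed.

End Hermite.

Local Open Scope classical_set_scope.
Local Open Scope ring_scope.

(** * Energy of spherical codes *)

Lemma psum_pairs_eq0 (R : numDomainType) (A : eqType) (r : seq A) (F : A -> A -> R) :
  (forall x y, x \in r -> y \in r -> x != y -> 0 <= F x y) ->
  0 <= \sum_(x <- r) \sum_(y <- r | x != y) F x y /\
  (\sum_(x <- r) \sum_(y <- r | x != y) F x y = 0 <->
   forall x y, x \in r -> y \in r -> x != y -> F x y = 0).
Proof.
move=> F0.
have G0 x : x \in r -> 0 <= \sum_(y <- r | x != y) F x y.
  by move=> xr; rewrite big_seq_cond sumr_ge0 // => y /andP[yr xy]; exact: F0.
split; first by rewrite big_seq sumr_ge0.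
split; last first.
  move=> E; rewrite big_seq big1 // => x xr; rewrite big_seq_cond big1 // => y /andP[yr xy].
  exact: E.
move=> /eqP; rewrite big_seq psumr_eq0 // => /allP H x y xr yr xy.
have := H x xr; rewrite xr big_seq_cond psumr_eq0 => [/allP/(_ y yr)|z /andP[zr xz]].
  by rewrite yr xy => /eqP.
exact: F0.
Qed.

Section Codes.
Variables (R : realType) (n : nat) (n_ge2 : (2 <= n)%N).
Variables (M : nat) (s : R) (C : {fset 'rV[R]_n}).
Hypothesis CP : codes M s C.

Let C_unit x (xC : x \in C) : dotv x x = 1.
Proof. by have [+ _ _] := CP; apply. Qed.

Lemma dotv_bounds x y : x \in C -> y \in C -> -1 <= dotv x y <= 1.
Proof.
move=> /C_unit x1 /C_unit y1.
have H (c : R) : 0 <= \sum_(i < n) (x 0 i + c * y 0 i) ^+ 2.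
  by rewrite sumr_ge0 // => i _; exact: sqr_ge0.
have E c : \sum_(i < n) (x 0 i + c * y 0 i) ^+ 2 = 1 + c ^+ 2 + 2 * c * dotv x y.
  transitivity (dotv x x + c ^+ 2 * dotv y y + 2 * c * dotv x y); last by rewrite x1 y1 mulr1.
  rewrite /dotv !mulr_sumr -!big_split /=.
  by apply: eq_bigr => i _; ring.
have := H 1; have := H (-1); rewrite !E => H1 H2; apply/andP; split; lra.
Qed.

Lemma dotv_le_max x y : x \in C -> y \in C -> x != y -> dotv x y <= s.
Proof.
have [_ _ <-] := CP => xC yC xy; apply: ub_le_sup; last by exists x, y.
(* A supremum dominates its set only when the set is bounded above, hence the bound 1. *)
by exists 1 => _ [u [v [uC vC _ ->]]]; case/andP: (dotv_bounds uC vC).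
Qed.

Lemma moment_ge0 i : 0 <= moment i C.
Proof.
have := @Harmonic.zonal_sum_ge0 R n (gegenbauer R n) _ (fun (x : 'rV[R]_n) j => x 0 j) C i n_ge2.
by apply=> //; exact: gegenbauer_rec.
Qed.

Lemma moment0 : moment 0 C = M%:R ^+ 2.
Proof.
have [_ <- _] := CP; rewrite /moment /=.
under eq_bigr do under eq_bigr do rewrite hornerC.
by rewrite !big_const_seq !count_predT !iter_addr_0 -mulrnA -natrX mulnn.
Qed.

Lemma pair_sum_moments (p : {poly R}) d : (size p <= d)%N ->
  \sum_(x <- C) \sum_(y <- C | x != y) p.[dotv x y] =
  \sum_(i < d) pcoef n p i * moment i C - M%:R * p.[1].
Proof.
move=> pd; apply/eqP; rewrite eq_sym subr_eq; apply/eqP.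
transitivity (\sum_(x <- C) \sum_(y <- C) p.[dotv x y]).
  rewrite {2}(gegenbauer_expansion n_ge2 pd).
  under [RHS]eq_bigr do under eq_bigr do rewrite horner_sum.
  under [RHS]eq_bigr do rewrite exchange_big.
  rewrite exchange_big; apply: eq_bigr => i _.
  rewrite /moment mulr_sumr; apply: eq_bigr => x _.
  by rewrite mulr_sumr; apply: eq_bigr => y _; rewrite hornerZ.
have -> : M%:R * p.[1] = \sum_(x <- C) p.[dotv x x].
  rewrite big_seq (eq_bigr (fun=> p.[1])) => [|x xC]; last by rewrite C_unit.
  rewrite -big_seq big_const_seq count_predT iter_addr_0 mulr_natl.
  by have [_ <- _] := CP.
rewrite -big_split /= big_seq [RHS]big_seq; apply: eq_bigr => x xC.
rewrite (bigD1_seq x) ?fset_uniq //= addrC; congr (_ + _).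
by apply: eq_bigl => y; rewrite eq_sym.
Qed.

Lemma energy_fin (h : R -> \bar R) :
  (forall x y, x \in C -> y \in C -> x != y -> h (dotv x y) \is a fin_num) ->
  energy h C = (\sum_(x <- C) \sum_(y <- C | x != y) fine (h (dotv x y)))%:E.
Proof.
move=> hfin; rewrite /energy -sumEFin big_seq [RHS]big_seq; apply: eq_bigr => x xC.
rewrite -sumEFin big_seq_cond [RHS]big_seq_cond; apply: eq_bigr => y /andP[yC xy].
by rewrite fineK // hfin.
Qed.

End Codes.

(** * Feasibility of the upper polynomial, the energy bound and its equality case *)

Section UpperPolynomial.
Variables (R : realType) (n : nat) (n_ge2 : (2 <= n)%N) (s : R) (h : R -> \bar R).
Variables (k : nat) (e : bool) (alpha rho : nat -> R) (g : {poly R}).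
Hypotheses (s_bounds : -1 <= s < 1) (hh : abs_monotone h).
Hypotheses (s_interval : lev_interval n k.+1 e s).
Hypotheses (alphaP : lev_nodes n k.+1 e s alpha).
Let T := lev_T k.+1 e alpha.
Let f := lev_poly T.
Hypothesis gP : hermite_interpolant h T g.

Let h_fin t (t1 : -1 <= t < 1) : h t \is a fin_num.
Proof. by have [_ + _ _ _] := hh; apply. Qed.

Let le_s_lt1 t (ts : -1 <= t <= s) : -1 <= t < 1.
Proof. by case/andP: ts => -> ts; apply: le_lt_trans ts _; case/andP: s_bounds. Qed.

Let pcoef_f_gt0 i (im : (i <= size T)%N) : 0 < pcoef n f i.
Proof.
have [_] := lev_poly_full n_ge2 s_bounds s_interval alphaP; apply.
by rewrite -(size_lev_T k e alpha).
Qed.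

Let ratio i := pcoef n g i / pcoef n f i.

Lemma lev_lambda_ge i : (1 <= i < size g)%N -> ratio i <= lev_lambda n T g.
Proof.
move=> /andP[i1 ig]; apply: ub_le_sup; last first.
  by exists i => //; rewrite i1 -ltnS prednK // (leq_ltn_trans _ ig).
(* A crude upper bound, showing that the supremum in [lev_lambda] is a genuine one. *)
exists (\sum_(j < size g) `|ratio j|) => _ [j /andP[j1 jg] ->].
have jg' : (j < size g)%N by move: jg; case: (size g) j1 => [|d] //; case: (j).
rewrite (bigD1 (Ordinal jg')) //= (le_trans (ler_norm _)) // lerDl.
by rewrite sumr_ge0.
Qed.

Lemma lev_lambda_eq0 : (size g <= 1)%N -> lev_lambda n T g = 0.
Proof.
move=> g1; rewrite /lev_lambda /Defs.maxset (_ : [set _ | _] = set0) ?sup0 //.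
by apply/seteqP; split=> // r [i]; case: (size g) g1 => [|[]] //; case: i.
Qed.

Lemma lev_lambda_gt0 : (1 < size g)%N -> 0 < lev_lambda n T g.
Proof.
move=> g1; have [d gd] : exists d, size g = d.+2 by case: (size g) g1 => [|[|d]] //; exists d.
apply: lt_le_trans (lev_lambda_ge (i := d.+1) _); last by rewrite gd ltnSn.
have [sg _] := gP; apply: divr_gt0; last by rewrite pcoef_f_gt0 // -ltnS -gd ltnW.
rewrite (pcoef_lead n_ge2 gd) divr_gt0 ?lead_gegenbauer_gt0 // lt_neqAle.
rewrite (lead_coef_interpolant n_ge2 s_bounds hh s_interval alphaP gP) andbT.
by rewrite eq_sym lead_coef_eq0 -size_poly_eq0 gd.
Qed.

Lemma lev_lambda_ge0 : 0 <= lev_lambda n T g.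
Proof.
have [/lev_lambda_eq0->//|/lev_lambda_gt0/ltW//] := leqP (size g) 1.
Qed.

Variable lambda : R.
Hypotheses (lambda_ge0 : 0 <= lambda).
Hypothesis lambda_ge : forall i, (1 <= i < size g)%N -> ratio i <= lambda.
Let p := upper_poly T g lambda.

Lemma upper_poly_horner t : p.[t] = - lambda * f.[t] + g.[t].
Proof. by rewrite hornerD hornerZ. Qed.

Lemma size_upper_poly : (size p <= (lev_m k.+1 e).+1)%N.
Proof.
rewrite -(size_lev_T k e alpha) (leq_trans (size_polyD _ _)) // geq_max.
rewrite (leq_trans (size_scale_leq _ _)) ?size_lev_poly //=.
by have [/leqW] := gP.
Qed.

Lemma upper_poly_node t : t \in T -> p.[t] = fine (h t).
Proof.
move=> tT; rewrite upper_poly_horner (interpolant_node gP tT).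
by have /rootP -> : root f t by [rewrite root_lev_poly]; rewrite mulr0 add0r.
Qed.

Lemma upper_poly_ge t : -1 <= t <= s -> fine (h t) <= p.[t].
Proof.
move=> ts; rewrite upper_poly_horner.
rewrite (le_trans (interpolant_ge n_ge2 s_bounds hh s_interval alphaP gP ts)) //.
by rewrite lerDr mulNr oppr_ge0 mulr_ge0_le0 // (lev_poly_le0 n_ge2 s_bounds s_interval alphaP).
Qed.

Lemma pcoef_upper_poly_le0 i : (1 <= i)%N -> pcoef n p i <= 0.
Proof.
move=> i1; have [pi|ip] := leqP (size p) i; first by rewrite pcoef_default.
have fi : 0 < pcoef n f i.
  apply: pcoef_f_gt0; rewrite -ltnS (leq_trans ip) //.
  by rewrite (size_lev_T k e alpha); exact: size_upper_poly.
rewrite pcoefD // pcoefZ // mulNr addrC subr_le0 -ler_pdivrMr //.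
(* Past the degree of [g] the ratio is 0, and [0 <= lambda] takes over. *)
have [gi|ig] := leqP (size g) i; last by apply: lambda_ge; rewrite i1.
by rewrite (pcoef_default n_ge2 gi) mul0r.
Qed.

Lemma upper_poly_feasible : feasible n h s (fun t => p.[t]).
Proof.
split; first exact/continuous_subspaceT/continuous_horner.
- move=> t ts; rewrite -[h t]fineK ?h_fin ?le_s_lt1 // lee_fin.
  exact: upper_poly_ge.
- exact: pcoef_upper_poly_le0.
Qed.

(** When [lambda] may vanish, strictness has to come from [h]: for constant [g], equality at [t]
    outside [T] gives [h] the same value at [t] and at the node [s], with [t < s]. *)
Lemma upper_poly_gt t :
  0 < lambda \/ (size g <= 1)%N /\
    (exists u v, [/\ -1 <= u <= 1, -1 <= v <= 1 & h u <> h v]) ->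
  -1 <= t <= s -> t \notin T -> fine (h t) < p.[t].
Proof.
move=> H ts tT.
have hg := interpolant_ge n_ge2 s_bounds hh s_interval alphaP gP ts.
have ft := lev_poly_lt0 n_ge2 s_bounds s_interval alphaP ts tT.
rewrite upper_poly_horner; case: H => [l0|[g1 [u [v [u1 v1 uv]]]]].
  by apply: le_lt_trans hg _; rewrite ltrDr mulNr oppr_gt0 nmulr_llt0.
apply: (@lt_le_trans _ _ g.[t]); last first.
  by rewrite lerDr mulNr oppr_ge0 mulr_ge0_le0 // ltW.
rewrite lt_neqAle hg andbT; apply/eqP => E; apply: uv.
have sT : s \in T.
  apply/(lev_TP n_ge2 s_bounds s_interval alphaP); exists (k + e)%N; first by rewrite addSn.
  by have [_ <- _] := alphaP; rewrite subn1.
have hts : hderiv h 0 t = hderiv h 0 s.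
  by rewrite /hderiv /= E -(interpolant_node gP sT) (size1_polyC g1) !hornerC.
have /andP[tN1 tles] := ts; have /andP[_ s1] := s_bounds.
have tls : t < s by rewrite lt_neqAle tles andbT; apply: contraNneq tT => ->.
have cst w : -1 <= w < 1 -> h w = (hderiv h 0 t)%:E.
  by move=> w1; rewrite -(constant_of_eq hh tN1 tls s1 hts w1) [RHS]fineK ?h_fin.
suff cst1 w : -1 <= w <= 1 -> h w = (hderiv h 0 t)%:E by rewrite !cst1.
move=> /andP[wN1]; rewrite le_eqVlt => /predU1P[->|w1]; last by rewrite cst ?wN1.
(* At 1 the potential is known only as a limit, possibly infinite a priori, so uniqueness of limits
   is applied in the extended reals. *)
have [_ _ _ _ h1] := hh; apply: (cvg_unique _ h1); first exact: ereal_hausdorff.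
apply: cvg_near_cst; near=> w'; apply: cst; apply/andP; split; near: w'.
  by apply: nbhs_left_ge; lra.
exact: nbhs_left_lt.
Unshelve. all: end_near. Qed.

Hypothesis rhoP : lev_weights n k.+1 e s alpha rho.
Variables (M : nat) (C : {fset 'rV[R]_n}).
Hypothesis CP : codes M s C.

Let C_bounds x y : x \in C -> y \in C -> x != y -> -1 <= dotv x y <= s.
Proof.
move=> xC yC xy; rewrite (dotv_le_max CP) // andbT.
by case/andP: (dotv_bounds CP xC yC).
Qed.

Let slack := \sum_(x <- C) \sum_(y <- C | x != y) (p.[dotv x y] - fine (h (dotv x y))).
Let B := energy_bound n h M k.+1 e s alpha rho p.

(** An exact identity with two nonnegative defects, the pointwise one and that of the moments, so
    that it yields both the bound and its equality case. *)
Lemma energy_bound_slack :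
  energy h C = (B - (slack - \sum_(i < lev_m k.+1 e) pcoef n p i.+1 * moment i.+1 C))%:E.
Proof.
rewrite (energy_fin (h := h)) => [|x y xC yC xy]; last exact/h_fin/le_s_lt1/C_bounds.
congr EFin; rewrite /slack.
under [X in _ = _ - (X - _)]eq_bigr do rewrite big_split /= sumrN.
rewrite big_split /= sumrN (pair_sum_moments n_ge2 CP size_upper_poly) big_ord_recl.
rewrite (moment0 CP) (rhoP size_upper_poly) /B /energy_bound /=.
have -> : \sum_(i < k.+1 + e) rho i * p.[alpha i] =
    \sum_(i < k.+1 + e) rho i * fine (h (alpha i)).
  apply: eq_bigr => i _; rewrite upper_poly_node //.
  by apply/(lev_TP n_ge2 s_bounds s_interval alphaP); exists i.
ring.
Qed.

Lemma energy_eq_bound :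
  0 < lambda \/ (size g <= 1)%N /\
    (exists u v, [/\ -1 <= u <= 1, -1 <= v <= 1 & h u <> h v]) ->
  energy h C = B%:E <->
  (forall x y, x \in C -> y \in C -> x != y -> dotv x y \in T) /\
  (forall i, (1 <= i)%N -> pcoef n p i * moment i C = 0).
Proof.
move=> alt; rewrite energy_bound_slack.
have F0 x y : x \in C -> y \in C -> x != y -> 0 <= p.[dotv x y] - fine (h (dotv x y)).
  by move=> xC yC xy; rewrite subr_ge0 upper_poly_ge ?C_bounds.
have [slack0 slackP] := psum_pairs_eq0 F0; rewrite -/slack in slack0 slackP.
have G0 (i : 'I_(lev_m k.+1 e)) : true -> 0 <= - (pcoef n p i.+1 * moment i.+1 C).
  by move=> _; rewrite oppr_ge0 mulr_le0_ge0 ?pcoef_upper_poly_le0 ?(moment_ge0 n_ge2 CP).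
have momP : \sum_(i < lev_m k.+1 e) - (pcoef n p i.+1 * moment i.+1 C) = 0 <->
    forall i, (1 <= i)%N -> pcoef n p i * moment i C = 0.
  split=> [/eqP|E]; last by rewrite big1 // => i _; rewrite E ?oppr0.
  rewrite psumr_eq0 // => /allP H [//|i] _.
  have [im|mi] := ltnP i (lev_m k.+1 e); last first.
    by rewrite (pcoef_default n_ge2) ?mul0r // (leq_trans size_upper_poly).
  by have := H (Ordinal im) (mem_index_enum _); rewrite oppr_eq0 => /eqP.
have sumG0 : 0 <= \sum_(i < lev_m k.+1 e) - (pcoef n p i.+1 * moment i.+1 C).
  exact: sumr_ge0.
rewrite -sumrN; split=> [[E]|[inT mom]].
  split; last by apply/momP; lra.
  move=> x y xC yC xy; have /slackP H : slack = 0 by lra.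
  apply: contraT => /(upper_poly_gt alt (C_bounds xC yC xy)).
  by rewrite -subr_gt0 H // ltxx.
congr EFin; rewrite (momP.2 mom) (slackP.2 _) ?addr0 ?subr0 // => x y xC yC xy.
by rewrite upper_poly_node ?inT // subrr.
Qed.

Lemma energy_le_bound : (energy h C <= B%:E)%E.
Proof.
rewrite energy_bound_slack lee_fin gerBl -sumrN addr_ge0 //.
  apply: (proj1 (psum_pairs_eq0 _)) => x y xC yC xy.
  by rewrite subr_ge0 upper_poly_ge ?C_bounds.
rewrite sumr_ge0 // => i _.
by rewrite oppr_ge0 mulr_le0_ge0 ?pcoef_upper_poly_le0 ?(moment_ge0 n_ge2 CP).
Qed.

End UpperPolynomial.

Theorem theorem3p2 (R : realType) (n M : nat) (s : R) (h : R -> \bar R)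
    (k : nat) (e : bool) (alpha rho : nat -> R) (g : {poly R})
    (hn : (2 <= n)%N) (hM : (2 <= M)%N) (hs : -1 <= s < 1)
    (hh : abs_monotone h)
    (hk : (1 <= k)%N) (hsI : lev_interval n k e s)
    (halpha : lev_nodes n k e s alpha)
    (hrho : lev_weights n k e s alpha rho)
    (hg : hermite_interpolant h (lev_T k e alpha) g) :
  let T := lev_T k e alpha in
  (\forall lambda \near +oo,
      feasible n h s (fun t => (upper_poly T g lambda).[t])) /\
  (let fh := upper_poly T g (lev_lambda n T g) in
   let B := energy_bound n h M k e s alpha rho fh in
   [/\ feasible n h s (fun t => fh.[t]),
       (sup_energy n h M s <= B%:E)%E
     & (* The alternative only concerns deg g = 0, where no maximum is taken. *)
       (1 < size g)%N \/
         (exists t u, [/\ -1 <= t <= 1, -1 <= u <= 1 & h t <> h u]) ->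
       forall C : {fset 'rV[R]_n}, codes M s C ->
         (energy h C = B%:E <->
          (forall x y, x \in C -> y \in C -> x != y -> dotv x y \in T) /\
          (forall i, (1 <= i)%N -> pcoef n fh i * moment i C = 0))]).
Proof.
move=> T; case: k => [//|k] in hk hsI halpha hrho hg T *.
have l0 := lev_lambda_ge0 hn hs hh hsI halpha hg.
have lr := @lev_lambda_ge R n k e alpha g.
split.
  near=> lambda.
  have ll : lev_lambda n T g <= lambda by near: lambda; exact/nbhs_pinfty_ge/num_real.
  apply: (upper_poly_feasible hn hs hh hsI halpha hg (le_trans l0 ll)) => i ig.
  exact: le_trans (lr i ig) ll.
split.
- exact: (upper_poly_feasible hn hs hh hsI halpha hg l0 lr).
- apply: ge_ereal_sup => _ [C CP <-].
  exact: (energy_le_bound hn hs hh hsI halpha hg l0 lr hrho CP).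
- move=> alt C CP.
  apply: (energy_eq_bound hn hs hh hsI halpha hg l0 lr hrho CP).
  have [g1|g1] := leqP (size g) 1; last first.
    by left; exact: (lev_lambda_gt0 hn hs hh hsI halpha hg).
  by right; split=> //; case: alt => // ; rewrite ltnNge g1.
Unshelve. all: end_near. Qed.
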